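(* Let $M$ be a complex torus of complex dimension $n$ (so $M$ is diffeomorphic to $\mathbb{T}^{2n}$), and let $\omega_h$ be a Kähler metric on $M$. Suppose $(\omega_{i,0})_{i\in\mathbb{N}}$ is a sequence of Kähler metrics on $M$ such that for some $\Lambda>1$ and some $p>n$: (i) $\mathrm{Vol}(M,\omega_{i,0})\geq \Lambda^{-1}$ for all $i\in\mathbb{N}$; (ii) $\|\operatorname{tr}_{\omega_h}\omega_{i,0}\|_{L^{p}(\omega_{h})} \leq \Lambda$ for all $i\in\mathbb{N}$; (iii) $\mathcal{R}(\omega_{i,0})\geq -i^{-1}$ on $M$ for all $i\in \mathbb{N}$. Then there is a flat Kähler metric $\omega_{\infty}$ on $M$ such that, after passing to a subsequence, $\omega_{i,0}\to \omega_\infty$ in the sense of currents and $$\lim_{i\rightarrow+\infty}\|v_{i,0}-1\|_{L^{q/n}(\omega_{\infty})} = 0\quad\text{for any } 0<q<p,$$ where $v_{i,0}=\frac{\omega_{i,0}^{n}}{\omega_{\infty}^{n}}$. In particular, along this subsequence, $$d\mathrm{vol}_{g_{i,0}}\to d\mathrm{vol}_{g_{\infty}}\quad \text{weakly on }M,$$ where $g_{i,0}$ and $g_{\infty}$ denote the Riemannian metrics associated to $\omega_{i,0}$ and $\omega_{\infty}$ respectively. If in addition (ii) holds for $p=+\infty$, then for any $x,y\in M$ (along this subsequence), $$\limsup_{i\to +\infty} d_{\omega_{i,0}}(x,y)\leq d_{\omega_\infty}(x,y).$$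
   Context: Kähler metrics are smooth and identified with their Kähler forms; $\mathbb{N}=\{1,2,\dots\}$. For Kähler forms $\omega,\omega'$: $\operatorname{tr}_{\omega}\omega' = n\,\frac{\omega'\wedge\omega^{n-1}}{\omega^n}$; $\mathrm{Vol}(M,\omega)=\int_M\omega^n$; $L^p(\omega)$ is taken with respect to the measure $\omega^n$, with $\|f\|_{L^{s}(\omega)}=\left(\int_M|f|^s\,\omega^n\right)^{1/s}$ for every $0<s<\infty$ (only a quasi-norm if $s<1$) and $L^\infty$ the sup norm. $\mathcal{R}(\omega)=\operatorname{tr}_\omega \mathrm{Ric}(\omega)$ is the scalar curvature, where $\mathrm{Ric}(\omega)=-\sqrt{-1}\partial\bar\partial\log\det g$ is the Ricci form. $\omega_i\to\omega_\infty$ in the sense of currents means $\int_M\eta\wedge\omega_i\to\int_M\eta\wedge\omega_\infty$ for every smooth $(n-1,n-1)$-form $\eta$ on $M$. $d_\omega$ is the Riemannian distance of the Riemannian metric associated to $\omega$, and $d\mathrm{vol}_g$ is the Riemannian volume measure; weak convergence of measures means convergence against continuous functions. *)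

(* Defs.v *)
From HB Require Import structures.
From mathcomp Require Import all_boot all_order all_algebra.
From mathcomp Require Import all_classical all_reals all_analysis.
From mathcomp Require Export complex.

Set Implicit Arguments.
Unset Strict Implicit.
Unset Printing Implicit Defensive.

Import Order.TTheory GRing.Theory Num.Theory.
Import numFieldNormedType.Exports.

Local Open Scope ring_scope.
Local Open Scope complex_scope.

(* The complex torus is M = C^n / L.  A point of C^n is x : 'rV[R]_(n + n),
   with z_j = x_(lshift j) + i x_(rshift j); the lattice L is spanned over Z
   by the rows of an invertible matrix B.  Functions, forms and metrics on M
   are the L-periodic ones on C^n, and points of M are represented by their
   lifts to C^n.  All forms are written in the global coframe
   dz_1, .., dz_n, dzbar_1, .., dzbar_n, indexed by 'I_(n + n). *)

Section Calculus.
Variables (R : realType) (m : nat).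
Implicit Types (f : 'rV[R]_m -> R) (a : 'I_m).

Definition partial a f (x : 'rV[R]_m) : R := 'D_(delta_mx 0 a) f x.

Fixpoint Ck (k : nat) f : Prop :=
  continuous f /\
  if k is k'.+1 then
    forall a, (forall x, derivable f x (delta_mx 0 a)) /\ Ck k' (partial a f)
  else True.

Definition smooth f : Prop := forall k, Ck k f.

Definition smoothC (f : 'rV[R]_m -> R[i]) : Prop :=
  smooth (fun x => complex.Re (f x)) /\ smooth (fun x => complex.Im (f x)).

Definition partialC a (f : 'rV[R]_m -> R[i]) (x : 'rV[R]_m) : R[i] :=
  partial a (fun y => complex.Re (f y)) x
  +i* partial a (fun y => complex.Im (f y)) x.

End Calculus.

(* Iterated integral over [0,1]^m; it is only applied to continuous functions,
   for which it is the integral against m-dimensional Lebesgue measure. *)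
Fixpoint cube_integral (R : realType) (m : nat) : ('rV[R]_m -> R) -> R :=
  if m is m'.+1 then fun f =>
    \int[@lebesgue_measure R]_(t in `[0, 1]%classic)
      cube_integral (fun u : 'rV[R]_m' => f (row_mx (t%:M : 'rV[R]_1) u))
  else fun f => f 0.

Section Forms.
Variables (R : realType) (n : nat).
Local Notation idx := 'I_(n + n).

(* An element of the complexified exterior algebra of the cotangent space:
   S |-> coefficient of the wedge, in increasing order, of the coframe elements
   with index in S. *)
Definition ext_form := {ffun {set idx} -> R[i]}.

Definition inversions (A B : {set idx}) : nat :=
  #|[set ab : idx * idx | [&& ab.1 \in A, ab.2 \in B & (ab.2 < ab.1)%N]]|.

Definition wedgef (a b : ext_form) : ext_form :=
  [ffun S : {set idx} => \sum_(A : {set idx} | A \subset S)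
    (-1) ^+ inversions A (S :\: A) * (a A * b (S :\: A))].

Definition coframe (k : idx) : ext_form :=
  [ffun S : {set idx} => (S == [set k])%:R].
Definition dz (j : 'I_n) : ext_form := coframe (lshift n j).
Definition dzbar (j : 'I_n) : ext_form := coframe (rshift n j).
Definition form1 : ext_form :=
  [ffun S : {set idx} => (S == finset.set0)%:R].
Definition wedge_pow (a : ext_form) (k : nat) : ext_form :=
  iter k (wedgef a) form1.

Definition of_type (p q : nat) (a : ext_form) : Prop :=
  forall S : {set idx}, a S != 0 ->
    #|[set j : 'I_n | lshift n j \in S]| = p /\
    #|[set j : 'I_n | rshift n j \in S]| = q.

(* Coefficient of a top-degree form with respect to
   dx_1 /\ dy_1 /\ .. /\ dx_n /\ dy_n, using
   dz_1 /\ .. /\ dz_n /\ dzbar_1 /\ .. /\ dzbar_n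
     = (-1)^(n(n-1)/2) (dz_1 /\ dzbar_1) /\ .. /\ (dz_n /\ dzbar_n)
   and dz /\ dzbar = -2i dx /\ dy. *)
Definition density (a : ext_form) : R[i] :=
  (-1) ^+ 'C(n, 2) * (- 2 * 'i) ^+ n * a [set: idx]%SET.

(* Quotient of two real top-degree forms. *)
Definition form_ratio (a b : ext_form) : R :=
  complex.Re (a [set: idx]%SET / b [set: idx]%SET).

Definition trace_form (w w' : ext_form) : R :=
  n%:R * form_ratio (wedgef w' (wedge_pow w n.-1)) (wedge_pow w n).

(* The (1,1)-form i sum_(j,k) h_(j kbar) dz_j /\ dzbar_k. *)
Definition form11 (h : 'M[R[i]]_n) : ext_form :=
  \sum_j \sum_k ('i * h j k) *: wedgef (dz j) (dzbar k).

(* Value of coframe k on a real tangent vector. *)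
Definition coframe_eval (k : idx) (u : 'rV[R]_(n + n)) : R[i] :=
  match fintype.split k with
  | inl j => u 0 (lshift n j) +i* u 0 (rshift n j)
  | inr j => u 0 (lshift n j) -i* u 0 (rshift n j)
  end.

Definition form2_eval (a : ext_form) (u v : 'rV[R]_(n + n)) : R[i] :=
  \sum_(k : idx) \sum_(l : idx | (k < l)%N) a [set k; l]%SET *
    (coframe_eval k u * coframe_eval l v - coframe_eval k v * coframe_eval l u).

Definition cplxJ (u : 'rV[R]_(n + n)) : 'rV[R]_(n + n) :=
  row_mx (- rsubmx u) (lsubmx u).

(* The Riemannian metric w(u, Jv) of a (1,1)-form w. *)
Definition riem (w : ext_form) (u v : 'rV[R]_(n + n)) : R :=
  complex.Re (form2_eval w u (cplxJ v)).

Definition gram (w : ext_form) : 'M[R]_(n + n) :=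
  \matrix_(a, b) riem w (delta_mx 0 a) (delta_mx 0 b).

Definition riem_density (w : ext_form) : R := Num.sqrt (\det (gram w)).

End Forms.

Section FormFields.
Variables (R : realType) (n : nat).
Local Notation pt := 'rV[R]_(n + n).
Local Notation field := (pt -> ext_form R n).
Implicit Types (al w : field).

Definition d_z (j : 'I_n) (f : pt -> R[i]) (x : pt) : R[i] :=
  (partialC (lshift n j) f x - 'i * partialC (rshift n j) f x) / 2.
Definition d_zbar (j : 'I_n) (f : pt -> R[i]) (x : pt) : R[i] :=
  (partialC (lshift n j) f x + 'i * partialC (rshift n j) f x) / 2.

Definition del al : field := fun x =>
  \sum_j wedgef (dz R j) [ffun S => d_z j (fun y => al y S) x].
Definition delbar al : field := fun x =>
  \sum_j wedgef (dzbar R j) [ffun S => d_zbar j (fun y => al y S) x].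
Definition ext_d al : field := fun x => del al x + delbar al x.

Definition smooth_form al : Prop := forall S, smoothC (fun x => al x S).

(* Levi-Civita connection and curvature of the Riemannian metric of w:
   christoffel c a b = Gamma^c_(ab) and
   curvature d c a b = R^d_(cab). *)
Definition christoffel w (c a b : 'I_(n + n)) (x : pt) : R :=
  2^-1 * \sum_d invmx (gram (w x)) c d *
    (partial a (fun y => gram (w y) b d) x
     + partial b (fun y => gram (w y) a d) x
     - partial d (fun y => gram (w y) a b) x).

Definition curvature w (d c a b : 'I_(n + n)) (x : pt) : R :=
  partial a (christoffel w d b c) x - partial b (christoffel w d a c) x
  + \sum_e (christoffel w d a e x * christoffel w e b c x
            - christoffel w d b e x * christoffel w e a c x).

Definition flat w : Prop := forall d c a b x, curvature w d c a b x = 0.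

End FormFields.

Section Torus.
Local Open Scope classical_set_scope.
Variables (R : realType) (n : nat) (B : 'M[R]_(n + n)).
Local Notation pt := 'rV[R]_(n + n).

Definition lattice (v : pt) : Prop :=
  exists k : 'rV[int]_(n + n), v = map_mx intr k *m B.

Definition lattice_periodic (T : Type) (f : pt -> T) : Prop :=
  forall x v, lattice v -> f (x + v) = f x.

(* Integral of f dx_1 dy_1 .. dx_n dy_n over the fundamental domain
   {t B | t in [0,1]^(2n)}. *)
Definition torus_integral (f : pt -> R) : R :=
  `|\det B| * cube_integral (fun t => f (t *m B)).

Definition form_integral (a : pt -> ext_form R n) : R[i] :=
  torus_integral (fun x => complex.Re (density (a x)))
  +i* torus_integral (fun x => complex.Im (density (a x))).

Definition kahler_form (g : pt -> 'M[R[i]]_n) : pt -> ext_form R n :=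
  fun x => form11 (g x).

(* g is the matrix (g_(j kbar)) of a Kaehler metric on M. *)
Record kahler (g : pt -> 'M[R[i]]_n) : Prop := Kahler {
  kahler_periodic : lattice_periodic g;
  kahler_smooth : forall j k, smoothC (fun x => g x j k);
  kahler_herm : forall x j k, g x k j = (g x j k)^*;
  kahler_pos : forall x (v : 'rV[R[i]]_n), v != 0 ->
    0 < (v *m g x *m (map_mx conjc v)^T) 0 0;
  kahler_closed : forall x, ext_d (kahler_form g) x = 0 }.

(* Ric = - i del delbar log det g.  The determinant of a positive definite
   Hermitian matrix is real, hence the Re. *)
Definition log_det (g : pt -> 'M[R[i]]_n) (x : pt) : R :=
  ln (complex.Re (\det (g x))).
Definition ricci_form (g : pt -> 'M[R[i]]_n) : pt -> ext_form R n := fun x =>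
  - 'i *: del (delbar (fun y => (log_det g y)%:C *: form1 R n)) x.

Definition scalar_curvature (g : pt -> 'M[R[i]]_n) (x : pt) : R :=
  trace_form (kahler_form g x) (ricci_form g x).

(* Integral of f against the measure w^n. *)
Definition measure_integral (w : pt -> ext_form R n) (f : pt -> R) : R :=
  torus_integral (fun x => f x * complex.Re (density (wedge_pow (w x) n))).

Definition volume (w : pt -> ext_form R n) : R := measure_integral w (fun=> 1).

Definition Lnorm_torus (w : pt -> ext_form R n) (s : \bar R)
    (f : pt -> R) : \bar R :=
  match s with
  | s%:E => ((measure_integral w (fun x => `|f x| `^ s)) `^ s^-1)%:E
  | +oo%E => ereal_sup [set `|f x|%:E | x in [set: pt]]
  | -oo%E => 0%E
  end.

Definition riem_integral (w : pt -> ext_form R n) (f : pt -> R) : R :=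
  torus_integral (fun x => f x * riem_density (w x)).

(* Piecewise C^1 curves of M are given as a list of C^1 segments, each
   parametrized by [0,1] and lifted to C^n, whose consecutive endpoints agree
   modulo the lattice. *)
Definition C1_curve (c : R -> pt) : Prop :=
  (forall t, derivable c t 1) /\ continuous (derive1 c).

Fixpoint joins (x : pt) (cs : seq (R -> pt)) (y : pt) : Prop :=
  if cs is c :: cs' then
    [/\ C1_curve c, lattice (c 0 - x) & joins (c 1) cs' y]
  else lattice (y - x).

Definition riem_length (w : pt -> ext_form R n) (cs : seq (R -> pt)) : R :=
  \sum_(c <- cs) \int[@lebesgue_measure R]_(t in `[0, 1])
    Num.sqrt (riem (w (c t)) (derive1 c t) (derive1 c t)).

Definition riem_dist (w : pt -> ext_form R n) (x y : pt) : \bar R :=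
  ereal_inf [set (riem_length w cs)%:E | cs in [set cs | joins x cs y]].

Definition cvg_currents (w : nat -> pt -> ext_form R n)
    (winf : pt -> ext_form R n) :=
  forall eta : pt -> ext_form R n,
    lattice_periodic eta -> smooth_form eta ->
    (forall x, of_type n.-1 n.-1 (eta x)) ->
    (complex.Re (form_integral (fun x => wedgef (eta x) (w k x))) @[k --> \oo]
       --> complex.Re (form_integral (fun x => wedgef (eta x) (winf x)))) /\
    (complex.Im (form_integral (fun x => wedgef (eta x) (w k x))) @[k --> \oo]
       --> complex.Im (form_integral (fun x => wedgef (eta x) (winf x)))).

Definition cvg_volume_weak (w : nat -> pt -> ext_form R n)
    (winf : pt -> ext_form R n) :=
  forall f : pt -> R, lattice_periodic f -> continuous f ->
    riem_integral (w k) f @[k --> \oo] --> riem_integral winf f.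

End Torus.

(* Main.v *)
Require Import Defs.
From HB Require Import structures.
From mathcomp Require Import all_boot all_order all_algebra.
From mathcomp Require Import all_classical all_reals all_analysis.
From mathcomp Require Import ring lra zify.

Set Implicit Arguments.
Unset Strict Implicit.
Unset Printing Implicit Defensive.

Import Order.TTheory GRing.Theory Num.Theory.
Import numFieldNormedType.Exports.

(** Write [g] for a metric of the sequence, [u = det g] for its volume density,
    [M] for the average over the torus and [A = M g] for the average metric,
    which is the constant metric in the cohomology class of [g].  The proof
    works with averages of continuous functions only and solves no equation.

    Oscillation of the volume.  Since [tr_g Ric = - Laplacian_g (ln u)],
    testing with [1 / (1 + u)] and integrating by parts bounds the [g]-energy of
    [ln (1 + u)] by the negative part of the scalar curvature ([energy_mean]);
    the integration by parts is exact because the cofactors of a closed form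
    have divergence zero ([piola]).  As the trace of [g] is bounded in mean, the
    gradient of [ln (1 + u)] tends to zero in L^1 ([gradient_bound]) and so does
    the oscillation of [ln (1 + u)] ([poincare]).  Because [u <= (tr g)^n] is
    bounded in L^r with [r = p / n > 1], this gives [M |u - M u| -> 0]
    ([volume_spread]).

    Convergence of the metrics.  The arithmetic-geometric inequality for [g]
    relative to [A], averaged, bounds [det A] below by [M u]
    ([det_mean_ge]); the same inequality for [A] relative to [g], together with
    the cohomological identity [n M u = M tr (adj g *m A)]
    ([cohomology_pairing]), bounds it above ([det_mean_le]).  Both bounds are
    asymptotically sharp as [u] becomes constant, so [det A - M u] tends to zero
    ([det_mean_cvg]).  Along a subsequence [A] has a limit, which is positive
    definite because the volumes are bounded below.  The trace of [g] relative
    to this limit has mean tending to [n] and its determinant tends to [1] in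
    L^1, so the arithmetic-geometric inequality is nearly an equality in mean;
    its quantitative form [metric_deviation] then yields convergence of [g] to
    the limit in L^1, entry by entry ([metric_cvg]).

    Conclusions.  Convergence of currents and of volumes is immediate, and
    convergence of the density in L^s for [s < r] is interpolation
    ([ratio_power_cvg0]).  For the distances, the curves of a chain for the limit
    metric are translated by a small vector: on average over such vectors the
    lengths for [g] converge, and for uniformly bounded metrics the segments that
    join the translated chain to the endpoints are short ([distance_limsup]). *)

Local Open Scope ring_scope.
Local Open Scope complex_scope.


(** * Exterior algebra of the coframe *)

Section Exterior.
Variables (R : realType) (n : nat).
Local Notation idx := 'I_(n + n).
Implicit Types (S : {set idx}) (b : ext_form R n).

(** Only the summand indexed by [[set k]] survives; its sign counts the elements
    of [S] that [k] passes. *)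
Lemma wedge_coframe k b S :
  wedgef (coframe R k) b S =
  if k \in S then (-1) ^+ #|[set s in S | (s < k)%N]|%SET * b (S :\ k)%SET else 0.
Proof.
rewrite ffunE; case: ifPn => kS; last first.
  apply: big1 => A AS; rewrite ffunE; case: eqP => [A1|_]; last by rewrite mul0r mulr0.
  by move: AS; rewrite A1 finset.sub1set (negbTE kS).
rewrite (bigD1 [set k]%SET) /=; last by rewrite finset.sub1set.
rewrite big1 ?addr0; last first.
  by move=> A /andP[_ /negbTE A1]; rewrite ffunE A1 mul0r mulr0.
rewrite ffunE eqxx mul1r; congr (_ ^+ _ * _).
rewrite /inversions.
rewrite -(card_imset [set s in S | (s < k)%N]%SET (f := fun s => (k, s))); last by move=> ? ? [].
apply: eq_card => -[x y]; rewrite !inE /=; apply/idP/imsetP.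
  case/and3P => /eqP -> /andP[_ yS] yk; exists y => //; by rewrite inE yS yk.
case=> z; rewrite inE => /andP[zS zk] [-> ->]; rewrite eqxx zS zk !andbT /=.
by rewrite neq_ltn zk.
Qed.

Lemma wedgefDl a b c : wedgef (a + b) c = wedgef a c + wedgef b c :> ext_form R n.
Proof.
apply/ffunP => S; rewrite !ffunE -big_split; apply: eq_bigr => A _ /=.
by rewrite ffunE; ring.
Qed.

Lemma wedgefZl (x : R[i]) a b : wedgef (x *: a) b = x *: wedgef a b :> ext_form R n.
Proof.
apply/ffunP => S; rewrite !ffunE scaler_sumr; apply: eq_bigr => A _ /=.
by rewrite ffunE /GRing.scale /=; ring.
Qed.

Lemma wedgefDr a b c : wedgef a (b + c) = wedgef a b + wedgef a c :> ext_form R n.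
Proof.
apply/ffunP => S; rewrite !ffunE -big_split; apply: eq_bigr => A _ /=.
by rewrite ffunE; ring.
Qed.

Lemma wedgefZr (x : R[i]) a b : wedgef a (x *: b) = x *: wedgef a b :> ext_form R n.
Proof.
apply/ffunP => S; rewrite !ffunE scaler_sumr; apply: eq_bigr => A _ /=.
by rewrite ffunE /GRing.scale /=; ring.
Qed.

Lemma wedgef0l b : wedgef 0 b = 0 :> ext_form R n.
Proof. by have := wedgefZl 0 0 b; rewrite !scale0r. Qed.

Lemma wedgef0r b : wedgef b 0 = 0 :> ext_form R n.
Proof. by have := wedgefZr 0 b 0; rewrite !scale0r. Qed.

Lemma wedgef_suml (I : Type) (r : seq I) (P : pred I) (F : I -> ext_form R n) b :
  wedgef (\sum_(i <- r | P i) F i) b = \sum_(i <- r | P i) wedgef (F i) b.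
Proof.
by elim/big_rec2: _ => [|i x y _ <-]; rewrite ?wedgefDl ?wedgef0l.
Qed.

Lemma wedgef_sumr (I : Type) (r : seq I) (P : pred I) (F : I -> ext_form R n) b :
  wedgef b (\sum_(i <- r | P i) F i) = \sum_(i <- r | P i) wedgef b (F i).
Proof.
by elim/big_rec2: _ => [|i x y _ <-]; rewrite ?wedgefDr ?wedgef0r.
Qed.

Lemma dz_dzbarE j k S :
  wedgef (dz R j) (dzbar R k) S = (S == [set lshift n j; rshift n k]%SET)%:R.
Proof.
rewrite wedge_coframe ffunE; case: ifPn => jS; last first.
  by case: eqP => // E; move: jS; rewrite E !inE eqxx.
case: eqP => [E|NE].
  have ES : S = [set lshift n j; rshift n k]%SET by rewrite -(finset.setD1K jS) E.
  rewrite -ES eqxx mulr1 (_ : [set s in S | _]%SET = finset.set0) ?cards0 ?expr0 //.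
  apply/setP => s; rewrite ES !inE; apply/negbTE/negP => /andP[/orP[]/eqP-> /=].
    by rewrite ltnn.
  move=> H; have := leq_trans H (ltnW (ltn_ord j)); lia.
rewrite mulr0; case: eqP => // ES; case: NE; rewrite ES.
apply/setP => s; rewrite !inE.
case: (altP (s =P lshift n j)) => //= ->; apply/esym/negbTE.
by rewrite eq_lrshift.
Qed.

Lemma form11E (h : 'M[R[i]]_n) S :
  form11 h S = \sum_j \sum_k 'i * h j k * (S == [set lshift n j; rshift n k]%SET)%:R.
Proof.
rewrite /form11 sum_ffunE; apply: eq_bigr => j _.
rewrite sum_ffunE; apply: eq_bigr => k _.
by rewrite ffunE dz_dzbarE.
Qed.

Lemma pair_set_inj (j j' k k' : 'I_n) :
  ([set lshift n j; rshift n k] == [set lshift n j'; rshift n k'])%SET = (j == j') && (k == k').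
Proof.
apply/eqP/andP => [E|[/eqP-> /eqP->]//].
have h1 : lshift n j \in [set lshift n j'; rshift n k']%SET by rewrite -E !inE eqxx.
have h2 : rshift n k \in [set lshift n j'; rshift n k']%SET by rewrite -E !inE eqxx orbT.
move: h1 h2; rewrite !inE eq_lrshift eq_rlshift orbF eq_lshift eq_rshift /=.
by move=> -> ->.
Qed.

Lemma form11_lr (h : 'M[R[i]]_n) j k :
  form11 h [set lshift n j; rshift n k]%SET = 'i * h j k.
Proof.
rewrite form11E (bigD1 j) //= (bigD1 k) //= eqxx mulr1.
rewrite big1 ?addr0; last first.
  by move=> k' /negbTE kk; rewrite pair_set_inj eqxx eq_sym kk mulr0.
rewrite big1 ?addr0 // => j' /negbTE jj; apply: big1 => k' _.
by rewrite pair_set_inj eq_sym jj mulr0.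
Qed.

Lemma wedge_form11 (h : 'M[R[i]]_n) b S :
  wedgef (form11 h) b S = \sum_j \sum_k 'i * h j k *
    wedgef (wedgef (dz R j) (dzbar R k)) b S.
Proof.
rewrite /form11 wedgef_suml sum_ffunE; apply: eq_bigr => j _.
rewrite wedgef_suml sum_ffunE; apply: eq_bigr => k _.
by rewrite wedgefZl ffunE.
Qed.

End Exterior.

Section Minors.
Variables (R : realType) (n : nat).
Local Notation idx := 'I_(n + n).
Implicit Types (S : {set idx}) (b : ext_form R n).

Lemma inversionsE (A B : {set idx}) :
  inversions A B = (\sum_(a in A) \sum_(b in B) (b < a))%N.
Proof.
rewrite /inversions -sum1_card pair_big_dep /= big_mkcond [RHS]big_mkcond /=.
apply: eq_bigr => -[x y] _; rewrite !inE /=.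
by case: (x \in A); case: (y \in B) => //=; case: ltnP.
Qed.

(** Multi-indices are parametrized by increasing enumerations, so that removing
    a pair of indices is composition with [lift] and minors are [mxsub]. *)
Definition bidegree_set k (f g : 'I_k -> 'I_n) : {set idx} :=
  ([set lshift n (f a) | a in 'I_k] :|: [set rshift n (g a) | a in 'I_k])%SET.

Lemma bidegree_set_disjoint k (f g : 'I_k -> 'I_n) :
  [disjoint [set lshift n (f a) | a in 'I_k]%SET & [set rshift n (g a) | a in 'I_k]%SET].
Proof.
apply/pred0P => x /=; apply/negbTE/negP => /andP[/imsetP[a _ ->] /imsetP[c _ /eqP]].
by rewrite eq_lrshift.
Qed.

Lemma sum_bidegree_set (T : nmodType) k (f g : 'I_k -> 'I_n) (F : idx -> T) :
  injective f -> injective g ->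
  \sum_(s in bidegree_set f g) F s =
  \sum_a F (lshift n (f a)) + \sum_a F (rshift n (g a)).
Proof.
move=> fi gi; transitivity (\sum_(s in [predU mem [set lshift n (f a) | a in 'I_k]%SET
    & mem [set rshift n (g a) | a in 'I_k]%SET]) F s).
  by apply: eq_bigl => s; rewrite !inE.
rewrite bigU /=; last exact: bidegree_set_disjoint.
rewrite big_imset /=; last by move=> x y _ _ /lshift_inj/fi.
by rewrite big_imset //=; move=> x y _ _ /rshift_inj/gi.
Qed.

Definition increasing k (f : 'I_k -> 'I_n) := {mono f : a c / (a < c)%N}.

Lemma increasing_inj k (f : 'I_k -> 'I_n) : increasing f -> injective f.
Proof.
move=> fm x y E; apply/val_inj; case: (ltngtP x y) => //.
  by rewrite -(fm x y) E ltnn.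
by rewrite -(fm y x) E ltnn.
Qed.

Lemma increasing_lift k (f : 'I_k.+1 -> 'I_n) a :
  increasing f -> increasing (f \o lift a).
Proof.
move=> fm x y; rewrite /comp fm /= /bump.
move: (nat_of_ord x) (nat_of_ord y) (nat_of_ord a) => {}x {}y {}a.
by case: (leqP a x); case: (leqP a y); lia.
Qed.

Lemma sum_ltn_lift k (a : 'I_k.+1) : (\sum_(c < k) (lift a c < a) = a)%N.
Proof.
rewrite (eq_bigr (fun c : 'I_k => (c < a)%N : nat)); last first.
  move=> c _ /=; rewrite /bump; case: (leqP a c) => ac; last by rewrite add0n ac.
  by apply/eqP; rewrite eqb0 -leqNgt ltnW.
transitivity (\sum_(0 <= c < k) (c < a))%N; first by rewrite big_mkord.
rewrite (big_cat_nat_idem _ (n := a)) //=; last by rewrite -ltnS.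
rewrite (eq_big_nat _ _ (F2 := fun=> 1%N)); last by move=> i /andP[_ ->].
rewrite sum_nat_const_nat subn0 muln1 big_nat_cond big1 ?addn0 // => i /andP[/andP[ai _] _].
by rewrite ltnNge ai.
Qed.

(** The holomorphic index passes [a] smaller holomorphic ones; the
    antiholomorphic index passes all [k] remaining holomorphic ones and [c]
    smaller antiholomorphic ones. *)
Lemma inversions_pair k (f g : 'I_k.+1 -> 'I_n) a c :
  increasing f -> increasing g ->
  inversions [set lshift n (f a); rshift n (g c)]%SET
    (bidegree_set (f \o lift a) (g \o lift c)) = (a + c + k)%N.
Proof.
move=> fm gm; rewrite inversionsE big_setU1 /=; last by rewrite inE eq_lrshift.
rewrite big_set1.
have fi := increasing_inj (increasing_lift a fm).
have gi := increasing_inj (increasing_lift c gm).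
have sumE F : (\sum_(s in bidegree_set (f \o lift a) (g \o lift c)) F s =
    \sum_x F (lshift n (f (lift a x))) + \sum_x F (rshift n (g (lift c x))))%N.
  exact: sum_bidegree_set.
rewrite !{}sumE /=.
rewrite [X in (_ + X + _)%N]big1 => [|x _]; last first.
  by apply/eqP; rewrite eqb0 -leqNgt; have := ltn_ord (f a); lia.
rewrite [X in (_ + (X + _))%N](eq_bigr (fun=> 1%N)) => [|x _]; last first.
  by apply/eqP; rewrite eqb1; have := ltn_ord (f (lift a x)); lia.
rewrite sum_nat_const card_ord muln1.
under eq_bigr do rewrite fm.
under [X in (_ + (_ + X))%N]eq_bigr do rewrite ltn_add2l gm.
by rewrite !sum_ltn_lift /=; lia.
Qed.

Lemma mem_bidegree_l k (f g : 'I_k -> 'I_n) j :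
  (lshift n j \in bidegree_set f g) = (j \in codom f).
Proof.
rewrite inE; apply/orP/codomP => [[/imsetP[a _ /lshift_inj->]|/imsetP[a _ /eqP]]|[a ->]].
- by exists a.
- by rewrite eq_lrshift.
- by left; apply: imset_f.
Qed.

Lemma mem_bidegree_r k (f g : 'I_k -> 'I_n) j :
  (rshift n j \in bidegree_set f g) = (j \in codom g).
Proof.
rewrite inE; apply/orP/codomP => [[/imsetP[a _ /eqP]|/imsetP[a _ /rshift_inj->]]|[a ->]].
- by rewrite eq_rlshift.
- by exists a.
- by right; apply: imset_f.
Qed.

Lemma bidegree_setD k (f g : 'I_k.+1 -> 'I_n) a c :
  injective f -> injective g ->
  (bidegree_set f g :\: [set lshift n (f a); rshift n (g c)])%SET =
  bidegree_set (f \o lift a) (g \o lift c).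
Proof.
move=> fi gi; apply/setP => s; rewrite inE.
have codomD (h : 'I_k.+1 -> 'I_n) (hi : injective h) x j :
    (j \in codom (h \o lift x)) = (j != h x) && (j \in codom h).
  apply/codomP/andP => [[y ->]|[jx /codomP[y jy]]].
    by rewrite /= codom_f inj_eq // eq_sym neq_lift.
  rewrite jy; case: (unliftP x y) => [z ->|yx]; first by exists z.
  by move: jx; rewrite jy yx eqxx.
case: (split_ordP s) => j ->.
  by rewrite !mem_bidegree_l codomD // !inE eq_lrshift orbF eq_lshift.
by rewrite !mem_bidegree_r codomD // !inE eq_rlshift eq_rshift.
Qed.

Lemma wedge_pair j k b S :
  wedgef (wedgef (dz R j) (dzbar R k)) b S =
  if [set lshift n j; rshift n k]%SET \subset S then
    (-1) ^+ inversions [set lshift n j; rshift n k]%SET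
              (S :\: [set lshift n j; rshift n k])%SET
    * b (S :\: [set lshift n j; rshift n k])%SET
  else 0.
Proof.
rewrite ffunE; set P := [set _; _]%SET; case: ifPn => PS; last first.
  apply: big1 => A AS; rewrite dz_dzbarE; case: eqP => [A1|_]; last by rewrite mul0r mulr0.
  by move: AS; rewrite A1 (negbTE PS).
rewrite (bigD1 P) //= dz_dzbarE eqxx mul1r big1 ?addr0 //.
by move=> A /andP[_ /negbTE A1]; rewrite dz_dzbarE A1 mul0r mulr0.
Qed.

(** A Laplace expansion over all pairs of a row and a column, as soon as the
    coefficients of [b] are minors. *)
Lemma wedge_form11_bidegree (h : 'M[R[i]]_n) b k (f g : 'I_k.+1 -> 'I_n) :
  increasing f -> increasing g ->
  wedgef (form11 h) b (bidegree_set f g) =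
  'i * (-1) ^+ k * \sum_a \sum_c h (f a) (g c) * ((-1) ^+ (a + c) *
     b (bidegree_set (f \o lift a) (g \o lift c))).
Proof.
move=> fm gm; have fi := increasing_inj fm; have gi := increasing_inj gm.
rewrite wedge_form11.
have red (h' : 'I_k.+1 -> 'I_n) (F : 'I_n -> R[i]) : injective h' ->
    (forall j, j \notin codom h' -> F j = 0) -> \sum_j F j = \sum_a F (h' a).
  move=> hi F0; rewrite (bigID (mem (codom h'))) /= [X in _ + X]big1 // addr0.
  rewrite -(big_imset (h := h') (A := 'I_k.+1) F); last by move=> ? ? _ _ /hi.
  apply: eq_bigl => j /=; apply/idP/imsetP => [/codomP[a ->]|[a _ ->]]; last exact: codom_f.
  by exists a.
rewrite (red f) // => [|j jf]; last first.
  apply: big1 => c _; rewrite wedge_pair ifN ?mulr0 //.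
  by rewrite finset.subUset !finset.sub1set mem_bidegree_l (negbTE jf).
rewrite mulr_sumr; apply: eq_bigr => a _; rewrite (red g) // => [|j jf]; last first.
  rewrite wedge_pair ifN ?mulr0 //.
  by rewrite finset.subUset !finset.sub1set mem_bidegree_r (negbTE jf) andbF.
rewrite mulr_sumr; apply: eq_bigr => c _; rewrite wedge_pair ifT; last first.
  by rewrite finset.subUset !finset.sub1set mem_bidegree_l mem_bidegree_r !codom_f.
by rewrite bidegree_setD // inversions_pair // exprD; ring.
Qed.

(** Expanding the minor along any of its [k.+1] rows gives the same value, and
    the wedge product adds up all these expansions: hence the factorial. *)
Lemma wedge_pow_minor (h : 'M[R[i]]_n) k (f g : 'I_k -> 'I_n) :
  increasing f -> increasing g ->
  wedge_pow (form11 h) k (bidegree_set f g) =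
  'i ^+ k * (-1) ^+ 'C(k, 2) * k`!%:R * \det (mxsub f g h).
Proof.
elim: k f g => [|k IH] f g fm gm.
  rewrite /wedge_pow /= ffunE det_mx00 (_ : 'C(0, 2) = 0%N) // fact0 !expr0 !mulr1.
  rewrite (_ : _ == _ = true) //; apply/eqP/setP => s; rewrite !inE.
  by apply/negbTE/negP => /orP[]/imsetP[[]].
rewrite /wedge_pow iterS wedge_form11_bidegree //.
rewrite (eq_bigr (fun=> 'i ^+ k * (-1) ^+ 'C(k, 2) * k`!%:R * \det (mxsub f g h))); last first.
  move=> a _; rewrite (expand_det_row _ a) mulr_sumr; apply: eq_bigr => c _.
  rewrite -/(wedge_pow _ _) IH; [|exact: increasing_lift|exact: increasing_lift].
  rewrite mxE /cofactor (_ : row' a _ = mxsub (f \o lift a) (g \o lift c) h); last first.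
    by apply/matrixP => x y; rewrite !mxE.
  by ring.
by rewrite sumr_const card_ord -mulr_natr binS bin1 exprD exprS factS natrM; ring.
Qed.

End Minors.

Section TopForms.
Variables (R : realType) (n : nat).
Local Notation idx := 'I_(n + n).

Lemma bidegree_set_id : bidegree_set (@id 'I_n) id = [set: idx]%SET.
Proof.
apply/setP => s; rewrite [RHS]inE; case: (split_ordP s) => j ->.
  by rewrite mem_bidegree_l; apply/codomP; exists j.
by rewrite mem_bidegree_r; apply/codomP; exists j.
Qed.

Lemma top_wedge_pow (h : 'M[R[i]]_n) :
  wedge_pow (form11 h) n [set: idx]%SET = 'i ^+ n * (-1) ^+ 'C(n, 2) * n`!%:R * \det h.
Proof.
by rewrite -bidegree_set_id wedge_pow_minor // (_ : mxsub id id h = h) //; apply/matrixP => x y; rewrite mxE.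
Qed.

End TopForms.

(** Against one other form, the coefficients of the power of [form11 h] are the
    cofactors of [h]. *)
Lemma top_wedge_trace (R : realType) n (h h' : 'M[R[i]]_n.+1) :
  wedgef (form11 h') (wedge_pow (form11 h) n) [set: 'I_(n.+1 + n.+1)]%SET =
  'i ^+ n.+1 * (-1) ^+ 'C(n.+1, 2) * n`!%:R * \tr (\adj h *m h').
Proof.
rewrite -bidegree_set_id wedge_form11_bidegree //.
have E a c : wedge_pow (form11 h) n (bidegree_set (lift a) (lift c)) =
    'i ^+ n * (-1) ^+ 'C(n, 2) * n`!%:R * \det (row' a (col' c h)).
  rewrite wedge_pow_minor; last first.
  - exact: (@increasing_lift _ _ (@id 'I_n.+1) c).
  - exact: (@increasing_lift _ _ (@id 'I_n.+1) a).
  by congr (_ * \det _); apply/matrixP => x y; rewrite !mxE.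
rewrite binS bin1 exprD exprS.
transitivity ('i * (-1) ^+ n * \sum_a \sum_c ('i ^+ n * (-1) ^+ 'C(n, 2) * n`!%:R) * (h' a c * (\adj h) c a)).
  congr (_ * _); apply: eq_bigr => a _; apply: eq_bigr => c _.
  by rewrite E mxE /cofactor; ring.
rewrite (eq_bigr (fun a => ('i ^+ n * (-1) ^+ 'C(n, 2) * n`!%:R) * \sum_c (h' a c * (\adj h) c a))); last by move=> a _; rewrite mulr_sumr.
rewrite -mulr_sumr mxtrace_mulC /mxtrace.
under [in RHS]eq_bigr do rewrite mxE.
by ring.
Qed.

(** * Positive definite Hermitian matrices *)

Section ComplexParts.
Variable R : realType.
Implicit Types z w : R[i].

Lemma Re_add z w : complex.Re (z + w) = complex.Re z + complex.Re w.
Proof. by case: z; case: w. Qed.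
Lemma Im_add z w : complex.Im (z + w) = complex.Im z + complex.Im w.
Proof. by case: z; case: w. Qed.
Lemma Re_opp z : complex.Re (- z) = - complex.Re z.
Proof. by case: z. Qed.
Lemma Im_opp z : complex.Im (- z) = - complex.Im z.
Proof. by case: z. Qed.
Lemma Re_mul z w : complex.Re (z * w) =
  complex.Re z * complex.Re w - complex.Im z * complex.Im w.
Proof. by case: z; case: w. Qed.
Lemma Im_mul z w : complex.Im (z * w) =
  complex.Re z * complex.Im w + complex.Im z * complex.Re w.
Proof. by case: z; case: w. Qed.
Lemma Re_conjc z : complex.Re (conjc z) = complex.Re z.
Proof. by case: z. Qed.
Lemma Im_conjc z : complex.Im (conjc z) = - complex.Im z.
Proof. by case: z. Qed.
Lemma Re_sum (I : Type) (r : seq I) (P : pred I) (F : I -> R[i]) :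
  complex.Re (\sum_(i <- r | P i) F i) = \sum_(i <- r | P i) complex.Re (F i).
Proof. by elim/big_rec2: _ => // i x y _ <-; rewrite Re_add. Qed.
Lemma Im_sum (I : Type) (r : seq I) (P : pred I) (F : I -> R[i]) :
  complex.Im (\sum_(i <- r | P i) F i) = \sum_(i <- r | P i) complex.Im (F i).
Proof. by elim/big_rec2: _ => // i x y _ <-; rewrite Im_add. Qed.
Lemma Re_realM (x : R) z : complex.Re (x%:C * z) = x * complex.Re z.
Proof. by rewrite Re_mul /= mul0r subr0. Qed.
Lemma Im_realM (x : R) z : complex.Im (x%:C * z) = x * complex.Im z.
Proof. by rewrite Im_mul /= mul0r addr0. Qed.
Lemma eq_ReIm z w : complex.Re z = complex.Re w -> complex.Im z = complex.Im w -> z = w.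
Proof. by case: z; case: w => a b c d /= -> ->. Qed.
Lemma mulJ z : z * conjc z = (complex.Re z ^+ 2 + complex.Im z ^+ 2)%:C.
Proof. by apply: eq_ReIm; rewrite ?Re_mul ?Im_mul Re_conjc Im_conjc /=; ring. Qed.

Lemma conjcM z w : conjc (z * w) = conjc z * conjc w.
Proof. exact: rmorphM. Qed.
Lemma conjc_i : conjc 'i = - 'i :> R[i].
Proof. by apply: eq_ReIm; rewrite /= ?oppr0. Qed.

(** The l^1 norm on the complex plane: equivalent to the modulus, with values in
    [R] and without square roots. *)
Definition cabs z : R := `|complex.Re z| + `|complex.Im z|.

Lemma cabs_ge0 z : 0 <= cabs z. Proof. by rewrite addr_ge0. Qed.
Lemma cabsD z w : cabs (z + w) <= cabs z + cabs w.
Proof.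
rewrite /cabs Re_add Im_add; have := ler_normD (complex.Re z) (complex.Re w).
by have := ler_normD (complex.Im z) (complex.Im w); lra.
Qed.
Lemma cabsM z w : cabs (z * w) <= cabs z * cabs w.
Proof.
rewrite /cabs Re_mul Im_mul.
have := ler_normB (complex.Re z * complex.Re w) (complex.Im z * complex.Im w).
have := ler_normD (complex.Re z * complex.Im w) (complex.Im z * complex.Re w).
by rewrite !normrM; lra.
Qed.
Lemma cabs_sum (I : Type) (r : seq I) (P : pred I) (F : I -> R[i]) :
  cabs (\sum_(i <- r | P i) F i) <= \sum_(i <- r | P i) cabs (F i).
Proof.
elim/big_rec2: _ => [|i x y _ le]; first by rewrite /cabs /= normr0 addr0.
by apply: le_trans (cabsD _ _) _; rewrite lerD2l.
Qed.
Lemma cabs_conj z : cabs (conjc z) = cabs z.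
Proof. by rewrite /cabs Re_conjc Im_conjc normrN. Qed.
Lemma cabs_real (x : R) : cabs x%:C = `|x|.
Proof. by rewrite /cabs /= normr0 addr0. Qed.
Lemma Re_le_cabs z : `|complex.Re z| <= cabs z.
Proof. by rewrite lerDl. Qed.
Lemma Im_le_cabs z : `|complex.Im z| <= cabs z.
Proof. by rewrite lerDr. Qed.

Lemma Re_trace_mul n (P h : 'M[R[i]]_n) : complex.Re (\tr (P *m h)) = \sum_j \sum_k
  (complex.Re (P k j) * complex.Re (h j k) - complex.Im (P k j) * complex.Im (h j k)).
Proof.
rewrite mxtrace_mulC /mxtrace Re_sum; apply: eq_bigr => j _.
by rewrite mxE Re_sum; apply: eq_bigr => k _; rewrite Re_mul; ring.
Qed.

End ComplexParts.

Section Hermitian.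
Variables (R : realType).
Local Notation C := R[i].

Definition ctr m n (A : 'M[C]_(m, n)) : 'M[C]_(n, m) := (map_mx conjc A)^T.

Lemma ctrM m n p (A : 'M[C]_(m, n)) (B : 'M[C]_(n, p)) : ctr (A *m B) = ctr B *m ctr A.
Proof. by rewrite /ctr map_mxM trmx_mul. Qed.
Lemma ctrK m n (A : 'M[C]_(m, n)) : ctr (ctr A) = A.
Proof. by apply/matrixP => i j; rewrite !mxE conjcK. Qed.
Lemma ctr1 n : ctr (1%:M : 'M[C]_n) = 1%:M.
Proof. by rewrite /ctr map_mx1 trmx1. Qed.
Lemma det_ctr n (A : 'M[C]_n) : \det (ctr A) = conjc (\det A).
Proof. by rewrite /ctr det_tr det_map_mx. Qed.

Definition selfadjoint n (h : 'M[C]_n) := forall j k, h k j = conjc (h j k).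

Definition posdef n (h : 'M[C]_n) :=
  selfadjoint h /\ forall v : 'rV[C]_n, v != 0 -> 0 < (v *m h *m ctr v) 0 0.

Lemma selfadjointP n (h : 'M[C]_n) : selfadjoint h <-> ctr h = h.
Proof.
split=> [hh|hh j k]; first by apply/matrixP => i j; rewrite !mxE -hh.
by rewrite -{1}hh !mxE.
Qed.

(** The eigenvalues are recorded also as values of the form, from which they
    inherit their sign. *)
Lemma hermitian_spectral n (h : 'M[C]_n) : selfadjoint h ->
  exists (U : 'M[C]_n) (l : 'I_n -> R),
  [/\ U *m ctr U = 1%:M, ctr U *m U = 1%:M,
      h = ctr U *m diag_mx (\row_i (l i)%:C) *m U &
      forall i, (row i U *m h *m ctr (row i U)) 0 0 = (l i)%:C].
Proof.
move=> hh; have herm : h \is hermsymmx.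
  apply/is_hermitianmxP; rewrite expr0 scale1r; apply/matrixP => i j.
  by rewrite !mxE hh.
have := hermitian_spectral_diag_real herm.
have /hermitian_normalmx /orthomx_spectralP := herm.
rewrite invmx_unitary ?spectral_unitarymx //.
have := spectral_unitarymx h.
set U := spectralmx h; set d := spectral_diag h => UU hE dreal.
have UE : map_mx Num.conj U^T = ctr U by rewrite /ctr map_trmx.
have U1 : U *m ctr U = 1%:M by move/unitarymxP: UU; rewrite UE.
pose l i := complex.Re (d 0 i).
have dE : d = \row_i (l i)%:C.
  apply/rowP => i; rewrite mxE RRe_real //; exact: (mxOverP dreal).
exists U, l; split; [exact: U1|exact: mulmx1C|by rewrite -dE -UE|].
move=> i; rewrite hE UE dE !rowE !ctrM -!mulmxA [U *m _]mulmxA U1 mul1mx.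
rewrite !mulmxA -[_ *m U *m _]mulmxA U1 mulmx1 -rowE.
rewrite mxE (bigD1 i) //= big1 ?addr0 => [|j ji].
  by rewrite !mxE !eqxx conjc1 mulr1 mulr1n.
by rewrite !mxE eq_sym (negbTE ji) mulr0n mul0r.
Qed.

Lemma unitary_sum n (U : 'M[C]_n) i : U *m ctr U = 1%:M ->
  \sum_j (complex.Re (U i j) ^+ 2 + complex.Im (U i j) ^+ 2) = 1.
Proof.
move=> UU; have /matrixP/(_ i i) := UU; rewrite !mxE eqxx => E.
have := congr1 (@complex.Re R) E; rewrite Re_sum /= => <-; apply: eq_bigr => j _.
by rewrite !mxE mulJ.
Qed.

Lemma unitary_cabs n (U : 'M[C]_n) i j : U *m ctr U = 1%:M -> cabs (U i j) <= 2.
Proof.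
move=> /(unitary_sum i); rewrite (bigD1 j) //=.
set s := \sum_(_ | _) _ => E.
have s0 : 0 <= s by apply: sumr_ge0 => k _; rewrite addr_ge0 ?sqr_ge0.
have h1 : `|complex.Re (U i j)| <= 1.
  rewrite -(@ler_pXn2r _ 2) ?nnegrE // expr1n -normrX ger0_norm ?sqr_ge0 //.
  by have := sqr_ge0 (complex.Im (U i j)); lra.
have h2 : `|complex.Im (U i j)| <= 1.
  rewrite -(@ler_pXn2r _ 2) ?nnegrE // expr1n -normrX ger0_norm ?sqr_ge0 //.
  by have := sqr_ge0 (complex.Re (U i j)); lra.
by rewrite /cabs; lra.
Qed.

Definition norm2 m (v : 'rV[C]_m) : R :=
  \sum_j (complex.Re (v 0 j) ^+ 2 + complex.Im (v 0 j) ^+ 2).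

Lemma norm2E m (v : 'rV[C]_m) : (v *m ctr v) 0 0 = (norm2 v)%:C.
Proof.
rewrite mxE /norm2 rmorph_sum; apply: eq_bigr => j _ /=.
by rewrite !mxE mulJ.
Qed.

Lemma norm2_ge0 m (v : 'rV[C]_m) : 0 <= norm2 v.
Proof. by apply: sumr_ge0 => k _; rewrite addr_ge0 ?sqr_ge0. Qed.

Lemma norm2_eq0 m (v : 'rV[C]_m) : norm2 v = 0 -> v = 0.
Proof.
move=> /eqP; rewrite psumr_eq0 => [/allP H|k _]; last by rewrite addr_ge0 ?sqr_ge0.
apply/rowP => j; rewrite mxE; have /= := H j (mem_index_enum _).
rewrite paddr_eq0 ?sqr_ge0 // !sqrf_eq0 => /andP[/eqP a /eqP b].
exact: eq_ReIm.
Qed.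

Lemma norm2_gt0 m (v : 'rV[C]_m) : v != 0 -> 0 < norm2 v.
Proof.
move=> v0; rewrite lt_neqAle norm2_ge0 andbT eq_sym; apply: contra v0.
by move/eqP/norm2_eq0 ->.
Qed.

Lemma spectral_form n (U : 'M[C]_n) (l : 'I_n -> R) (v : 'rV[C]_n) :
  (v *m (ctr U *m diag_mx (\row_i (l i)%:C) *m U) *m ctr v) 0 0 =
  (\sum_i l i * (complex.Re ((v *m ctr U) 0 i) ^+ 2
                 + complex.Im ((v *m ctr U) 0 i) ^+ 2))%:C.
Proof.
have -> : v *m (ctr U *m diag_mx (\row_i (l i)%:C) *m U) *m ctr v =
    (v *m ctr U) *m diag_mx (\row_i (l i)%:C) *m ctr (v *m ctr U).
  by rewrite ctrM ctrK !mulmxA.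
set b := v *m ctr U; rewrite mxE rmorph_sum; apply: eq_bigr => i _.
by rewrite mul_mx_diag !mxE rmorphM /= -mulJ; ring.
Qed.

Lemma spectral_trace n (U : 'M[C]_n) (l : 'I_n -> R) : U *m ctr U = 1%:M ->
  \tr (ctr U *m diag_mx (\row_i (l i)%:C) *m U) = (\sum_i l i)%:C.
Proof.
move=> UU; rewrite mxtrace_mulC mulmxA UU mul1mx rmorph_sum /mxtrace.
by apply: eq_bigr => i _; rewrite !mxE eqxx mulr1n.
Qed.

Lemma spectral_det n (U : 'M[C]_n) (l : 'I_n -> R) : U *m ctr U = 1%:M ->
  \det (ctr U *m diag_mx (\row_i (l i)%:C) *m U) = (\prod_i l i)%:C.
Proof.
move=> UU; rewrite !det_mulmx mulrAC -det_mulmx mulmx1C // det1 mul1r det_diag.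
by rewrite rmorph_prod; apply: eq_bigr => i _; rewrite !mxE.
Qed.

Lemma posdef_spectral n (h : 'M[C]_n) : posdef h ->
  exists (U : 'M[C]_n) (l : 'I_n -> R),
  [/\ U *m ctr U = 1%:M, ctr U *m U = 1%:M,
      h = ctr U *m diag_mx (\row_i (l i)%:C) *m U & forall i, 0 < l i].
Proof.
case=> hh hp; have [U [l [U1 U2 hE lE]]] := hermitian_spectral hh.
exists U, l; split=> // i; rewrite -ltcR -lE; apply: hp.
apply/eqP => r0; have := row_mul i U (ctr U); rewrite r0 mul0mx U1.
move/rowP/(_ i); rewrite !mxE eqxx => /eqP; by rewrite oner_eq0.
Qed.

(** A zero eigenvalue would make the determinant vanish.  This is how limits of
    metrics are shown to be metrics. *)
Lemma psd_posdef n (h : 'M[C]_n) : selfadjoint h ->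
  (forall v : 'rV[C]_n, 0 <= complex.Re ((v *m h *m ctr v) 0 0)) ->
  0 < complex.Re (\det h) -> posdef h.
Proof.
move=> hh hp dh; split=> // v v0.
have [U [l [U1 U2 hE lE]]] := hermitian_spectral hh.
have l0 i : 0 <= l i by have := hp (row i U); rewrite lE.
have lp i : 0 < l i.
  rewrite lt_neqAle l0 andbT; apply/eqP => li0.
  by move: dh; rewrite hE spectral_det //= (bigD1 i) //= -li0 mul0r ltxx.
rewrite hE spectral_form ltcR.
have b0 : v *m ctr U != 0.
  apply: contra v0 => /eqP b0; by rewrite -[v]mulmx1 -U2 mulmxA b0 mul0mx.
rewrite lt_neqAle sumr_ge0 ?andbT; last first.
  by move=> i _; rewrite mulr_ge0 // addr_ge0 ?sqr_ge0.
rewrite eq_sym psumr_eq0; last by move=> i _; rewrite mulr_ge0 // addr_ge0 ?sqr_ge0.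
apply: contra b0 => /allP H; apply/eqP/norm2_eq0/eqP.
rewrite /norm2 psumr_eq0; last by move=> i _; rewrite addr_ge0 ?sqr_ge0.
apply/allP => i _; have /= := H i (mem_index_enum _).
by rewrite mulf_eq0 gt_eqF.
Qed.

End Hermitian.

Section AMGM.
Variables (R : realType) (n : nat).
Implicit Types l : 'I_n -> R.

Definition geom_mean l : R := (\prod_j l j) `^ n%:R^-1.

(** The inequality [ln y <= y - 1] at [y = sqrt x]. *)
Lemma ln_deficit (x : R) : 0 < x -> (Num.sqrt x - 1) ^+ 2 <= x - 1 - ln x.
Proof.
move=> x0; have y0 : 0 < Num.sqrt x by rewrite sqrtr_gt0.
rewrite -[in X in _ <= X](sqr_sqrtr (ltW x0)) lnXn //.
have := @le_ln1Dx R (Num.sqrt x - 1); rewrite addrCA subrr addr0.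
move=> /(_ _); rewrite -subr_gt0 opprK subrK => /(_ y0).
rewrite mulr2n expr2; lra.
Qed.

(** Writing [G] for the geometric mean, the numbers [ln (l i / G)] add up to
    zero, so that the arithmetic-geometric deficit is the sum of the
    nonnegative quantities [x - 1 - ln x] at [x = l i / G], each of which
    dominates [(sqrt x - 1)^2]. *)
Lemma amgm_deficit l i : (forall j, 0 < l j) ->
  (Num.sqrt (l i) - Num.sqrt (geom_mean l)) ^+ 2 <= \sum_j l j - n%:R * geom_mean l.
Proof.
move=> lp; set G := geom_mean l; have n0 : (0 < n)%N by case: (n) i => // -[].
have P0 : 0 < \prod_j l j by apply: prodr_gt0.
have G0 : 0 < G by rewrite powR_gt0.
have lnG : n%:R * ln G = \sum_j ln (l j).
  rewrite ln_powR mulrA divff ?mul1r ?pnatr_eq0 -?lt0n //.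
  elim/big_rec2: _ P0 => [|j x y _ IH]; first by rewrite ln1.
  rewrite pmulr_rgt0 // => x0; by rewrite lnM ?posrE // IH.
have sumE : \sum_j (l j / G - 1 - ln (l j / G)) = (\sum_j l j - n%:R * G) / G.
  rewrite !sumrB sumr_const card_ord -mulr_suml.
  have -> : \sum_j ln (l j / G) = 0.
    under eq_bigr do rewrite ln_div ?posrE //.
    by rewrite sumrB sumr_const card_ord -mulr_natl -lnG subrr.
  by rewrite subr0 mulrBl mulfK ?gt_eqF.
have : (Num.sqrt (l i / G) - 1) ^+ 2 <= (\sum_j l j - n%:R * G) / G.
  rewrite -sumE (bigD1 i) //=; apply: le_trans (ln_deficit _) _; first exact: divr_gt0.
  rewrite lerDl; apply: sumr_ge0 => j _.
  by apply: le_trans (ln_deficit _); rewrite ?sqr_ge0 ?divr_gt0.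
rewrite ler_pdivlMr //; apply: le_trans; rewrite le_eqVlt; apply/orP; left; apply/eqP.
have sG : 0 < Num.sqrt G by rewrite sqrtr_gt0.
rewrite -[X in _ * X](sqr_sqrtr (ltW G0)) -exprMn sqrtrM ?(ltW (lp i)) //.
by rewrite sqrtrV ?(ltW G0) // mulrBl mul1r mulfVK // gt_eqF.
Qed.

Lemma amgm l : (0 < n)%N -> (forall j, 0 < l j) ->
  n%:R * geom_mean l <= \sum_j l j.
Proof.
move=> n0 lp; rewrite -subr_ge0.
exact: le_trans (sqr_ge0 _) (amgm_deficit (Ordinal n0) lp).
Qed.

(** Writing a difference as [(sqrt a - sqrt b) (sqrt a + sqrt b)], Young's
    inequality with weight [k] leaves the square of the first factor, which
    the deficit controls. *)
Lemma geom_dist l i (k : R) : (0 < k) -> (forall j, 0 < l j) ->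
  `|l i - geom_mean l| <= k * (\sum_j l j - n%:R * geom_mean l) + 4 / k * \sum_j l j.
Proof.
move=> k0 lp; set G := geom_mean l; have n0 : (0 < n)%N by case: (n) i => // -[].
have G0 : 0 < G by rewrite powR_gt0 // prodr_gt0.
have D := amgm_deficit i lp; rewrite -/G in D.
have GS : n%:R * G <= \sum_j l j by apply: amgm.
have GS1 : G <= \sum_j l j.
  apply: le_trans GS; rewrite ler_peMl ?(ltW G0) // ler1n //.
have lS : l i <= \sum_j l j.
  by rewrite (bigD1 i) //= lerDl; apply: sumr_ge0 => j _; apply: ltW.
move: D GS GS1 lS; set S := \sum_j l j; set T := S - _ => D GS GS1 lS.
have a0 := sqrtr_ge0 (l i); have b0 := sqrtr_ge0 G.
have aE := sqr_sqrtr (ltW (lp i)); have bE := sqr_sqrtr (ltW G0).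
move: a0 b0 aE bE D; set a := Num.sqrt (l i); set b := Num.sqrt G => a0 b0 aE bE D.
rewrite -aE -bE subr_sqr normrM (ger0_norm (addr_ge0 a0 b0)).
have Y : `|a - b| * (a + b) <= k * (a - b) ^+ 2 + (a + b) ^+ 2 / k.
  rewrite -[(a - b) ^+ 2]real_normK ?num_real //.
  move: (normr_ge0 (a - b)) (addr_ge0 a0 b0); set x := `|_|; set y := a + b => x0 y0.
  rewrite -(ler_pM2r k0) mulrDl mulfVK ?gt_eqF //.
  have := sqr_ge0 (k * x - y); have := mulr_ge0 x0 y0; nra.
apply: le_trans Y _; apply: lerD; first by rewrite ler_pM2l.
rewrite [X in _ <= X]mulrAC ler_pM2r ?invr_gt0 //.
have := sqr_ge0 (a - b); nra.
Qed.

End AMGM.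

Section PositiveMatrices.
Variables (R : realType) (n : nat).
Local Notation C := R[i].
Implicit Types (h A : 'M[C]_n).

Definition trR h : R := complex.Re (\tr h).
Definition detR h : R := complex.Re (\det h).

Lemma posdef_det h : posdef h -> \det h = (detR h)%:C.
Proof.
by case/posdef_spectral => U [l [U1 _ hE _]]; rewrite /detR hE spectral_det.
Qed.

Lemma posdef_det_gt0 h : posdef h -> 0 < detR h.
Proof.
case/posdef_spectral => U [l [U1 _ hE lp]]; rewrite /detR hE spectral_det //=.
exact: prodr_gt0.
Qed.

Lemma posdef_trace_ge0 h : posdef h -> 0 <= trR h.
Proof.
case/posdef_spectral => U [l [U1 _ hE lp]]; rewrite /trR hE spectral_trace //=.
by apply: sumr_ge0 => i _; apply: ltW.
Qed.

Lemma posdef_trace_gt0 h : (0 < n)%N -> posdef h -> 0 < trR h.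
Proof.
move=> n0 /posdef_spectral[U [l [U1 _ hE lp]]]; rewrite /trR hE spectral_trace //=.
rewrite (bigD1 (Ordinal n0)) //= ltr_pwDl // sumr_ge0 // => i _; exact: ltW.
Qed.

Lemma posdef_unit h : posdef h -> h \in unitmx.
Proof.
move=> hp; rewrite unitmxE unitfE posdef_det //.
by rewrite eq_complex /= eqxx andbT gt_eqF ?posdef_det_gt0.
Qed.

Lemma posdef_det_le h : posdef h -> detR h <= trR h ^+ n.
Proof.
case/posdef_spectral => U [l [U1 _ hE lp]].
rewrite /trR /detR hE spectral_trace // spectral_det //=.
have -> : (\sum_i l i) ^+ n = \prod_(i < n) \sum_j l j by rewrite prodr_const card_ord.
apply: ler_prod => i _; rewrite ltW //= (bigD1 i) //= lerDl.
by apply: sumr_ge0 => j _; apply: ltW.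
Qed.

Lemma posdef_amgm h : (0 < n)%N -> posdef h ->
  n%:R * detR h `^ n%:R^-1 <= trR h.
Proof.
move=> n0 /posdef_spectral[U [l [U1 _ hE lp]]].
by rewrite /trR /detR hE spectral_trace // spectral_det //=; apply: amgm.
Qed.

Lemma spectral_entry (U : 'M[C]_n) (l : 'I_n -> R) j k :
  (ctr U *m diag_mx (\row_i (l i)%:C) *m U) j k =
  \sum_i conjc (U i j) * (l i)%:C * U i k.
Proof.
rewrite mxE; apply: eq_bigr => i _; by rewrite mul_mx_diag !mxE.
Qed.

Lemma spectral_entry_le (U : 'M[C]_n) (l : 'I_n -> R) j k :
  U *m ctr U = 1%:M ->
  cabs (\sum_i conjc (U i j) * (l i)%:C * U i k) <= 4 * \sum_i `|l i|.
Proof.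
move=> U1; apply: le_trans (cabs_sum _ _ _) _; rewrite mulr_sumr.
apply: ler_sum => i _; apply: le_trans (cabsM _ _) _.
apply: (@le_trans _ _ ((2 * `|l i|) * 2)); last by lra.
apply: ler_pM; rewrite ?cabs_ge0 ?unitary_cabs //.
apply: le_trans (cabsM _ _) _; rewrite cabs_real cabs_conj ler_wpM2r //.
exact: unitary_cabs.
Qed.

Lemma posdef_entry_le h j k : posdef h -> cabs (h j k) <= 4 * trR h.
Proof.
case/posdef_spectral => U [l [U1 U2 hE lp]]; rewrite /trR hE spectral_trace //=.
rewrite spectral_entry; apply: le_trans (spectral_entry_le _ _ _ U1) _.
by apply: ler_wpM2l => //; apply: ler_sum => i _; rewrite gtr0_norm.
Qed.

(** Near-equality in the arithmetic-geometric inequality makes all eigenvalues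
    nearly equal to their geometric mean. *)
Lemma posdef_near_scalar h j k (K : R) : 0 < K -> posdef h ->
  cabs (h j k - ((detR h `^ n%:R^-1)%:C)%:M j k) <=
  4 * n%:R * (K * (trR h - n%:R * detR h `^ n%:R^-1) + 4 / K * trR h).
Proof.
move=> K0 /posdef_spectral[U [l [U1 U2 hE lp]]].
rewrite /trR /detR hE spectral_trace // spectral_det //=.
rewrite -/(geom_mean l); set G := geom_mean l.
have -> : (G%:C)%:M = ctr U *m diag_mx (\row_i G%:C) *m U.
  rewrite (_ : diag_mx _ = (G%:C)%:M); last first.
    by apply/matrixP => a b; rewrite !mxE.
  by rewrite mul_mx_scalar -scalemxAl U2 scalemx1.
rewrite !spectral_entry -sumrB.
rewrite (eq_bigr (fun i => conjc (U i j) * (l i - G)%:C * U i k)); last first.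
  by move=> i _; rewrite rmorphB /=; ring.
apply: le_trans (spectral_entry_le _ _ _ U1) _.
rewrite -mulrA ler_pM2l ?ltr0n //.
apply: le_trans (_ : \sum_(i < n) (K * (\sum_j l j - n%:R * G) + 4 / K * \sum_j l j) <= _).
  by apply: ler_sum => i _; apply: geom_dist.
by rewrite sumr_const card_ord -[X in X <= _]mulr_natl.
Qed.

(** A square root, up to a unitary factor: congruence by [P] turns [h] into the
    identity matrix. *)
Lemma posdef_factor h : posdef h ->
  exists P Q : 'M[C]_n, [/\ P *m Q = 1%:M, Q *m P = 1%:M & h = Q *m ctr Q].
Proof.
case/posdef_spectral => U [l [U1 U2 hE lp]].
have s0 i : Num.sqrt (l i) != 0 by rewrite gt_eqF // sqrtr_gt0.
pose D := diag_mx (\row_i (Num.sqrt (l i))%:C) : 'M[C]_n.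
pose E := diag_mx (\row_i ((Num.sqrt (l i))^-1)%:C) : 'M[C]_n.
have DE : D *m E = 1%:M.
  apply/matrixP => i j; rewrite mul_diag_mx !mxE; case: eqP => [->|_].
    by rewrite !mulr1n -rmorphM /= divff.
  by rewrite !mulr0n mulr0.
have ED : E *m D = 1%:M by apply: mulmx1C.
exists (E *m U), (ctr U *m D); split.
- by rewrite mulmxA -[_ *m ctr U]mulmxA U1 mulmx1.
- by rewrite mulmxA -[_ *m E]mulmxA DE mulmx1.
- have Dc : ctr D = D.
    apply/matrixP => i j; rewrite !mxE eq_sym; case: eqP => [->|_].
      by rewrite !mulr1n conjc_real.
    by rewrite !mulr0n conjc0.
  rewrite ctrM ctrK Dc hE !mulmxA; congr (_ *m _); rewrite -!mulmxA; congr (_ *m _).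
  apply/matrixP => i j; rewrite mul_diag_mx !mxE; case: eqP => [->|_].
    by rewrite !mulr1n -rmorphM /= -expr2 sqr_sqrtr // ltW.
  by rewrite !mulr0n mulr0.
Qed.

Lemma posdef_congr h (P Q : 'M[C]_n) : P *m Q = 1%:M -> posdef h -> posdef (P *m h *m ctr P).
Proof.
move=> PQ [hh hp]; split.
  by apply/selfadjointP; rewrite !ctrM ctrK (selfadjointP h).1 // mulmxA.
move=> v v0; have := hp (v *m P); rewrite ctrM !mulmxA; apply.
by apply: contra v0 => /eqP vP; rewrite -[v]mulmx1 -PQ mulmxA vP mul0mx.
Qed.

Lemma posdef1 : posdef (1%:M : 'M[C]_n).
Proof.
split; first by apply/selfadjointP; rewrite ctr1.
by move=> v v0; rewrite mulmx1 norm2E ltcR norm2_gt0.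
Qed.

Lemma congr_det h A (P Q : 'M[C]_n) : P *m Q = 1%:M -> A = Q *m ctr Q -> posdef h -> posdef A ->
  detR (P *m h *m ctr P) = detR h / detR A.
Proof.
move=> PQ AE hp Ap; apply/eqP; rewrite eq_sym -(can_eq (@mulfK _ (detR A) _)); last first.
  by rewrite gt_eqF ?posdef_det_gt0.
rewrite mulfVK; last by rewrite gt_eqF ?posdef_det_gt0.
have E1 := posdef_det (posdef_congr PQ hp).
have E2 := posdef_det hp; have E3 := posdef_det Ap.
rewrite -(inj_eq (@complexI R)) rmorphM /= -E1 -E2 -E3 AE !det_mulmx !det_ctr.
have : \det P * \det Q = 1 by rewrite -det_mulmx PQ det1.
move=> PQ1; have PQ2 := congr1 conjc PQ1; rewrite rmorphM rmorph1 /= in PQ2.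
apply/eqP; rewrite -[LHS]mulr1 -[in LHS]PQ1 -[LHS]mulr1 -[in LHS]PQ2; ring.
Qed.

Lemma congr_trace h A (P Q : 'M[C]_n) : P *m Q = 1%:M -> A = Q *m ctr Q ->
  \tr (P *m h *m ctr P) = \tr (invmx A *m h).
Proof.
move=> PQ AE; have QP := mulmx1C PQ.
have iA : invmx A = ctr P *m P.
  have AP : A *m (ctr P *m P) = 1%:M.
    by rewrite AE mulmxA -[_ *m ctr P]mulmxA -ctrM PQ ctr1 mulmx1.
  by have [Au _] := mulmx1_unit AP; rewrite -[LHS]mulmx1 -AP mulKmx.
by rewrite mxtrace_mulC mulmxA iA.
Qed.

Lemma posdef_trace_mul h A : posdef h -> posdef A ->
  0 <= complex.Re (\tr (h *m A)) <= trR h * trR A.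
Proof.
move=> hp Ap; have [U [l [U1 U2 hE lp]]] := posdef_spectral hp.
have N : posdef (U *m A *m ctr U) by exact: (posdef_congr U1 Ap).
have nn i : 0 <= complex.Re ((U *m A *m ctr U) i i).
  have rU : row i U != 0.
    apply/eqP => r0; have := row_mul i U (ctr U); rewrite r0 mul0mx U1.
    by move/rowP/(_ i); rewrite !mxE eqxx => /eqP; rewrite oner_eq0.
  have := Ap.2 _ rU; rewrite ltcE => /andP[_ /ltW].
  congr (0 <= complex.Re _); rewrite -!row_mul !mxE; apply: eq_bigr => j _.
  by rewrite !mxE.
have trE : \tr (U *m A *m ctr U) = \tr A by rewrite mxtrace_mulC mulmxA U2 mul1mx.
have -> : complex.Re (\tr (h *m A)) = \sum_i l i * complex.Re ((U *m A *m ctr U) i i).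
  rewrite hE -!mulmxA mxtrace_mulC -!mulmxA (mulmxA U) /mxtrace Re_sum.
  apply: eq_bigr => i _; rewrite mul_diag_mx !mxE.
  by rewrite Re_realM.
rewrite sumr_ge0 /= => [|i _]; last by rewrite mulr_ge0 // ltW.
have -> : trR A = \sum_i complex.Re ((U *m A *m ctr U) i i).
  by rewrite /trR -trE /mxtrace Re_sum.
rewrite mulr_sumr; apply: ler_sum => i _; rewrite ler_wpM2r //.
rewrite /trR hE spectral_trace //= (bigD1 i) //= lerDl.
by apply: sumr_ge0 => j _; apply: ltW.
Qed.

(** After congruence by a factor of [A] this is [tr (H N) <= tr H * tr N] with
    [tr N = tr A]. *)
Lemma posdef_trace_compare h A : posdef h -> posdef A ->
  0 <= complex.Re (\tr (invmx A *m h)) /\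
  trR h <= trR A * complex.Re (\tr (invmx A *m h)).
Proof.
move=> hp Ap; have [P [Q [PQ QP AE]]] := posdef_factor Ap.
have Hp := posdef_congr PQ hp; rewrite -(congr_trace h PQ AE).
have Np : posdef (ctr Q *m Q).
  have cQP : ctr Q *m ctr P = 1%:M by rewrite -ctrM PQ ctr1.
  by have := posdef_congr cQP posdef1; rewrite mulmx1 ctrK.
split; first exact: posdef_trace_ge0.
have /andP[_] := posdef_trace_mul Hp Np.
have -> : trR (ctr Q *m Q) = trR A by rewrite /trR mxtrace_mulC AE.
rewrite mulrC; congr (_ <= _); rewrite /trR; congr (complex.Re _).
rewrite mxtrace_mulC -!mulmxA mxtrace_mulC -!mulmxA.
have -> : ctr P *m ctr Q = 1%:M by rewrite -ctrM QP ctr1.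
by rewrite mulmx1 mulmxA QP mul1mx.
Qed.

Lemma posdef_amgm_compare h A : (0 < n)%N -> posdef h -> posdef A ->
  n%:R * (detR h / detR A) `^ n%:R^-1 <= complex.Re (\tr (invmx A *m h)).
Proof.
move=> n0 hp Ap; have [P [Q [PQ QP AE]]] := posdef_factor Ap.
rewrite -(congr_trace h PQ AE) -(congr_det PQ AE hp Ap).
exact: posdef_amgm n0 (posdef_congr PQ hp).
Qed.

(** No eigenvalue of [h] exceeds its trace. *)
Lemma posdef_inv_form h (v : 'rV[C]_n) : posdef h ->
  norm2 v <= trR h * complex.Re ((v *m invmx h *m ctr v) 0 0).
Proof.
move=> hp; have [U [l [U1 U2 hE lp]]] := posdef_spectral hp.
have iE : invmx h = ctr U *m diag_mx (\row_i ((l i)^-1)%:C) *m U.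
  have hI : h *m (ctr U *m diag_mx (\row_i ((l i)^-1)%:C) *m U) = 1%:M.
    rewrite hE !mulmxA -[_ *m U *m ctr U]mulmxA U1 mulmx1.
    rewrite -[_ *m diag_mx _ *m diag_mx _]mulmxA.
    have -> : diag_mx (\row_i (l i)%:C) *m diag_mx (\row_i ((l i)^-1)%:C) = 1%:M.
      apply/matrixP => i j; rewrite mul_diag_mx !mxE; case: eqP => [->|_].
        by rewrite !mulr1n -rmorphM /= divff // gt_eqF.
      by rewrite !mulr0n mulr0.
    by rewrite mulmx1 U2.
  by have [hu _] := mulmx1_unit hI; rewrite -[LHS]mulmx1 -hI mulKmx.
rewrite iE spectral_form /= {1}/trR hE spectral_trace //=.
have -> : norm2 v = norm2 (v *m ctr U).
  by apply: complexI; rewrite -!norm2E ctrM ctrK mulmxA -[_ *m ctr U *m U]mulmxA U2 mulmx1.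
rewrite mulr_sumr; apply: ler_sum => i _; rewrite mulrA ler_peMl //.
  by rewrite addr_ge0 ?sqr_ge0.
rewrite ler_pdivlMr // mul1r (bigD1 i) //= lerDl.
by apply: sumr_ge0 => j _; apply: ltW.
Qed.

End PositiveMatrices.

(** * Volume, trace and Riemannian metric of a (1,1)-form *)

Section VolumeForm.
Variables (R : realType) (n : nat).
Local Notation C := R[i].
Implicit Types (h k : 'M[C]_n).

Lemma i_neq0 : ('i : C) != 0.
Proof. by rewrite eq_complex /= oner_eq0 andbF. Qed.

Lemma top_const_neq0 m : ('i : C) ^+ n * (-1) ^+ m != 0.
Proof. by rewrite mulf_neq0 ?expf_neq0 ?i_neq0 // oppr_eq0 oner_eq0. Qed.

Lemma density_wedge_pow h :
  density (wedge_pow (form11 h) n) = (2 ^+ n * n`!%:R) * \det h.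
Proof.
rewrite /density top_wedge_pow.
have E : (- 2 * 'i) ^+ n * 'i ^+ n = 2 ^+ n :> C.
  by rewrite -exprMn -mulrA -expr2 sqr_i mulrNN mulr1.
have S : (-1) ^+ 'C(n, 2) * (-1) ^+ 'C(n, 2) = 1 :> C by rewrite -expr2 sqrr_sign.
transitivity (((-1) ^+ 'C(n, 2) * (-1) ^+ 'C(n, 2)) * ((- 2 * 'i) ^+ n * 'i ^+ n) *
   (n`!%:R * \det h) : C); first by ring.
by rewrite E S mul1r mulrA.
Qed.

Lemma form_ratio_wedge_pow h k :
  form_ratio (wedge_pow (form11 h) n) (wedge_pow (form11 k) n) =
  complex.Re (\det h / \det k).
Proof.
rewrite /form_ratio !top_wedge_pow; congr (complex.Re _).
have c0 : 'i ^+ n * (-1) ^+ 'C(n, 2) * n`!%:R != 0 :> C.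
  by rewrite mulf_neq0 ?top_const_neq0 // pnatr_eq0 -lt0n fact_gt0.
by rewrite -mulf_div divff // mul1r.
Qed.

Lemma posdef_ratio h k : posdef h -> posdef k ->
  form_ratio (wedge_pow (form11 h) n) (wedge_pow (form11 k) n) = detR h / detR k.
Proof.
move=> hp kp; rewrite form_ratio_wedge_pow (posdef_det hp) (posdef_det kp).
by rewrite -fmorphV -rmorphM.
Qed.

Lemma posdef_density h : posdef h ->
  complex.Re (density (wedge_pow (form11 h) n)) = 2 ^+ n * n`!%:R * detR h.
Proof.
move=> hp; rewrite density_wedge_pow posdef_det //.
have -> : (2 ^+ n * n`!%:R : C) = (2 ^+ n * n`!%:R : R)%:C.
  by rewrite rmorphM rmorphXn !rmorph_nat.
by rewrite Re_realM.
Qed.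

End VolumeForm.

Lemma trace_form11 (R : realType) n (h h' : 'M[R[i]]_n) : (0 < n)%N -> h \in unitmx ->
  trace_form (form11 h) (form11 h') = complex.Re (\tr (invmx h *m h')).
Proof.
case: n h h' => // n h h' _ hu; rewrite /trace_form /form_ratio /=.
rewrite top_wedge_trace top_wedge_pow /invmx hu -scalemxAl linearZ /=.
have d0 : \det h != 0 by rewrite -unitfE -unitmxE.
have c0 : 'i ^+ n.+1 * (-1) ^+ 'C(n.+1, 2) * n`!%:R != 0 :> R[i].
  by rewrite mulf_neq0 ?top_const_neq0 // pnatr_eq0 -lt0n fact_gt0.
have -> : n.+1%:R = complex.Re (n.+1%:R : R[i]).
  by rewrite -(rmorph_nat (@real_complex_def R (Phant R))).
rewrite factS natrM.
have -> (z : R[i]) : complex.Re (n.+1%:R : R[i]) * complex.Re z = complex.Re (n.+1%:R * z).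
  by rewrite -(rmorph_nat (@real_complex_def R (Phant R))) Re_realM.
congr (complex.Re _); have n0 : n.+1%:R != 0 :> R[i] by rewrite pnatr_eq0.
move: (\tr _) (\det h) d0 c0 n0 => t d d0 c0 n0.
have f0 : n`!%:R != 0 :> R[i] by rewrite pnatr_eq0 -lt0n fact_gt0.
have i0 : 'i ^+ n.+1 != 0 :> R[i] by rewrite expf_neq0 ?i_neq0.
have s0 : (-1) ^+ 'C(n.+1, 2) != 0 :> R[i] by rewrite expf_neq0 // oppr_eq0 oner_eq0.
move: ('i ^+ n.+1) ((-1) ^+ _) (n`!%:R) (n.+1%:R) f0 i0 s0 n0 => a b e f *.
by field; apply/and5P; split.
Qed.

Section RiemannianMetric.
Variables (R : realType) (n : nat).
Local Notation C := R[i].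
Local Notation pt := 'rV[R]_(n + n).
Implicit Types (h : 'M[C]_n) (u v : pt).

Definition zcoord u : 'rV[C]_n := \row_j (u 0 (lshift n j) +i* u 0 (rshift n j)).

Lemma coframe_eval_l j u : coframe_eval (lshift n j) u = zcoord u 0 j.
Proof.
by rewrite /coframe_eval (_ : fintype.split _ = inl j) ?mxE // -[lshift n j]/(unsplit (inl j)) unsplitK.
Qed.

Lemma coframe_eval_r j u : coframe_eval (rshift n j) u = conjc (zcoord u 0 j).
Proof.
by rewrite /coframe_eval (_ : fintype.split _ = inr j) ?mxE // -[rshift n j]/(unsplit (inr j)) unsplitK.
Qed.

Lemma zcoord_J u j : zcoord (cplxJ u) 0 j = 'i * zcoord u 0 j.
Proof.
rewrite [LHS]mxE /cplxJ row_mxEl row_mxEr !mxE; apply: (@eq_ReIm R); rewrite ?Re_mul ?Im_mul /=; ring.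
Qed.

Lemma form2_eval_form11 h u v :
  form2_eval (form11 h) u v = \sum_j \sum_k 'i * h j k *
    (zcoord u 0 j * conjc (zcoord v 0 k) - conjc (zcoord u 0 k) * zcoord v 0 j).
Proof.
rewrite /form2_eval big_split_ord /= [X in _ + X]big1 ?addr0; last first.
  move=> k _; apply: big1 => l kl; rewrite form11E big1 ?mul0r // => a _.
  rewrite big1 // => b _; case: eqP => [E|_]; last by rewrite mulr0.
  have : lshift n a \in [set rshift n k; l]%SET by rewrite E !inE eqxx.
  rewrite !inE eq_lrshift /= => /eqP lE; move: kl; rewrite -lE /=.
  by have := ltn_ord a; lia.
apply: eq_bigr => j _; rewrite big_mkcond big_split_ord /= big1 ?add0r; last first.
  move=> k _; case: ifP => // jk; rewrite form11E big1 ?mul0r // => a _.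
  rewrite big1 // => b _; case: eqP => [E|_]; last by rewrite mulr0.
  have : rshift n b \in [set lshift n j; lshift n k]%SET by rewrite E !inE eqxx orbT.
  by rewrite !inE !eq_rlshift.
apply: eq_bigr => k _; rewrite ifT; last by have := ltn_ord j; lia.
rewrite form11_lr !coframe_eval_l !coframe_eval_r.
by ring.
Qed.

(** The symmetrisation of the Hermitian form: for [h] the identity this is
    twice the Euclidean inner product. *)
Lemma riem_form11 h u v : selfadjoint h ->
  riem (form11 h) u v =
  2 * complex.Re (\sum_j \sum_k h j k * (zcoord u 0 j * conjc (zcoord v 0 k))).
Proof.
move=> hh; rewrite /riem form2_eval_form11.
pose S := \sum_j \sum_k h j k * (zcoord u 0 j * conjc (zcoord v 0 k)).
have SJ : conjc S = \sum_j \sum_k h j k * (conjc (zcoord u 0 k) * zcoord v 0 j).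
  rewrite rmorph_sum exchange_big /=; apply: eq_bigr => j _.
  rewrite rmorph_sum; apply: eq_bigr => k _.
  by rewrite !rmorphM /= conjcK -hh.
transitivity (complex.Re (S + conjc S)); last by rewrite Re_add Re_conjc /S; lra.
congr (complex.Re _); rewrite SJ -big_split; apply: eq_bigr => j _ /=.
rewrite -big_split; apply: eq_bigr => k _ /=; rewrite !zcoord_J conjcM conjc_i.
have i2 : 'i * 'i = -1 :> C by rewrite -expr2 sqr_i.
transitivity (- ('i * 'i) * (h j k * (zcoord u 0 j * conjc (zcoord v 0 k)))
   - ('i * 'i) * (h j k * (conjc (zcoord u 0 k) * zcoord v 0 j))); first by ring.
by rewrite i2; ring.
Qed.

Lemma zcoord_l a j : zcoord (delta_mx 0 (lshift n a)) 0 j = (j == a)%:R.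
Proof.
rewrite !mxE eqxx eq_lshift eq_rlshift /= -(rmorph_nat (@real_complex_def R (Phant R))).
by [].
Qed.

Lemma zcoord_r a j : zcoord (delta_mx 0 (rshift n a)) 0 j = 'i * (j == a)%:R.
Proof.
rewrite !mxE eqxx eq_lrshift eq_rshift /= -(rmorph_nat (@real_complex_def R (Phant R))).
by apply: (@eq_ReIm R); rewrite ?Re_mul ?Im_mul /=; ring.
Qed.

Lemma sum_delta2 h (c d : C) a b :
  \sum_j \sum_k h j k * (c * (j == a)%:R * (d * (k == b)%:R)) = c * d * h a b.
Proof.
rewrite (bigD1 a) //= (bigD1 b) //= !eqxx big1 ?addr0; last first.
  by move=> k /negbTE ->; rewrite !mulr0.
rewrite big1 ?addr0; last first.
  by move=> j /negbTE jE; apply: big1 => k _; rewrite jE mulr0 mul0r mulr0.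
by rewrite !mulr1 mulrC.
Qed.

Lemma gram_form11 h : selfadjoint h ->
  gram (form11 h) = block_mx (2 *: map_mx (@complex.Re R) h) (2 *: map_mx (@complex.Im R) h)
    (- (2 *: map_mx (@complex.Im R) h)) (2 *: map_mx (@complex.Re R) h).
Proof.
move=> hh; have cb (x y : 'I_n) : conjc ((x == y)%:R) = (x == y)%:R :> C by rewrite conjc_nat.
apply/matrixP => a b; rewrite mxE riem_form11 //.
case: (split_ordP a) => x ->; case: (split_ordP b) => y ->.
- rewrite block_mxEul !mxE; congr (_ * _).
  under eq_bigr do under eq_bigr do rewrite !zcoord_l cb -(mul1r (_ == x)%:R) -(mul1r (_ == y)%:R).
  by rewrite sum_delta2 !mul1r.
- rewrite block_mxEur !mxE; congr (_ * _).
  under eq_bigr do under eq_bigr do rewrite zcoord_l zcoord_r conjcM conjc_i cb -(mul1r (_ == x)%:R).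
  by rewrite sum_delta2 mul1r Re_mul /=; ring.
- rewrite block_mxEdl !mxE -mulrN; congr (_ * _).
  under eq_bigr do under eq_bigr do rewrite zcoord_l zcoord_r cb -(mul1r (_ == y)%:R).
  by rewrite sum_delta2 mulr1 Re_mul /=; ring.
- rewrite block_mxEdr !mxE; congr (_ * _).
  under eq_bigr do under eq_bigr do rewrite !zcoord_r conjcM conjc_i cb.
  by rewrite sum_delta2 !Re_mul !Im_mul /=; ring.
Qed.

(** Unipotent block operations over the complex numbers make the matrix block
    triangular, with [h] and its conjugate on the diagonal. *)
Lemma det_realification h :
  \det (block_mx (map_mx (@complex.Re R) h) (map_mx (@complex.Im R) h)
    (- map_mx (@complex.Im R) h) (map_mx (@complex.Re R) h)) =
  complex.Re (\det h) ^+ 2 + complex.Im (\det h) ^+ 2.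
Proof.
pose toC := @real_complex_def R (Phant R).
set X := map_mx _ h; set Y := map_mx (@complex.Im R) h.
apply: (@complexI R); rewrite -mulJ -[LHS]det_map_mx map_block_mx /= map_mxN.
set X' := map_mx _ X; set Y' := map_mx _ Y.
have hE : X' + 'i *: Y' = h.
  by apply/matrixP => i j; rewrite !mxE; apply: (@eq_ReIm R); rewrite ?Re_add ?Im_add ?Re_mul ?Im_mul /=; ring.
have hJ : X' - 'i *: Y' = map_mx conjc h.
  by apply/matrixP => i j; rewrite !mxE; apply: (@eq_ReIm R); rewrite ?Re_add ?Im_add ?Re_opp ?Im_opp ?Re_mul ?Im_mul ?Re_conjc ?Im_conjc /=; ring.
pose L := block_mx 1%:M (- 'i *: 1%:M) 0 1%:M : 'M[C]_(n + n).
pose L' := block_mx 1%:M ('i *: 1%:M) 0 1%:M : 'M[C]_(n + n).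
have dL : \det L = 1 by rewrite det_ublock !det1 mulr1.
have dL' : \det L' = 1 by rewrite det_ublock !det1 mulr1.
have i2 (A : 'M[C]_n) : 'i *: ('i *: A) = - A by rewrite scalerA -expr2 sqr_i scaleN1r.
have E : L *m block_mx X' Y' (- Y') X' *m L' = block_mx h 0 (- Y') (map_mx conjc h).
  rewrite !mulmx_block !mul1mx !mul0mx !mulmx0 !mulmx1 !add0r !addr0.
  rewrite -!scalemxAl -!scalemxAr !mul1mx !mulmx1 -hJ -hE.
  have e1 : - 'i *: - Y' = 'i *: Y' by rewrite scaleNr scalerN opprK.
  have e2 : 'i *: (X' + 'i *: Y') + (Y' + - 'i *: X') = 0.
    by rewrite scalerDr i2 scaleNr [Y' + _]addrC addrACA subrr addNr addr0.
  have e3 : 'i *: - Y' + X' = X' - 'i *: Y' by rewrite scalerN addrC.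
  by rewrite e1 e2 e3.
have := congr1 determinant E; rewrite (det_mulmx (L *m _)) (det_mulmx L) dL dL' mulr1 mul1r => ->.
by rewrite det_lblock det_map_mx.
Qed.

Lemma riem_density_form11 h : posdef h -> riem_density (form11 h) = 2 ^+ n * detR h.
Proof.
move=> hp; rewrite /riem_density gram_form11; last by case: hp.
have -> : block_mx (2 *: map_mx (@complex.Re R) h) (2 *: map_mx (@complex.Im R) h)
    (- (2 *: map_mx (@complex.Im R) h)) (2 *: map_mx (@complex.Re R) h) =
    2 *: block_mx (map_mx (@complex.Re R) h) (map_mx (@complex.Im R) h)
    (- map_mx (@complex.Im R) h) (map_mx (@complex.Re R) h).
  by rewrite scale_block_mx scalerN.
rewrite detZ det_realification posdef_det //= expr0n addr0 exprD -expr2 -exprMn.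
by rewrite sqrtr_sqr ger0_norm // mulr_ge0 ?exprn_ge0 // ltW // posdef_det_gt0.
Qed.

End RiemannianMetric.

(** * Integration over the unit interval *)

Section UnitIntegral.
Variable R : realType.
Local Notation mu := (@lebesgue_measure R).
Implicit Types f g F : R -> R.

Definition unit_integral f : R := \int[mu]_(t in `[0, 1]%classic) f t.

Lemma unit_integrable f : continuous f -> mu.-integrable `[0, 1]%classic (EFin \o f).
Proof.
move=> cf; apply: (@continuous_compact_integrable R f); first exact: segment_compact.
exact: continuous_subspaceT.
Qed.

Lemma unit_integral_lin (a : R) f g : continuous f -> continuous g ->
  unit_integral (fun t => a * f t + g t) = a * unit_integral f + unit_integral g.
Proof.
move=> cf cg; have caf : continuous (fun t => a * f t).
  by move=> t; apply: cvgM; [exact: cvg_cst|exact: cf].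
rewrite /unit_integral RintegralD //; [|exact: unit_integrable|exact: unit_integrable].
by rewrite RintegralZl //; exact: unit_integrable.
Qed.

Lemma unit_integral_ge0 f : (forall t, `[0, 1]%classic t -> 0 <= f t) -> 0 <= unit_integral f.
Proof. by move=> f0; rewrite /unit_integral; apply: Rintegral_ge0. Qed.

Lemma unit_integral_cst (a : R) : unit_integral (fun=> a) = a.
Proof.
have E := @lebesgue_measure_itv R `[0, 1]; rewrite /= lte_fin ltr01 sube0 in E.
rewrite /unit_integral Rintegral_cst //; set m := fine _.
have -> : m = fine (1%:E : \bar R) by congr fine; exact: E.
by rewrite mulr1.
Qed.

Lemma eq_unit_integral f g : (forall t, `[0, 1]%classic t -> f t = g t) ->
  unit_integral f = unit_integral g.
Proof. by move=> fg; apply: eq_Rintegral => t /set_mem; exact: fg. Qed.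

Lemma FTC f F : continuous f -> (forall t : R, is_derive t 1 F (f t)) ->
  unit_integral f = F 1 - F 0.
Proof.
move=> cf dF; rewrite /unit_integral /Rintegral (@continuous_FTC2 R f F 0 1) //.
- exact: continuous_subspaceT.
- have cF : continuous F.
    move=> t; apply: differentiable_continuous; apply/derivable1_diffP.
    by have [] := dF t.
  split.
  + by move=> t _; have [] := dF t.
  + by apply: cvg_at_right_filter; exact: cF.
  + by apply: cvg_at_left_filter; exact: cF.
- by move=> t _; rewrite derive1E; have [] := dF t.
Qed.

Lemma antiderivative (a : R) f : continuous f ->
  exists F, forall x, a < x -> is_derive x 1 F (f x).
Proof.
move=> cf; exists (fun x => \int[mu]_(t in `[a, x]%classic) f t) => x ax.
have x1 : x < x + 1 by rewrite ltrDl.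
have fi : mu.-integrable `[a, x + 1]%classic (EFin \o f).
  apply: (@continuous_compact_integrable R f); first exact: segment_compact.
  exact: continuous_subspaceT.
have [dF F'] := @continuous_FTC1_closed R f a x (x + 1) x1 fi ax (cf x).
apply: DeriveDef; first exact: dF.
by rewrite -derive1E; exact: F'.
Qed.

(** Every average over an interval is an increment of an antiderivative, which
    gives affine changes of variables. *)
Lemma unit_integral_affine f F (a s c : R) : continuous f -> a < s -> 0 < c ->
  (forall x, a < x -> is_derive x 1 F (f x)) ->
  unit_integral (fun t => f (s + c * t)) = c^-1 * (F (s + c) - F s).
Proof.
move=> cf as0 c0 dF.
have cfc : continuous (fun t => f (s + c * t)).
  move=> t; apply: (@continuous_comp _ _ _ (fun t => s + c * t) f); last exact: cf.
  by apply: cvgD; [exact: cvg_cst|apply: cvgM; [exact: cvg_cst|exact: cvg_id]].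
(* [F] is a primitive of [f] only to the right of [a], whence [0 <= t]. *)
have dG (t : R) : 0 <= t -> is_derive t 1 (fun t => c^-1 * F (s + c * t)) (f (s + c * t)).
  move=> t0; have ast : a < s + c * t by rewrite ltr_wpDr // mulr_ge0 // ltW.
  have dl : is_derive t 1 (fun t : R => s + c * t) c.
    have := is_deriveD (is_derive_cst s t 1) (is_deriveZ c (is_derive_id t (1 : R))). by rewrite add0r /GRing.scale /= mulr1.
  have := dF _ ast => dFs.
  have := @is_derive1_comp R F (fun t => s + c * t) t _ _ dFs dl => dcomp.
  have := is_deriveZ c^-1 dcomp; rewrite /GRing.scale /=.
  by rewrite mulrC mulfK ?gt_eqF.
rewrite /unit_integral /Rintegral (@continuous_FTC2 R _ (fun t => c^-1 * F (s + c * t)) 0 1) //=.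
- by rewrite mulr1 mulr0 addr0 mulrBr.
- exact: continuous_subspaceT.
- have cG (t : R) : 0 <= t -> {for t, continuous (fun t => c^-1 * F (s + c * t))}.
    move=> t0; apply: differentiable_continuous; apply/derivable1_diffP.
    by have [] := dG t t0.
  split.
  + by move=> t; rewrite in_itv /= => /andP[/ltW /dG[]].
  + by apply: cvg_at_right_filter; apply: cG.
  + by apply: cvg_at_left_filter; apply: cG.
- move=> t; rewrite in_itv /= => /andP[/ltW t0 _]; rewrite derive1E; by have [] := dG t t0.
Qed.

(** The increment of an antiderivative over one period is constant, its
    derivative being [f (x + 1) - f x]. *)
Lemma unit_integral_translate f (s : R) : continuous f -> (forall x, f (x + 1) = f x) ->
  unit_integral (fun t => f (s + t)) = unit_integral f.
Proof.
(* A point to the left of both [s] and [0]. *)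
move=> cf pf; pose a := Num.min s 0 - 1.
have as0 : a < s by rewrite /a ltrBlDr (@le_lt_trans _ _ s) ?ge_min ?lexx // ltrDl.
have a0 : a < 0 by rewrite /a ltrBlDr add0r (@le_lt_trans _ _ 0) ?ge_min ?lexx ?orbT.
have [F dF] := antiderivative a cf.
have E (x : R) : a < x -> unit_integral (fun t => f (x + t)) = F (x + 1) - F x.
  move=> ax; have := unit_integral_affine cf ax ltr01 dF; rewrite invr1 mul1r => <-.
  by apply: eq_unit_integral => t _; rewrite mul1r.
rewrite E // -[in RHS](_ : (fun t => f (0 + t)) = f); last by apply/funext => t; rewrite add0r.
rewrite E //.
pose G x := F (x + 1) - F x.
have dG x : a < x -> is_derive x 1 G 0.
  move=> ax; have d1 := dF _ ax.
  have ax1 : a < x + 1 by rewrite ltr_wpDr.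
  have dl : is_derive x 1 (fun t : R => t + 1) 1 by apply: is_derive_eq; rewrite addr0.
  have d2 := @is_derive1_comp R F (fun t => t + 1) x _ _ (dF _ ax1) dl.
  have := is_deriveB d2 d1; rewrite pf /GRing.scale /= mulr1 subrr.
  by [].
have cst x y : a < x -> x <= y -> G x = G y.
  move=> ax xy; have [z|c|c _ ] := @MVT_segment R G (fun=> 0) x y xy.
  - by rewrite in_itv /= => /andP[xz _]; apply: dG; exact: lt_trans xz.
  - apply: derivable_within_continuous => z; rewrite in_itv /= => /andP[xz _].
    by have [] := dG z (lt_le_trans ax xz).
  - by rewrite mul0r => /subr0_eq.
by case: (leP s 0) => h; [exact: cst|apply/esym/cst => //; exact: ltW].
Qed.

(** An antiderivative of a nonnegative function is nondecreasing. *)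
Lemma unit_integral_zoom f (s c : R) : continuous f -> (forall x, 0 <= f x) ->
  0 < c -> c <= 1 ->
  unit_integral (fun t => f (s + c * t)) <= c^-1 * unit_integral (fun t => f (s + t)).
Proof.
move=> cf f0 c0 c1; have as0 : s - 1 < s by rewrite ltrBlDr ltrDl.
have [F dF] := antiderivative (s - 1) cf.
rewrite (unit_integral_affine cf as0 c0 dF) ler_pM2l ?invr_gt0 //.
have -> : unit_integral (fun t => f (s + t)) = F (s + 1) - F s.
  have := unit_integral_affine cf as0 ltr01 dF; rewrite invr1 mul1r => <-.
  by apply: eq_unit_integral => t _; rewrite mul1r.
rewrite lerD2r.
have sc : s + c <= s + 1 by rewrite lerD2l.
have as1 : s - 1 < s + c by rewrite (lt_trans as0) // ltrDl.
have [z|z zI|z zI E] := @MVT_segment R F f (s + c) (s + 1) sc.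
- by rewrite in_itv /= => /andP[xz _]; apply: dF; exact: lt_trans xz.
- move: z zI; apply: derivable_within_continuous => z; rewrite in_itv /= => /andP[xz _].
  by have [] := dF z (lt_le_trans as1 xz).
- by rewrite -subr_ge0 E mulr_ge0 // subr_ge0.
Qed.

(** The mean value theorem on each subinterval. *)
Lemma riemann_sum f (N : nat) (e : R) : (0 < N)%N -> continuous f ->
  (forall s t, 0 <= s <= 1 -> 0 <= t <= 1 -> `|s - t| <= N%:R^-1 -> `|f s - f t| <= e) ->
  `|unit_integral f - N%:R^-1 * \sum_(k < N) f (k%:R / N%:R)| <= e.
Proof.
move=> N0 cf uf; have a0 : -1 < 0 :> R by rewrite oppr_lt0.
have [F dF] := antiderivative (-1) cf.
have -> : unit_integral f = F 1 - F 0.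
  have := unit_integral_affine cf a0 ltr01 dF; rewrite invr1 mul1r add0r => <-.
  by apply: eq_unit_integral => t _; rewrite mul1r add0r.
pose p k : R := k%:R / N%:R.
have NR : 0 < N%:R :> R by rewrite ltr0n.
have -> : F 1 - F 0 = \sum_(k < N) (F (p k.+1) - F (p k)).
  rewrite -(big_mkord xpredT (fun k => F (p k.+1) - F (p k))) telescope_sumr //.
  by rewrite /p divff ?gt_eqF // mul0r.
rewrite mulr_sumr -sumrB; apply: le_trans (ler_norm_sum _ _ _) _.
apply: (@le_trans _ _ (\sum_(k < N) (N%:R^-1 * e))); last first.
  by rewrite sumr_const card_ord -[X in X <= _]mulr_natl mulrA divff ?gt_eqF // mul1r.
apply: ler_sum => k _.
have pk0 : 0 <= p k by rewrite /p divr_ge0 // ler0n.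
have pk1 : p k.+1 <= 1 by rewrite /p ler_pdivrMr // mul1r ler_nat.
have pkS : p k.+1 - p k = N%:R^-1 by rewrite /p -mulrBl -natrB // subSnn mul1r.
have pkk : p k <= p k.+1 by rewrite -subr_ge0 pkS invr_ge0 ler0n.
have [z|z zI|z zI E] := @MVT_segment R F f (p k) (p k.+1) pkk.
- rewrite in_itv /= => /andP[xz _]; apply: dF; apply: lt_trans xz; exact: lt_le_trans pk0.
- move: z zI; apply: derivable_within_continuous => z; rewrite in_itv /= => /andP[xz _].
  have [] // := dF z _; apply: lt_le_trans xz; exact: lt_le_trans pk0.
move: zI; rewrite in_itv /= => /andP[z1 z2].
rewrite E pkS mulrC -mulrBr normrM gtr0_norm ?invr_gt0 // ler_pM2l ?invr_gt0 //.
apply: uf.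
- by rewrite (le_trans pk0 z1) (le_trans z2 pk1).
- by rewrite pk0 (le_trans pkk pk1).
- by rewrite -/(p k) ger0_norm ?subr_ge0 // -pkS lerD2r.
Qed.

End UnitIntegral.

Local Open Scope classical_set_scope.

(** * Averages of continuous functions *)

Section RealContinuity.
Variables (R : realType) (T : topologicalType).
Implicit Types f g : T -> R.

Lemma cont_cst (a : R) : continuous (fun _ : T => a).
Proof. by move=> x; exact: cvg_cst. Qed.
Lemma contD f g : continuous f -> continuous g -> continuous (fun x => f x + g x).
Proof. by move=> cf cg x; apply: cvgD; [exact: cf|exact: cg]. Qed.
Lemma contM f g : continuous f -> continuous g -> continuous (fun x => f x * g x).
Proof. by move=> cf cg x; apply: cvgM; [exact: cf|exact: cg]. Qed.
Lemma contN f : continuous f -> continuous (fun x => - f x).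
Proof. by move=> cf x; apply: cvgN; exact: cf. Qed.
Lemma contB f g : continuous f -> continuous g -> continuous (fun x => f x - g x).
Proof. by move=> cf cg x; apply: cvgB; [exact: cf|exact: cg]. Qed.
Lemma cont_norm f : continuous f -> continuous (fun x => `|f x|).
Proof. by move=> cf x; apply: cvg_norm; exact: cf. Qed.
Lemma cont_inv f : continuous f -> (forall x, f x != 0) -> continuous (fun x => (f x)^-1).
Proof. by move=> cf f0 x; apply: cvgV; [exact: f0|exact: cf]. Qed.
Lemma cont_sum (J : Type) (r : seq J) (P : pred J) (F : J -> T -> R) :
  (forall j, P j -> continuous (F j)) -> continuous (fun x => \sum_(j <- r | P j) F j x).
Proof.
move=> cF; elim: r => [|j r IH].
  rewrite (_ : (fun _ => _) = fun=> 0); first exact: cont_cst.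
  by apply/funext => x; rewrite big_nil.
rewrite (_ : (fun _ => _) =
    fun x => if P j then F j x + \sum_(i <- r | P i) F i x else \sum_(i <- r | P i) F i x).
  by case Pj: (P j) => //; apply: contD => //; exact: cF.
by apply/funext => x; rewrite big_cons.
Qed.
Lemma cont_comp (S : topologicalType) (p : S -> T) f :
  continuous p -> continuous f -> continuous (fun s => f (p s)).
Proof. by move=> cp cf s; apply: (@continuous_comp _ _ _ p f); [exact: cp|exact: cf]. Qed.

Lemma cont_mx m n (F : T -> 'M[R]_(m, n)) :
  (forall i j, continuous (fun x => F x i j)) -> continuous F.
Proof.
move=> cF x A [P xP PA]; rewrite /nbhs /=.
have : \forall y \near x, forall i j, P i j (F y i j).
  apply: filter_forall => i; apply: filter_forall => j; exact: (cF i j x (P i j) (xP i j)).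
by apply: filterS => y Py; apply: PA.
Qed.

Lemma cont_entry m n (F : T -> 'M[R]_(m, n)) i j :
  continuous F -> continuous (fun x => F x i j).
Proof.
by move=> cF x; apply: (@continuous_comp _ _ _ F (fun M : 'M[R]_(m, n) => M i j));
  [exact: cF|exact: coord_continuous].
Qed.
Lemma contZ (a : R) f : continuous f -> continuous (fun x => a * f x).
Proof. by apply: contM; exact: cont_cst. Qed.

Lemma cont_dist f (c : R) : continuous f -> continuous (fun x => `|f x - c|).
Proof. by move=> cf; apply: cont_norm; apply: contB => //; exact: cont_cst. Qed.

End RealContinuity.

Lemma compact_bounded_fun (R : realType) (T : topologicalType) (K : set T) (f : T -> R) :
  compact K -> continuous f -> exists2 C : R, 0 < C & forall x, K x -> `|f x| <= C.
Proof.
move=> cK cf.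
have /compact_bounded [M [Mr MP]] : compact (f @` K).
  by apply: continuous_compact => //; exact: continuous_subspaceT.
have M1 : M < `|M| + 1 by rewrite (le_lt_trans (ler_norm _)) // ltrDl.
exists (`|M| + 1); first by rewrite ltr_wpDl.
by move=> x Kx; apply: MP M1 _ _; exists x.
Qed.

Section Means.
Variable R : realType.

(** A positive normalised linear functional on continuous functions, supported
    in a compact set: all that is used of an average. *)
Record mean (T : topologicalType) (K : set T) (I : (T -> R) -> R) : Prop := Mean {
  mean_compact : compact K;
  mean_lin : forall a (f g : T -> R), continuous f -> continuous g ->
    I (fun x => a * f x + g x) = a * I f + I g;
  mean_ge0 : forall f : T -> R, continuous f -> (forall x, K x -> 0 <= f x) -> 0 <= I f;
  mean_cst : forall a : R, I (fun=> a) = a }.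

Section Basic.
Variables (T : topologicalType) (K : set T) (I : (T -> R) -> R).
Hypothesis mI : mean K I.
Implicit Types f g : T -> R.

Lemma meanD f g : continuous f -> continuous g -> I (fun x => f x + g x) = I f + I g.
Proof.
move=> cf cg; rewrite -[I f]mul1r -(mean_lin mI) //; congr (I _).
by apply/funext => x; rewrite mul1r.
Qed.

Lemma meanZ a f : continuous f -> I (fun x => a * f x) = a * I f.
Proof.
move=> cf; have := mean_lin mI a cf (@cont_cst R T 0); rewrite (mean_cst mI) addr0 => <-.
by congr (I _); apply/funext => x; rewrite addr0.
Qed.

Lemma meanB f g : continuous f -> continuous g -> I (fun x => f x - g x) = I f - I g.
Proof.
move=> cf cg; have := mean_lin mI (-1) cg cf; rewrite mulN1r addrC => <-.
by congr (I _); apply/funext => x; rewrite mulN1r addrC.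
Qed.

Lemma meanN f : continuous f -> I (fun x => - f x) = - I f.
Proof.
move=> cf; rewrite -mulN1r -meanZ //; congr (I _); by apply/funext => x; rewrite mulN1r.
Qed.

Lemma mean_le f g : continuous f -> continuous g -> (forall x, K x -> f x <= g x) -> I f <= I g.
Proof.
move=> cf cg fg; rewrite -subr_ge0 -meanB //; apply: (mean_ge0 mI).
  exact: contB.
by move=> x Kx; rewrite subr_ge0 fg.
Qed.

Lemma mean_abs f : continuous f -> `|I f| <= I (fun x => `|f x|).
Proof.
move=> cf; have cn := cont_norm cf; rewrite ler_norml -meanN // !mean_le //.
- by move=> x _; rewrite ler_norm.
- exact: contN.
- by move=> x _; rewrite lerNl ler_normr lexx orbT.
Qed.

Lemma mean_le_cst f a : continuous f -> (forall x, K x -> f x <= a) -> I f <= a.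
Proof. by move=> cf fa; rewrite -[leRHS](mean_cst mI); apply: mean_le => //; exact: cont_cst. Qed.

Lemma mean_ge_cst f a : continuous f -> (forall x, K x -> a <= f x) -> a <= I f.
Proof. by move=> cf fa; rewrite -[leLHS](mean_cst mI); apply: mean_le => //; exact: cont_cst. Qed.

Lemma mean_sum (J : Type) (r : seq J) (P : pred J) (F : J -> T -> R) :
  (forall j, P j -> continuous (F j)) ->
  I (fun x => \sum_(j <- r | P j) F j x) = \sum_(j <- r | P j) I (F j).
Proof.
move=> cF; elim: r => [|j r IH].
  rewrite big_nil -[RHS](mean_cst mI); congr (I _).
  by apply/funext => x; rewrite big_nil.
rewrite big_cons -IH; case: ifP => Pj.
  rewrite -meanD; [|exact: cF|exact: cont_sum].
  by congr (I _); apply/funext => x; rewrite big_cons Pj.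
by congr (I _); apply/funext => x; rewrite big_cons Pj.
Qed.

(** The tube lemma. *)
Lemma compact_near (S : topologicalType) (F : S -> T -> R) (s0 : S) (e : R) :
  continuous (fun p : S * T => F p.1 p.2) -> 0 < e ->
  \forall s \near s0, forall x, K x -> `|F s x - F s0 x| <= e.
Proof.
move=> cF e0; have [cov _] := compact_near_coveringP K.
have := cov (mean_compact mI) S (nbhs s0) (fun s x => `|F s x - F s0 x| <= e) _.
apply=> x Kx.
have e2 : 0 < e / 2 by rewrite divr_gt0.
have cx := cF (s0, x).
have n1 : \forall x' \near x & s \near s0, `|F s0 x - F s x'| < e / 2.
  have /cvgrPdist_lt /(_ _ e2) := cx.
  case=> -[A B] /= [As Bx] AB; exists (B, A) => //= -[y s] /= [By As'].
  by apply: (AB (s, y)).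
have n2 : \forall x' \near x & s \near s0, `|F s0 x - F s0 x'| < e / 2.
  have /cvgrPdist_lt /(_ _ e2) := cx.
  case=> -[A B] /= [As Bx] AB; exists (B, setT) => /=.
    by split => //; exact: filterT.
  move=> -[y s] /= [By _]; apply: (AB (s0, y)); split => //=; exact: nbhs_singleton.
apply: filterS2 n1 n2 => -[y s] /= h1 h2.
have -> : F s y - F s0 y = (F s0 x - F s0 y) - (F s0 x - F s y) by ring.
apply: le_trans (ler_normB _ _) _; rewrite [leRHS]splitr.
by apply: lerD; exact: ltW.
Qed.

Lemma cont_slice (S : topologicalType) (F : S -> T -> R) s :
  continuous (fun p : S * T => F p.1 p.2) -> continuous (F s).
Proof.
move=> cF; apply: (@cont_comp R _ T (fun x => (s, x)) (fun p : S * T => F p.1 p.2)) => //.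
by move=> x; apply: cvg_pair; [exact: cvg_cst|exact: cvg_id].
Qed.

Lemma mean_cont (S : topologicalType) (F : S -> T -> R) :
  continuous (fun p : S * T => F p.1 p.2) -> continuous (fun s => I (F s)).
Proof.
move=> cF s0; apply/cvgrPdist_le => e e0.
have := compact_near s0 cF e0; apply: filterS => s Fs.
rewrite -meanB; [|exact: cont_slice|exact: cont_slice].
have cB : continuous (fun x => F s0 x - F s x) by apply: contB; exact: cont_slice.
apply: le_trans (mean_abs cB) _; apply: mean_le_cst; first exact: cont_norm.
by move=> x Kx; rewrite distrC; exact: Fs.
Qed.

End Basic.

Lemma mean_unit : mean (`[0, 1] : set R) (@unit_integral R).
Proof.
split; first exact: segment_compact.
- by move=> a f g cf cg; exact: unit_integral_lin.
- by move=> f cf f0; exact: unit_integral_ge0.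
- by move=> a; exact: unit_integral_cst.
Qed.

Lemma swap_pair_cont (S T : topologicalType) (F : S -> T -> R) :
  continuous (fun p : S * T => F p.1 p.2) -> continuous (fun p : T * S => F p.2 p.1).
Proof.
move=> cF; apply: (@cont_comp R (S * T)%type (T * S)%type (fun p => (p.2, p.1)) (fun p : S * T => F p.1 p.2)) => //.
by move=> p; apply: cvg_pair; [exact: cvg_snd|exact: cvg_fst].
Qed.

(** Riemann sums reduce the exchange of two averages to finite additivity. *)
Lemma mean_swap_unit (T : topologicalType) (K : set T) I (F : R -> T -> R) :
  mean K I -> continuous (fun p : R * T => F p.1 p.2) ->
  unit_integral (fun s => I (F s)) = I (fun x => unit_integral (fun s => F s x)).
Proof.
move=> mI cF; apply/eqP; rewrite -subr_eq0 -normr_le0; apply/ler_addgt0Pl => e e0; rewrite addr0.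
have e4 : 0 < e / 2 by rewrite divr_gt0.
have [cov _] := compact_near_coveringP (`[0, 1] : set R).
have := cov (@segment_compact R 0 1) R (0^'+)
  (fun d s => forall s', `|s - s'| <= d -> forall x, K x -> `|F s x - F s' x| <= e / 2) _.
case.
  move=> s _; have e8 : 0 < e / 2 / 2 by rewrite divr_gt0.
  have /nbhs_ballP[r /= r0 rs] := compact_near mI s cF e8.
  exists (ball s (r / 2), [set d | d < r / 2]) => /=.
    split; first by apply: nbhsx_ballx; rewrite divr_gt0.
    by apply: nbhs_right_lt; rewrite divr_gt0.
  move=> -[s1 d] /= [b1 dr] s' s's x Kx.
  have h1 : `|F s1 x - F s x| <= e / 2 / 2.
    apply: rs => //; apply: le_ball b1; lra.
  have h2 : `|F s' x - F s x| <= e / 2 / 2.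
    apply: rs => //; rewrite /ball /=; rewrite /ball /= in b1.
    have -> : s - s' = (s - s1) + (s1 - s') by ring.
    apply: le_lt_trans (ler_normD _ _) _; lra.
  have -> : F s1 x - F s' x = (F s1 x - F s x) - (F s' x - F s x) by ring.
  by apply: le_trans (ler_normB _ _) _; lra.
move=> d /= d0 dP.
have [N Nd] : exists N : nat, (0 < N)%N /\ N%:R^-1 < d.
  exists (Num.truncn (d^-1)).+1; split=> //.
  by rewrite invf_plt ?posrE ?ltr0n // truncnS_gt.
have [N0 {}Nd] := Nd.
have U := dP (N%:R^-1); have {}U := U _ _.
have UU s s' : 0 <= s <= 1 -> `|s - s'| <= N%:R^-1 -> forall x, K x -> `|F s x - F s' x| <= e / 2.
  move=> sI; apply: U => //.
  - by rewrite /ball /= sub0r normrN gtr0_norm // invr_gt0 ltr0n.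
  - by rewrite invr_gt0 ltr0n.
have cs s : continuous (F s) by exact: cont_slice.
have cG := mean_cont mI cF.
have h1 : `|unit_integral (fun s => I (F s)) -
    N%:R^-1 * \sum_(k < N) I (F (k%:R / N%:R))| <= e / 2.
  apply: riemann_sum => // s t sI _ st.
  rewrite -(meanB mI) //; apply: le_trans (mean_abs mI _) _; first exact: contB.
  apply: (mean_le_cst mI); first by apply: cont_norm; exact: contB.
  exact: UU.
have cJ : continuous (fun x => unit_integral (fun s => F s x)).
  exact: (mean_cont (F := fun x s => F s x) mean_unit (swap_pair_cont cF)).
have h2 : `|I (fun x => unit_integral (fun s => F s x)) -
    N%:R^-1 * \sum_(k < N) I (F (k%:R / N%:R))| <= e / 2.
  have cS : continuous (fun x => N%:R^-1 * \sum_(k < N) F (k%:R / N%:R) x).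
    by apply: contM; [exact: cont_cst|exact: cont_sum].
  rewrite -(mean_sum mI) // -(meanZ mI); last exact: cont_sum.
  rewrite -(meanB mI) //; apply: le_trans (mean_abs mI _) _; first exact: contB.
  apply: (mean_le_cst mI); first by apply: cont_norm; exact: contB.
  move=> x Kx; apply: riemann_sum => //.
    exact: (@cont_slice _ T (fun x s => F s x) x (swap_pair_cont cF)).
  by move=> s t sI _ st; exact: UU.
have -> : unit_integral (fun s => I (F s)) - I (fun x => unit_integral (fun s => F s x)) =
  (unit_integral (fun s => I (F s)) - N%:R^-1 * \sum_(k < N) I (F (k%:R / N%:R))) -
  (I (fun x => unit_integral (fun s => F s x)) - N%:R^-1 * \sum_(k < N) I (F (k%:R / N%:R))) by ring.
by apply: le_trans (ler_normB _ _) _; lra.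
Qed.

End Means.

Section CubeMean.
Variable R : realType.

Definition cube m : set 'rV[R]_m := [set t | forall i, (`[0, 1] : set R) (t ord0 i)].

Lemma cont_id (T : topologicalType) : continuous (fun x : T => x).
Proof. by move=> x; exact: cvg_id. Qed.

Lemma cont_const (T U : topologicalType) (c : U) : continuous (fun _ : T => c).
Proof. by move=> x; exact: cvg_cst. Qed.

Lemma cont_pair (S T U : topologicalType) (f : S -> T) (g : S -> U) :
  continuous f -> continuous g -> continuous (fun s => (f s, g s)).
Proof. by move=> cf cg s; apply: cvg_pair; [exact: cf|exact: cg]. Qed.

Lemma cont_fst (T U : topologicalType) : continuous (fun p : T * U => p.1).
Proof. by move=> p; exact: cvg_fst. Qed.
Lemma cont_snd (T U : topologicalType) : continuous (fun p : T * U => p.2).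
Proof. by move=> p; exact: cvg_snd. Qed.

Lemma cont_compT (S T U : topologicalType) (p : S -> T) (f : T -> U) :
  continuous p -> continuous f -> continuous (fun s => f (p s)).
Proof. by move=> cp cf s; apply: (@continuous_comp _ _ _ p f); [exact: cp|exact: cf]. Qed.

Lemma cont_row_mx (T : topologicalType) m (p : T -> R) (q : T -> 'rV[R]_m) :
  continuous p -> continuous q ->
  continuous (fun x => row_mx ((p x)%:M : 'rV[R]_1) (q x) : 'rV[R]_m.+1).
Proof.
move=> cp cq; apply: (@cont_mx R T 1 (1 + m)) => i j.
case: (split_ordP j) => k ->.
  rewrite (_ : (fun _ => _) = p) //; apply/funext => x.
  by rewrite row_mxEl mxE !ord1 mulr1n.
rewrite (_ : (fun _ => _) = fun x => q x i k); last by apply/funext => x; rewrite row_mxEr.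
exact: cont_entry.
Qed.

Lemma cont_mulmx (T : topologicalType) m k (p : T -> 'rV[R]_m) (B : 'M[R]_(m, k)) :
  continuous p -> continuous (fun x => p x *m B).
Proof.
move=> cp; apply: cont_mx => i j.
rewrite (_ : (fun _ => _) = fun x => \sum_l p x i l * B l j); last first.
  by apply/funext => x; rewrite mxE.
apply: cont_sum => l _; apply: contM; [exact: cont_entry|exact: cont_cst].
Qed.

Lemma cont_addmx (T : topologicalType) m (p q : T -> 'rV[R]_m) :
  continuous p -> continuous q -> continuous (fun x => p x + q x).
Proof. by move=> cp cq x; apply: cvgD; [exact: cp|exact: cq]. Qed.

Lemma cont_scalemx (T : topologicalType) m (c : T -> R) (p : T -> 'rV[R]_m) :
  continuous c -> continuous p -> continuous (fun x => c x *: p x).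
Proof. by move=> cp cq x; apply: cvgZ; [exact: cp|exact: cq]. Qed.

Lemma cube_row_mx m (t : R) (u : 'rV[R]_m) : (`[0, 1] : set R) t -> cube u ->
  cube (row_mx (t%:M : 'rV[R]_1) u : 'rV[R]_m.+1).
Proof.
move=> t1 cu j; case: (@split_ordP 1 m j) => k ->.
  by rewrite (row_mxEl (t%:M : 'rV[R]_1) u) mxE !ord1 mulr1n.
by rewrite (row_mxEr (t%:M : 'rV[R]_1) u); exact: cu.
Qed.

Lemma cube_integralS m (f : 'rV[R]_m.+1 -> R) :
  cube_integral f = unit_integral (fun t =>
    cube_integral (fun u : 'rV[R]_m => f (row_mx (t%:M : 'rV[R]_1) u))).
Proof. by []. Qed.

Lemma cont_slab m (f : 'rV[R]_m.+1 -> R) : continuous f ->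
  continuous (fun p : R * 'rV[R]_m => f (row_mx (p.1%:M : 'rV[R]_1) p.2)).
Proof.
move=> cf; apply: (cont_comp (p := fun p : R * 'rV[R]_m =>
  (row_mx (p.1%:M : 'rV[R]_1) p.2 : 'rV[R]_m.+1)) _ cf).
by apply: cont_row_mx; [exact: cont_fst|exact: cont_snd].
Qed.

Lemma mean_cube m : mean (@cube m) (@cube_integral R m).
Proof.
elim: m => [|m IH].
  split=> [|//|f _ f0|//]; last by apply: f0 => -[].
  by apply: (@rV_compact R 0 (fun=> `[0, 1])) => -[].
have sl t (f : 'rV[R]_m.+1 -> R) : continuous f ->
    continuous (fun u : 'rV[R]_m => f (row_mx (t%:M : 'rV[R]_1) u)).
  by move=> /cont_slab cf; exact: (@cont_slice _ _ _ (fun t u => f (row_mx (t%:M : 'rV[R]_1) u)) t cf).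
have ct (f : 'rV[R]_m.+1 -> R) : continuous f ->
    continuous (fun t => cube_integral (fun u : 'rV[R]_m => f (row_mx (t%:M : 'rV[R]_1) u))).
  by move=> cf; exact: (mean_cont IH (cont_slab cf)).
split.
- by apply: (@rV_compact R m.+1 (fun=> `[0, 1])) => i; exact: segment_compact.
- move=> a f g cf cg; rewrite !cube_integralS -unit_integral_lin; [|exact: ct|exact: ct].
  by apply: eq_unit_integral => t _; rewrite (mean_lin IH) //; exact: sl.
- move=> f cf f0; rewrite cube_integralS; apply: unit_integral_ge0 => t t1.
  apply: (mean_ge0 IH); first exact: sl.
  by move=> u cu; apply: f0; exact: cube_row_mx.
- move=> a; rewrite cube_integralS -[RHS](unit_integral_cst a).
  by apply: eq_unit_integral => t _; rewrite (mean_cst IH).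
Qed.

Lemma mean_swap_cube m (T : topologicalType) (K : set T) I (F : 'rV[R]_m -> T -> R) :
  mean K I -> continuous (fun p : 'rV[R]_m * T => F p.1 p.2) ->
  cube_integral (fun v => I (F v)) = I (fun x => cube_integral (fun v => F v x)).
Proof.
move=> mI; elim: m F => // m IH F cF.
have cslab t : continuous (fun p : 'rV[R]_m * T => F (row_mx (t%:M : 'rV[R]_1) p.1) p.2).
  apply: (@cont_compT ('rV[R]_m * T)%type ('rV[R]_m.+1 * T)%type R
    (fun p => (row_mx (t%:M : 'rV[R]_1) p.1 : 'rV[R]_m.+1, p.2)) (fun p => F p.1 p.2)) => //.
  apply: cont_pair; last exact: cont_snd.
  by apply: cont_row_mx; [exact: cont_cst|exact: cont_fst].
rewrite cube_integralS.
transitivity (unit_integral (fun t => I (fun x => cube_integral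
    (fun u : 'rV[R]_m => F (row_mx (t%:M : 'rV[R]_1) u) x)))).
  apply: eq_unit_integral => t _.
  by rewrite (IH (fun u => F (row_mx (t%:M : 'rV[R]_1) u))).
rewrite (@mean_swap_unit _ _ _ _ (fun t x => cube_integral
    (fun u : 'rV[R]_m => F (row_mx (t%:M : 'rV[R]_1) u) x)) mI) //.
apply: (mean_cont (S := (R * T)%type) (F := fun p u => F (row_mx (p.1%:M : 'rV[R]_1) u) p.2) (mean_cube m)).
apply: (@cont_compT ((R * T) * 'rV[R]_m)%type ('rV[R]_m.+1 * T)%type R
    (fun p => (row_mx (p.1.1%:M : 'rV[R]_1) p.2 : 'rV[R]_m.+1, p.1.2)) (fun p => F p.1 p.2)) => //.
apply: cont_pair.
  apply: cont_row_mx; last exact: cont_snd.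
  by apply: (@cont_compT _ (R * T)%type _ fst fst); exact: cont_fst.
by apply: (@cont_compT _ (R * T)%type _ fst snd); [exact: cont_fst|exact: cont_snd].
Qed.

Definition periodicZ m (f : 'rV[R]_m -> R) :=
  forall t (k : 'rV[int]_m), f (t + map_mx intr k) = f t.

(** One coordinate at a time: [unit_integral_translate] moves the first one and
    the induction hypothesis the others. *)
Lemma cube_translate m (f : 'rV[R]_m -> R) v : continuous f -> periodicZ f ->
  cube_integral (fun t => f (t + v)) = cube_integral f.
Proof.
elim: m f v => [|m IH] f v cf pf; first by congr (f _); apply/rowP => -[].
have sl t : continuous (fun u : 'rV[R]_m => f (row_mx (t%:M : 'rV[R]_1) u)).
  by exact: (@cont_slice _ _ _ (fun t u => f (row_mx (t%:M : 'rV[R]_1) u)) t (cont_slab cf)).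
have map_row (k1 : int) (k : 'rV[int]_m) :
    map_mx intr (row_mx (k1%:M : 'rV_1) k : 'rV[int]_m.+1) =
    row_mx ((k1%:~R : R)%:M : 'rV_1) (map_mx intr k).
  have <- : map_mx intr (k1%:M : 'M[int]_1) = (k1%:~R : R)%:M by rewrite map_scalar_mx.
  exact: (map_row_mx _ (k1%:M : 'rV_1) k).
have ct : continuous (fun t => cube_integral (fun u : 'rV[R]_m => f (row_mx (t%:M : 'rV[R]_1) u))).
  exact: (mean_cont (mean_cube m) (cont_slab cf)).
rewrite !cube_integralS.
pose v1 := (lsubmx (v : 'rV_(1 + m))) 0 0; pose v2 := rsubmx (v : 'rV_(1 + m)).
have vE : v = row_mx (v1%:M : 'rV_1) v2.
  have <- : lsubmx (v : 'rV_(1 + m)) = v1%:M.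
    by apply/matrixP => i j; rewrite !ord1 [RHS]mxE mulr1n.
  exact: (esym (@hsubmxK _ 1 1 m _)).
rewrite -(unit_integral_translate v1 ct); last first.
  move=> x; congr (cube_integral _); apply/funext => u.
  rewrite -(pf (row_mx (x%:M : 'rV_1) u) (row_mx (1%:M : 'rV_1) 0)) map_row.
  rewrite (add_row_mx (x%:M : 'rV_1) u) map_mx0 addr0.
  by rewrite -raddfD.
apply: eq_unit_integral => t _.
rewrite -(IH (fun u : 'rV[R]_m => f (row_mx ((v1 + t)%:M : 'rV[R]_1) u)) v2) //; last first.
  move=> u k; rewrite -(pf (row_mx ((v1 + t)%:M : 'rV_1) u) (row_mx (0%:M : 'rV_1) k)) map_row.
  by rewrite (add_row_mx ((v1 + t)%:M : 'rV_1) u) -raddfD addr0.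
congr (cube_integral _); apply/funext => u.
by rewrite {1}vE (add_row_mx (t%:M : 'rV_1) u) -raddfD [t + v1]addrC.
Qed.

(** [unit_integral_zoom] in each variable; the inner averages stay nonnegative. *)
Lemma cube_zoom m (f : 'rV[R]_m -> R) (s : 'rV[R]_m) (c : R) :
  continuous f -> (forall x, 0 <= f x) -> 0 < c -> c <= 1 ->
  cube_integral (fun t => f (s + c *: t)) <= c^-1 ^+ m * cube_integral (fun t => f (s + t)).
Proof.
move=> + + c0 c1; elim: m f s => [|m IH] f s cf f0.
  by rewrite expr0 mul1r le_eqVlt /=; apply/orP; left; apply/eqP; congr (f _); apply/rowP => -[].
have sl (g : 'rV[R]_m.+1 -> R) t : continuous g ->
    continuous (fun u : 'rV[R]_m => g (row_mx (t%:M : 'rV[R]_1) u)).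
  by move=> cg; exact: (@cont_slice _ _ _ (fun t u => g (row_mx (t%:M : 'rV[R]_1) u)) t (cont_slab cg)).
have ct (g : 'rV[R]_m.+1 -> R) : continuous g ->
    continuous (fun t => cube_integral (fun u : 'rV[R]_m => g (row_mx (t%:M : 'rV[R]_1) u))).
  by move=> cg; exact: (mean_cont (mean_cube m) (cont_slab cg)).
pose s1 := (lsubmx (s : 'rV_(1 + m))) 0 0; pose s2 := rsubmx (s : 'rV_(1 + m)).
have sE : s = row_mx (s1%:M : 'rV_1) s2.
  have <- : lsubmx (s : 'rV_(1 + m)) = s1%:M.
    by apply/matrixP => i j; rewrite !ord1 [RHS]mxE mulr1n.
  exact: (esym (@hsubmxK _ 1 1 m _)).
pose G t := cube_integral (fun u : 'rV[R]_m => f (row_mx (t%:M : 'rV[R]_1) (s2 + u))).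
have cfs : continuous (fun x : 'rV[R]_m.+1 => f (x + row_mx (0%:M : 'rV_1) s2)).
  by apply: (cont_comp _ cf); apply: cont_addmx; [exact: cont_id|exact: cont_const].
have GE t : G t = cube_integral (fun u : 'rV[R]_m =>
    (fun x : 'rV[R]_m.+1 => f (x + row_mx (0%:M : 'rV_1) s2)) (row_mx (t%:M : 'rV[R]_1) u)).
  congr (cube_integral _); apply/funext => u.
  by rewrite (add_row_mx (t%:M : 'rV_1) u) -raddfD addr0 addrC.
have cG : continuous G by rewrite (funext GE); apply: (ct _ cfs).
have caff d : continuous (fun t : R => s1 + d * t).
  by apply: contD; [exact: cont_cst|apply: contM; [exact: cont_cst|exact: cont_id]].
have LE d t (u : 'rV[R]_m) : s + d *: (row_mx (t%:M : 'rV[R]_1) u : 'rV[R]_m.+1) =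
    row_mx ((s1 + d * t)%:M : 'rV_1) (s2 + d *: u).
  rewrite {1}sE (scale_row_mx d (t%:M : 'rV_1) u) (add_row_mx (s1%:M : 'rV_1) s2).
  by rewrite scale_scalar_mx -raddfD.
rewrite !cube_integralS.
have E1 : unit_integral (fun t => cube_integral (fun u : 'rV[R]_m => f (s + row_mx (t%:M : 'rV[R]_1) u))) =
    unit_integral (fun t => G (s1 + t)).
  apply: eq_unit_integral => t _; congr (cube_integral _); apply/funext => u.
  by rewrite -[X in s + X]scale1r LE mul1r scale1r.
rewrite [X in _ <= _ * X]E1.
have cv : continuous (fun x : 'rV[R]_m.+1 => f (s + c *: x)).
  apply: (cont_comp _ cf); apply: cont_addmx; first exact: cont_const.
  by apply: cont_scalemx; [exact: cont_cst|exact: cont_id].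
apply: le_trans (_ : unit_integral (fun t => c^-1 ^+ m * G (s1 + c * t)) <= _).
  apply: (mean_le (mean_unit R)).
  - exact: (ct _ cv).
  - by apply: contM; [exact: cont_cst|apply: (cont_comp _ cG)].
  move=> t _; rewrite /G; under [X in cube_integral X]funext => u do rewrite LE.
  apply: (IH (fun u : 'rV[R]_m => f (row_mx ((s1 + c * t)%:M : 'rV[R]_1) u))) => //.
  exact: sl.
have cGc : continuous (fun t => G (s1 + c * t)) by apply: (cont_comp _ cG).
rewrite (meanZ (mean_unit R)) // exprSr -mulrA ler_pM2l ?exprn_gt0 ?invr_gt0 //.
apply: unit_integral_zoom => // x; apply: (mean_ge0 (mean_cube m)) => //.
apply: (cont_comp _ (sl _ x cf)); apply: cont_addmx; [exact: cont_const|exact: cont_id].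
Qed.

End CubeMean.

(** * Averages over the torus and functions of class C^k *)

Section TorusMean.
Variables (R : realType) (n : nat) (B : 'M[R]_(n + n)).
Hypothesis Bu : B \in unitmx.
Local Notation pt := 'rV[R]_(n + n).
Implicit Types f g : pt -> R.

(** The average over a fundamental domain, for the normalised Lebesgue measure. *)
Definition torus_mean f : R := cube_integral (fun t => f (t *m B)).

Definition cell : set pt := (fun t => t *m B) @` @cube R (n + n).

Lemma mean_torus : mean cell torus_mean.
Proof.
have cB : continuous (fun t : pt => t *m B) by apply: cont_mulmx; exact: cont_id.
have mC := mean_cube R (n + n); split.
- by apply: continuous_compact; [exact: continuous_subspaceT|exact: mean_compact mC].
- by move=> a f g cf cg; apply: (mean_lin mC); exact: (cont_comp cB).
- move=> f cf f0; apply: (mean_ge0 mC); first exact: (cont_comp cB).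
  by move=> t ct; apply: f0; exists t.
- exact: (mean_cst mC).
Qed.

Lemma lattice_periodicZ f : lattice_periodic B f -> periodicZ (fun t => f (t *m B)).
Proof.
by move=> pf t k; rewrite mulmxDl pf //; exists k.
Qed.

Lemma torus_mean_translate f v : continuous f -> lattice_periodic B f ->
  torus_mean (fun x => f (x + v)) = torus_mean f.
Proof.
move=> cf pf; have cB : continuous (fun t : pt => t *m B) by apply: cont_mulmx; exact: cont_id.
rewrite /torus_mean -(cube_translate (v *m invmx B) _ (lattice_periodicZ pf)); last exact: (cont_comp cB).
by congr (cube_integral _); apply/funext => t; rewrite mulmxDl mulmxKV.
Qed.

Lemma torus_mean_zoom f y (c : R) : continuous f -> lattice_periodic B f ->
  (forall x, 0 <= f x) -> 0 < c -> c <= 1 ->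
  cube_integral (fun t : pt => f (y + (c *: t) *m B)) <= c^-1 ^+ (n + n) * torus_mean f.
Proof.
move=> cf pf f0 c0 c1.
have cB : continuous (fun t : pt => t *m B) by apply: cont_mulmx; exact: cont_id.
have cfB : continuous (fun t : pt => f (t *m B)) by exact: (cont_comp cB).
have := cube_zoom (y *m invmx B) cfB (fun x => f0 _) c0 c1.
have -> : cube_integral (fun t => f ((y *m invmx B + t) *m B)) = torus_mean f.
  rewrite /torus_mean -(cube_translate (y *m invmx B) cfB (lattice_periodicZ pf)).
  by congr (cube_integral _); apply/funext => t; rewrite addrC.
by congr (cube_integral _ <= _); apply/funext => t; rewrite mulmxDl mulmxKV.
Qed.

Lemma torus_integralE f : torus_integral B f = `|\det B| * torus_mean f.
Proof. by []. Qed.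

Lemma det_pos : 0 < `|\det B|.
Proof. by rewrite normr_gt0 -unitfE -unitmxE. Qed.

(** A periodic continuous function is controlled by its values on a compact
    fundamental domain. *)
Lemma cell_repr x : exists2 y, cell y & lattice B (x - y).
Proof.
have [t ->] : exists t, x = t *m B by exists (x *m invmx B); rewrite mulmxKV.
pose k : 'rV[int]_(n + n) := \row_i Num.floor (t 0 i).
exists ((t - map_mx intr k) *m B).
  exists (t - map_mx intr k) => //; move=> i; rewrite /= in_itv /= !mxE.
  have h1 := floor_le_tmp (t 0 i); have := floorD1_gt (t 0 i); rewrite intrD => h2.
  by rewrite subr_ge0 h1 /= lerBlDl ltW.
by exists k; rewrite -mulmxBl opprB addrC subrK.
Qed.

Lemma periodic_eq f x y : lattice_periodic B f -> lattice B (x - y) -> f x = f y.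
Proof. by move=> pf xy; rewrite -(pf y _ xy) addrC subrK. Qed.

Lemma periodic_bounded f : continuous f -> lattice_periodic B f ->
  exists2 C : R, 0 < C & forall x, `|f x| <= C.
Proof.
move=> cf pf; have [c c0 hc] := compact_bounded_fun (mean_compact mean_torus) cf.
exists c => // x; have [y cy xy] := cell_repr x; rewrite (periodic_eq pf xy).
exact: hc.
Qed.

Lemma periodic_lower f : continuous f -> lattice_periodic B f -> (forall x, 0 < f x) ->
  exists2 c : R, 0 < c & forall x, c <= f x.
Proof.
move=> cf pf f0; have [C C0 fC] : exists2 C : R, 0 < C & forall x, `|(f x)^-1| <= C.
  apply: periodic_bounded; first by apply: cont_inv => // x; rewrite gt_eqF.
  by move=> x v lv; rewrite pf.
exists C^-1; first by rewrite invr_gt0.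
move=> x; have := fC x; rewrite ger0_norm ?invr_ge0 ?(ltW (f0 _)) // => h.
by rewrite -[f x]invrK lef_pV2 // posrE invr_gt0.
Qed.

Lemma torus_mean_gt0 f : continuous f -> lattice_periodic B f -> (forall x, 0 < f x) ->
  0 < torus_mean f.
Proof.
move=> cf pf f0; have [c c0 fc] := periodic_lower cf pf f0.
by apply: lt_le_trans c0 _; apply: (mean_ge_cst mean_torus).
Qed.

End TorusMean.

Section PartialDerivatives.
Variables (R : realType) (m : nat).
Local Notation pt := 'rV[R]_m.
Implicit Types (f g : pt -> R) (a : 'I_m).
Local Notation e_ a := (delta_mx 0 a : 'rV[R]_m).

Lemma is_derive_line f (x v : pt) (r df : R) :
  is_derive (x + r *: v) v f df <-> is_derive r 1 (fun s : R => f (x + s *: v)) df.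
Proof.
have E : (fun h : R => h^-1 *: ((f \o shift (x + r *: v)) (h *: v) - f (x + r *: v))) =
  (fun h : R => h^-1 *: (((fun s : R => f (x + s *: v)) \o shift r) (h *: (1:R)) - f (x + r *: v))).
  apply/funext => h /=; congr (_ *: (f _ - _)).
  by rewrite /shift /= scalerDl /GRing.scale /= mulr1 addrA addrC addrCA addrA addrC addrA.
by split=> -[d1 d2]; apply: DeriveDef; move: d1 d2; rewrite /derivable /derive E.
Qed.

Lemma is_derive_chain f (phi : R -> R) (x v : pt) (df dphi : R) :
  is_derive x v f df -> is_derive (f x) 1 phi dphi ->
  is_derive x v (fun y => phi (f y)) (dphi * df).
Proof.
move=> hf hphi; have x0 : x = x + 0 *: v by rewrite scale0r addr0.
move: hf; rewrite {1}x0 => /is_derive_line hf.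
rewrite {1}x0; apply/(is_derive_line (fun y => phi (f y))).
have h2 : is_derive ((fun s : R => f (x + s *: v)) 0) 1 phi dphi by rewrite /= -x0.
by have := @is_derive1_comp R phi (fun s : R => f (x + s *: v)) 0 _ _ h2 hf; rewrite /GRing.scale /= mulrC.
Qed.

Lemma partial_is_derive f a x : derivable f x (e_ a) -> is_derive x (e_ a) f (partial a f x).
Proof. by move=> df; apply: DeriveDef. Qed.

Lemma is_derive_partial f a x df : is_derive x (e_ a) f df ->
  derivable f x (e_ a) /\ partial a f x = df.
Proof. by case. Qed.

Lemma Ck_cont k f : Ck k f -> continuous f.
Proof. by case: k => [|k] []. Qed.

Lemma CkS k f : Ck k.+1 f -> Ck k f.
Proof.
elim: k f => [|k IH] f [cf df]; first by split.
by split=> // a; have [d1 d2] := df a; split=> //; exact: IH.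
Qed.

Lemma Ck_derivable k f a x : Ck k.+1 f -> derivable f x (e_ a).
Proof. by case=> _ /(_ a)[]. Qed.

Lemma Ck_partial k f a : Ck k.+1 f -> Ck k (partial a f).
Proof. by case=> _ /(_ a)[]. Qed.

Lemma Ck_is_derive k f a x : Ck k.+1 f -> is_derive x (e_ a) f (partial a f x).
Proof. by move=> cf; apply: partial_is_derive; exact: Ck_derivable cf. Qed.

Lemma CkSI k f (df : 'I_m -> pt -> R) : continuous f ->
  (forall a x, is_derive x (e_ a) f (df a x)) -> (forall a, Ck k (df a)) -> Ck k.+1 f.
Proof.
move=> cf hd hk; split=> // a; split=> [x|]; first by have [] := hd a x.
by rewrite (_ : partial a f = df a) //; apply/funext => x; have [] := hd a x.
Qed.

Lemma is_derive_cstf (c : R) a x : is_derive x (e_ a) (fun _ : pt => c) 0.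
Proof. exact: is_derive_cst. Qed.

Lemma Ck_cst k (c : R) : Ck k (fun _ : pt => c).
Proof.
elim: k c => [|k IH] c; first by split=> //; exact: cont_cst.
apply: (@CkSI k _ (fun _ _ => 0)); first exact: cont_cst.
by move=> a; exact: IH.
Qed.

Lemma is_deriveDf f g a x df dg : is_derive x (e_ a) f df -> is_derive x (e_ a) g dg ->
  is_derive x (e_ a) (fun y => f y + g y) (df + dg).
Proof. exact: is_deriveD. Qed.

Lemma is_deriveMf f g a x df dg : is_derive x (e_ a) f df -> is_derive x (e_ a) g dg ->
  is_derive x (e_ a) (fun y => f y * g y) (df * g x + f x * dg).
Proof.
move=> hf hg; have := is_deriveM hf hg; rewrite /GRing.scale /= => h.
by apply: is_derive_eq h _; rewrite addrC [g x * _]mulrC.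
Qed.

Lemma is_deriveVf f a x df : f x != 0 -> is_derive x (e_ a) f df ->
  is_derive x (e_ a) (fun y => (f y)^-1) (- df * ((f x)^-1 * (f x)^-1)).
Proof.
move=> f0 [hf <-]; apply: DeriveDef; first exact: derivableV.
by rewrite deriveV // /GRing.scale /= expr2 invfM; ring.
Qed.

Lemma is_derive_lnf f a x df : 0 < f x -> is_derive x (e_ a) f df ->
  is_derive x (e_ a) (fun y => ln (f y)) (df * (f x)^-1).
Proof.
move=> f0 hf; have := is_derive_chain hf (is_derive1_ln f0).
by rewrite mulrC.
Qed.

Lemma CkD k f g : Ck k f -> Ck k g -> Ck k (fun x => f x + g x).
Proof.
elim: k f g => [|k IH] f g hf hg; first by split=> //; apply: contD; [exact: Ck_cont hf|exact: Ck_cont hg].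
apply: (CkSI (df := fun a x => partial a f x + partial a g x)).
- by apply: contD; [exact: Ck_cont hf|exact: Ck_cont hg].
- by move=> a x; apply: is_deriveDf; [exact: Ck_is_derive hf|exact: Ck_is_derive hg].
- by move=> a; apply: IH; exact: Ck_partial.
Qed.

Lemma CkM k f g : Ck k f -> Ck k g -> Ck k (fun x => f x * g x).
Proof.
elim: k f g => [|k IH] f g hf hg; first by split=> //; apply: contM; [exact: Ck_cont hf|exact: Ck_cont hg].
apply: (CkSI (df := fun a x => partial a f x * g x + f x * partial a g x)).
- by apply: contM; [exact: Ck_cont hf|exact: Ck_cont hg].
- by move=> a x; apply: is_deriveMf; [exact: Ck_is_derive hf|exact: Ck_is_derive hg].
- move=> a; apply: CkD; apply: IH.
  + exact: Ck_partial.
  + exact: CkS.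
  + exact: CkS.
  + exact: Ck_partial.
Qed.

Lemma CkN k f : Ck k f -> Ck k (fun x => - f x).
Proof.
move=> hf; rewrite (_ : (fun _ => _) = fun x => -1 * f x); first by apply: CkM => //; exact: Ck_cst.
by apply/funext => x; rewrite mulN1r.
Qed.

Lemma CkV k f : (forall x, f x != 0) -> Ck k f -> Ck k (fun x => (f x)^-1).
Proof.
move=> f0; elim: k => [|k IH] hf; first by split=> //; apply: cont_inv => //; exact: Ck_cont hf.
apply: (CkSI (df := fun a x => - partial a f x * ((f x)^-1 * (f x)^-1))).
- by apply: cont_inv => //; exact: Ck_cont hf.
- by move=> a x; apply: is_deriveVf => //; exact: Ck_is_derive hf.
- move=> a; have hi := IH (CkS hf).
  by apply: CkM; [apply: CkN; exact: Ck_partial|exact: CkM].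
Qed.

Lemma Ck_ln k f : (forall x, 0 < f x) -> Ck k f -> Ck k (fun x => ln (f x)).
Proof.
move=> f0 hf.
have cl : continuous (fun x => ln (f x)).
  move=> x; apply: (@continuous_comp _ _ _ f (@ln R)); first exact: (Ck_cont hf).
  exact: continuous_ln.
case: k hf => [|k] hf; first by split.
apply: (CkSI (df := fun a x => partial a f x * (f x)^-1)) => //.
- by move=> a x; apply: is_derive_lnf => //; exact: Ck_is_derive hf.
- move=> a; apply: CkM; first exact: Ck_partial.
  by apply: CkV => [x|]; [rewrite gt_eqF|exact: CkS].
Qed.

Lemma partial_FTC f a (x : pt) (c : R) : Ck 1 f ->
  f (x + c *: e_ a) - f x = c * unit_integral (fun s => partial a f (x + (s * c) *: e_ a)).
Proof.
move=> hf; have cl : continuous (fun s : R => x + (s * c) *: e_ a).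
  apply: cont_addmx; first exact: cont_const.
  by apply: cont_scalemx; [apply: contM; [exact: cont_id|exact: cont_cst]|exact: cont_const].
have cp : continuous (fun s : R => partial a f (x + (s * c) *: e_ a)).
  exact: (cont_comp cl (Ck_cont (Ck_partial a hf))).
rewrite -(meanZ (mean_unit R)) //.
suff dF (t : R) : is_derive t 1 (fun s => f (x + (s * c) *: e_ a))
    (c * partial a f (x + (t * c) *: e_ a)).
  rewrite (@FTC R _ _ _ dF); first by rewrite mul1r mul0r scale0r addr0.
  by apply: contM => //; exact: cont_cst.
have h1 : is_derive (t * c) 1 (fun s : R => f (x + s *: e_ a)) (partial a f (x + (t * c) *: e_ a)).
  by apply/is_derive_line; exact: Ck_is_derive hf.
have h2 : is_derive t 1 (fun s : R => s * c) c.
  rewrite (_ : (fun s : R => s * c) = c \*: id); last first.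
    by apply/funext => s; rewrite /GRing.scale /= mulrC.
  by have := is_deriveZ c (is_derive_id t (1 : R)); rewrite /GRing.scale /= mulr1.
by have := @is_derive1_comp R (fun s : R => f (x + s *: e_ a)) (fun s => s * c) t _ _ h1 h2; rewrite /GRing.scale /= mulrC.
Qed.

Lemma partial_shift f a (v x : pt) :
  partial a (fun y => f (y + v)) x = partial a f (x + v).
Proof.
have E : (fun h : R => h^-1 *: (((fun y => f (y + v)) \o shift x) (h *: e_ a) - f (x + v))) =
  (fun h : R => h^-1 *: ((f \o shift (x + v)) (h *: e_ a) - f (x + v))).
  by apply/funext => h; rewrite /= /shift /= addrA.
by rewrite /partial /derive E.
Qed.

Lemma derivable_shift f (v x w : pt) : derivable f (x + v) w -> derivable (fun y => f (y + v)) x w.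
Proof.
have E : (fun h : R => h^-1 *: (((fun y => f (y + v)) \o shift x) (h *: w) - f (x + v))) =
  (fun h : R => h^-1 *: ((f \o shift (x + v)) (h *: w) - f (x + v))).
  by apply/funext => h; rewrite /= /shift /= addrA.
by rewrite /derivable E.
Qed.

Lemma Ck_shift k f v : Ck k f -> Ck k (fun x => f (x + v)).
Proof.
elim: k f => [|k IH] f hf.
  by split=> //; apply: (cont_comp _ (Ck_cont hf)); apply: cont_addmx; [exact: cont_id|exact: cont_const].
split; first by apply: (cont_comp _ (Ck_cont hf)); apply: cont_addmx; [exact: cont_id|exact: cont_const].
move=> a; split=> [x|]; first by apply: derivable_shift; exact: Ck_derivable hf.
by rewrite (funext (partial_shift f a v)); apply: IH; exact: Ck_partial.
Qed.

End PartialDerivatives.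

(** * The Poincare inequality on the torus *)

Section TorusCalculus.
Variables (R : realType) (n : nat) (B : 'M[R]_(n + n)).
Hypothesis Bu : B \in unitmx.
Local Notation pt := 'rV[R]_(n + n).
Local Notation e_ a := (delta_mx 0 a : 'rV[R]_(n + n)).
Local Notation M := (torus_mean B).
Implicit Types f g : pt -> R.

Let mM := mean_torus B.

Lemma cont_shift f (v : pt) : continuous f -> continuous (fun x : pt => f (x + v)).
Proof.
by move=> cf; apply: (cont_comp _ cf); apply: cont_addmx; [exact: cont_id|exact: cont_const].
Qed.

Lemma periodic_partial f a : lattice_periodic B f -> lattice_periodic B (partial a f).
Proof.
by move=> pf x v lv; rewrite -partial_shift; congr (partial a _ x); apply/funext => y; rewrite pf.
Qed.

Lemma cont_segment (g : pt -> R) (w : pt) a (c : R) : continuous g ->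
  continuous (fun p : R * pt => g (p.2 + (w + (p.1 * c) *: e_ a))).
Proof.
move=> cg; apply: (cont_comp _ cg); apply: cont_addmx; first exact: cont_snd.
apply: cont_addmx; first exact: cont_const.
apply: cont_scalemx; last exact: cont_const.
by apply: contM; [exact: cont_fst|exact: cont_cst].
Qed.

Lemma cont_segment0 (g : pt -> R) a (c : R) : continuous g ->
  continuous (fun p : R * pt => g (p.2 + (p.1 * c) *: e_ a)).
Proof.
move=> cg; apply: (cont_comp _ cg); apply: cont_addmx; first exact: cont_snd.
apply: cont_scalemx; last exact: cont_const.
by apply: contM; [exact: cont_fst|exact: cont_cst].
Qed.

(** A derivative has mean zero because the mean of a function is unchanged by
    the translations that it differentiates. *)
Lemma torus_mean_partial f a : Ck 1 f -> lattice_periodic B f -> M (partial a f) = 0.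
Proof.
move=> hf pf; have cf := Ck_cont hf.
have cd : continuous (partial a f) := Ck_cont (Ck_partial a hf).
have := torus_mean_translate Bu (1 *: e_ a) cf pf.
move/eqP; rewrite -subr_eq0 -(meanB mM) //; last exact: cont_shift.
rewrite (funext (fun x => partial_FTC a x 1 hf)).
under [X in M X]funext => x do rewrite mul1r.
rewrite -(mean_swap_unit (F := fun (s : R) (x : pt) => partial a f (x + (s * 1) *: e_ a)) mM); last first.
  exact: cont_segment0.
rewrite (@eq_unit_integral _ _ (fun=> M (partial a f))) ?unit_integral_cst => [/eqP //|s _].
by rewrite (torus_mean_translate Bu) //; exact: periodic_partial.
Qed.

Lemma coord_translate_L1 f a (c : R) : Ck 1 f -> lattice_periodic B f ->
  M (fun x => `|f (x + c *: e_ a) - f x|) <= `|c| * M (fun x => `|partial a f x|).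
Proof.
move=> hf pf; have cf := Ck_cont hf.
have cd : continuous (partial a f) := Ck_cont (Ck_partial a hf).
have cdn : continuous (fun x : pt => `|partial a f x|) by apply: cont_norm.
have cG : continuous (fun p : R * pt => `|partial a f (p.2 + (p.1 * c) *: e_ a)|).
  exact: (@cont_segment0 (fun x => `|partial a f x|)).
have csl x : continuous (fun s : R => partial a f (x + (s * c) *: e_ a)).
  apply: (cont_comp _ cd); apply: cont_addmx; first exact: cont_const.
  by apply: cont_scalemx; [apply: contM; [exact: cont_id|exact: cont_cst]|exact: cont_const].
have cJ : continuous (fun x : pt => unit_integral (fun s => `|partial a f (x + (s * c) *: e_ a)|)).
  exact: (mean_cont (F := fun (x : pt) (s : R) => `|partial a f (x + (s * c) *: e_ a)|) (mean_unit R) (swap_pair_cont (F := fun (s : R) (x : pt) => `|partial a f (x + (s * c) *: e_ a)|) cG)).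
apply: (@le_trans _ _ (M (fun x => `|c| * unit_integral (fun s => `|partial a f (x + (s * c) *: e_ a)|)))).
  apply: (mean_le mM).
  - by apply: cont_norm; apply: contB => //; exact: cont_shift.
  - by apply: contM => //; exact: cont_cst.
  - move=> x _; rewrite partial_FTC // normrM ler_wpM2l //.
    exact: (mean_abs (mean_unit R)).
rewrite (meanZ mM) // ler_wpM2l //.
rewrite -(mean_swap_unit (F := fun (s : R) (x : pt) => `|partial a f (x + (s * c) *: e_ a)|) mM) //.
rewrite (@eq_unit_integral _ _ (fun=> M (fun x => `|partial a f x|))) ?unit_integral_cst // => s _.
rewrite (torus_mean_translate Bu (f := fun x => `|partial a f x|)) //.
by move=> x v lv; rewrite (periodic_partial a pf).
Qed.

(** Move along one coordinate direction at a time; the mean of the increment is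
    insensitive to the starting point. *)
Lemma translate_L1 f (v : pt) : Ck 1 f -> lattice_periodic B f ->
  M (fun x => `|f (x + v) - f x|) <= \sum_a `|v 0 a| * M (fun x => `|partial a f x|).
Proof.
move=> hf pf; have cf := Ck_cont hf; rewrite {1}(row_sum_delta v).
elim/big_rec2: _ => [|a s w _ IH].
  rewrite (_ : (fun _ => _) = fun=> 0) ?(mean_cst mM) //.
  by apply/funext => x; rewrite addr0 subrr normr0.
have c1 : continuous (fun x : pt => `|f (x + v 0 a *: e_ a) - f x|).
  by apply: cont_norm; apply: contB => //; exact: cont_shift.
have c2 : continuous (fun x : pt => `|f (x + w) - f x|).
  by apply: cont_norm; apply: contB => //; exact: cont_shift.
apply: (@le_trans _ _ (M (fun x => `|f (x + w + v 0 a *: e_ a) - f (x + w)|) + M (fun x => `|f (x + w) - f x|))).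
  rewrite -(meanD mM) //; last exact: (@cont_shift _ w c1).
  apply: (mean_le mM).
  - by apply: cont_norm; apply: contB => //; exact: cont_shift.
  - by apply: contD => //; exact: (@cont_shift _ w c1).
  - move=> x _; rewrite addrA addrAC.
    have -> : f (x + w + v 0 a *: e_ a) - f x = (f (x + w + v 0 a *: e_ a) - f (x + w)) + (f (x + w) - f x) by ring.
    exact: ler_normD.
apply: lerD => //; rewrite (torus_mean_translate Bu w c1); first exact: coord_translate_L1.
move=> x u lu; rewrite (pf x u lu) -(pf (x + v 0 a *: e_ a) u lu).
by congr (`|f _ - _|); exact: addrAC.
Qed.

Lemma cont_translates (g : pt -> R) : continuous g ->
  continuous (fun p : pt * pt => g (p.2 + p.1 *m B)).
Proof.
move=> cg; apply: (cont_comp _ cg); apply: cont_addmx; first exact: cont_snd.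
by apply: cont_mulmx; exact: cont_fst.
Qed.

Lemma mean_as_translates f x : continuous f -> lattice_periodic B f ->
  cube_integral (fun t => f (x + t *m B)) = M f.
Proof.
move=> cf pf; rewrite -(torus_mean_translate Bu x cf pf) /torus_mean.
by congr (cube_integral _); apply/funext => t; rewrite addrC.
Qed.

(** The difference [f x - M f] is the average of [f x - f (x + t *m B)] over [t]
    in the cube; after exchanging the two averages [translate_L1] applies. *)
Lemma poincare : exists2 C : R, 0 < C & forall f, Ck 1 f -> lattice_periodic B f ->
  M (fun x => `|f x - M f|) <= C * \sum_a M (fun x => `|partial a f x|).
Proof.
have [C C0 hC] : exists2 C : R, 0 < C & forall (t : pt) a, cube t -> `|(t *m B) 0 a| <= C.
  have /compact_bounded [N [Nr NP]] := mean_compact mM.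
  have N1 : N < `|N| + 1 by rewrite (le_lt_trans (ler_norm _)) // ltrDl.
  exists (`|N| + 1); first by rewrite ltr_wpDl.
  move=> t a ct; apply: le_trans (NP _ N1 (t *m B) _); last by exists t.
  rewrite [leRHS]/Num.norm /=.
  by rewrite mx_normrE; apply: (le_bigmax _ (fun i => `|(t *m B) i.1 i.2|) (0, a)).
exists C => // f hf pf; have cf := Ck_cont hf.
have mC := mean_cube R (n + n).
pose F (t x : pt) := `|f x - f (x + t *m B)|.
have cF : continuous (fun p : pt * pt => F p.1 p.2).
  apply: cont_norm; apply: contB; last exact: cont_translates.
  by apply: (cont_comp _ cf); exact: cont_snd.
have cFx x : continuous (F^~ x).
  exact: (@cont_slice _ _ _ (fun x t => F t x) x (swap_pair_cont cF)).
have cxt x : continuous (fun t : pt => f (x + t *m B)).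
  apply: (cont_comp _ cf); apply: cont_addmx; first exact: cont_const.
  by apply: cont_mulmx; exact: cont_id.
apply: (@le_trans _ _ (M (fun x => cube_integral (fun t => F t x)))).
  apply: (mean_le mM).
  - by apply: cont_norm; apply: contB => //; exact: cont_cst.
  - exact: (mean_cont (F := fun x t => F t x) mC (swap_pair_cont cF)).
  move=> x _; rewrite -(mean_as_translates x cf pf).
  rewrite -[X in `|X - _|](mean_cst mC) -(meanB mC) //; last exact: cont_cst.
  by apply: (mean_abs mC); apply: contB => //; exact: cont_cst.
rewrite -(mean_swap_cube mM) //.
apply: (mean_le_cst mC); first exact: (mean_cont mM).
move=> t ct; rewrite mulr_sumr; under [X in M X]funext => x do rewrite /F distrC.
apply: le_trans (translate_L1 _ hf pf) _; apply: ler_sum => a _.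
rewrite ler_wpM2r ?hC //; apply: (mean_ge0 mM) => //.
by apply: cont_norm; exact: (Ck_cont (Ck_partial a hf)).
Qed.

(** The pairing of [phi] with the translates of [f] is constant, because its
    derivatives vanish; averaging over all translations replaces [f] by its
    mean. *)
Lemma pairing_mean (J : finType) (phi f : J -> pt -> R) :
  (forall i, continuous (phi i)) -> (forall i, lattice_periodic B (phi i)) ->
  (forall i, Ck 1 (f i)) -> (forall i, lattice_periodic B (f i)) ->
  (forall a y, M (fun x => \sum_i phi i x * partial a (f i) (x + y)) = 0) ->
  M (fun x => \sum_i phi i x * f i x) = M (fun x => \sum_i phi i x * M (f i)).
Proof.
move=> cphi pphi hf pf H; have cf i := Ck_cont (hf i).
have cd i a : continuous (partial a (f i)) := Ck_cont (Ck_partial a (hf i)).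
have cpv v : continuous (fun x : pt => \sum_i phi i x * f i (x + v)).
  by apply: cont_sum => i _; apply: contM => //; exact: cont_shift.
have step a (c : R) w : M (fun x => \sum_i phi i x * f i (x + (c *: e_ a + w))) =
    M (fun x => \sum_i phi i x * f i (x + w)).
  apply/eqP; rewrite -subr_eq0 -(meanB mM) //; apply/eqP.
  pose G s x := c * \sum_i phi i x * partial a (f i) (x + (w + (s * c) *: e_ a)).
  have cGi i : continuous (fun p : R * pt => phi i p.2 * partial a (f i) (p.2 + (w + (p.1 * c) *: e_ a))).
    apply: contM; first by apply: (cont_comp _ (cphi i)); exact: cont_snd.
    exact: cont_segment.
  have cG : continuous (fun p : R * pt => G p.1 p.2).
    by apply: contM; [exact: cont_cst|apply: cont_sum].
  have cs' i x : continuous (fun s : R => partial a (f i) (x + (w + (s * c) *: e_ a))).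
    apply: (cont_comp _ (cd i a)); apply: cont_addmx; first exact: cont_const.
    apply: cont_addmx; first exact: cont_const.
    by apply: cont_scalemx; [apply: contM; [exact: cont_id|exact: cont_cst]|exact: cont_const].
  have cs i x : continuous (fun s : R => phi i x * partial a (f i) (x + (w + (s * c) *: e_ a))).
    by apply: contM; [exact: cont_cst|exact: cs'].
  transitivity (M (fun x => unit_integral (fun s => G s x))).
    congr (M _); apply/funext => x.
    rewrite /G (meanZ (mean_unit R)); last exact: cont_sum.
    rewrite (mean_sum (mean_unit R)) // -sumrB mulr_sumr; apply: eq_bigr => i _.
    rewrite (meanZ (mean_unit R)) // -mulrBr mulrCA; congr (_ * _).
    have -> : x + (c *: e_ a + w) = x + w + c *: e_ a by rewrite [c *: _ + w]addrC addrA.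
    rewrite (partial_FTC a (x + w) c (hf i)).
    have -> : (fun s : R => partial a (f i) (x + w + (s * c) *: e_ a)) =
        (fun s : R => partial a (f i) (x + (w + (s * c) *: e_ a))).
      by apply/funext => s; rewrite -addrA.
    by [].
  rewrite -(mean_swap_unit mM) // (@eq_unit_integral _ _ (fun=> 0)) ?unit_integral_cst // => s _.
  by rewrite /G (meanZ mM) ?H ?mulr0 //; apply: cont_sum => i _; apply: contM => //; exact: cont_shift.
have all v : M (fun x => \sum_i phi i x * f i (x + v)) = M (fun x => \sum_i phi i x * f i x).
  rewrite (row_sum_delta v); elim/big_rec: _ => [|a w _ IH].
    by congr (M _); apply/funext => x; apply: eq_bigr => i _; rewrite addr0.
  by rewrite step.
pose G (t x : pt) := \sum_i phi i x * f i (x + t *m B).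
have cGi i : continuous (fun p : pt * pt => phi i p.2 * f i (p.2 + p.1 *m B)).
  by apply: contM; [apply: (cont_comp _ (cphi i)); exact: cont_snd|exact: cont_translates].
have cG : continuous (fun p : pt * pt => G p.1 p.2) by apply: cont_sum.
have mC := mean_cube R (n + n).
transitivity (cube_integral (fun t => M (G t))).
  rewrite -[LHS](mean_cst mC); congr (cube_integral _); apply/funext => t.
  by rewrite /G all.
rewrite (mean_swap_cube mM) //; congr (M _); apply/funext => x.
have cft i : continuous (fun t : pt => f i (x + t *m B)).
  apply: (cont_comp _ (cf i)); apply: cont_addmx; first exact: cont_const.
  by apply: cont_mulmx; exact: cont_id.
rewrite (mean_sum mC) => [|i _]; last by apply: contM => //; exact: cont_cst.
by apply: eq_bigr => i _; rewrite (meanZ mC) // mean_as_translates.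
Qed.

End TorusCalculus.

(** * Complex differential calculus *)

Section ComplexCalculus.
Variables (R : realType) (n : nat).
Local Notation pt := 'rV[R]_(n + n).
Local Notation C := R[i].
Implicit Types (f g : pt -> C).

Definition CkC k f : Prop :=
  Ck k (fun x => complex.Re (f x)) /\ Ck k (fun x => complex.Im (f x)).

Lemma eq_CkC k f g : f =1 g -> CkC k f -> CkC k g.
Proof. by move=> /funext ->. Qed.

Lemma CkCS k f : CkC k.+1 f -> CkC k f.
Proof. by case=> h1 h2; split; exact: CkS. Qed.

Lemma CkC_real k (f : pt -> R) : Ck k f -> CkC k (fun x => (f x)%:C).
Proof. by move=> hf; split=> //; exact: Ck_cst. Qed.

Lemma CkC_cst k (c : C) : CkC k (fun=> c).
Proof. by split; exact: Ck_cst. Qed.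

Lemma CkCD k f g : CkC k f -> CkC k g -> CkC k (fun x => f x + g x).
Proof.
case=> f1 f2 [g1 g2]; split.
  by rewrite (funext (fun x => Re_add (f x) (g x))); exact: CkD.
by rewrite (funext (fun x => Im_add (f x) (g x))); exact: CkD.
Qed.

Lemma CkCM k f g : CkC k f -> CkC k g -> CkC k (fun x => f x * g x).
Proof.
case=> f1 f2 [g1 g2]; split.
  rewrite (funext (fun x => Re_mul (f x) (g x))); apply: CkD; first exact: CkM.
  by apply: CkN; exact: CkM.
by rewrite (funext (fun x => Im_mul (f x) (g x))); apply: CkD; exact: CkM.
Qed.

Lemma CkC_conj k f : CkC k f -> CkC k (fun x => conjc (f x)).
Proof.
case=> f1 f2; split; first by rewrite (funext (fun x => Re_conjc (f x))).
by rewrite (funext (fun x => Im_conjc (f x))); exact: CkN.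
Qed.

Lemma CkC_sum k (J : Type) (r : seq J) (F : J -> pt -> C) :
  (forall j, CkC k (F j)) -> CkC k (fun x => \sum_(j <- r) F j x).
Proof.
move=> hF; elim: r => [|j r IH].
  by apply: (@eq_CkC _ (fun=> 0)); [move=> x; rewrite big_nil|exact: CkC_cst].
apply: (@eq_CkC _ (fun x => F j x + \sum_(j <- r) F j x)); last exact: CkCD.
by move=> x; rewrite big_cons.
Qed.

Lemma CkC_prod k (J : Type) (r : seq J) (F : J -> pt -> C) :
  (forall j, CkC k (F j)) -> CkC k (fun x => \prod_(j <- r) F j x).
Proof.
move=> hF; elim: r => [|j r IH].
  by apply: (@eq_CkC _ (fun=> 1)); [move=> x; rewrite big_nil|exact: CkC_cst].
apply: (@eq_CkC _ (fun x => F j x * \prod_(j <- r) F j x)); last exact: CkCM.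
by move=> x; rewrite big_cons.
Qed.

Lemma CkC_det k m (g : pt -> 'M[C]_m) : (forall i j, CkC k (fun x => g x i j)) ->
  CkC k (fun x => \det (g x)).
Proof.
move=> hg; apply: CkC_sum => s; apply: CkCM; first exact: CkC_cst.
by apply: CkC_prod.
Qed.

Lemma CkC_adj k m (g : pt -> 'M[C]_m) i j : (forall i j, CkC k (fun x => g x i j)) ->
  CkC k (fun x => (\adj (g x)) i j).
Proof.
case: m g i j => [|m] g i j hg; first by case: i.
apply: (@eq_CkC _ (fun x => (-1) ^+ (j + i) * \det (row' j (col' i (g x))))).
  by move=> x; rewrite mxE.
apply: CkCM; first exact: CkC_cst.
apply: CkC_det => a b; apply: (@eq_CkC _ (fun x => g x (lift j a) (lift i b))) => // x.
by rewrite !mxE.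
Qed.

Definition contC f := continuous (fun x => complex.Re (f x)) /\ continuous (fun x => complex.Im (f x)).

Lemma CkC_contC k f : CkC k f -> contC f.
Proof. by case=> h1 h2; split; [exact: Ck_cont h1|exact: Ck_cont h2]. Qed.

Lemma is_deriveNf (f : pt -> R) a x df : is_derive x (delta_mx 0 a) f df ->
  is_derive x (delta_mx 0 a) (fun y => - f y) (- df).
Proof. exact: is_deriveN. Qed.

Lemma is_deriveBf (f g : pt -> R) a x df dg :
  is_derive x (delta_mx 0 a) f df -> is_derive x (delta_mx 0 a) g dg ->
  is_derive x (delta_mx 0 a) (fun y => f y - g y) (df - dg).
Proof. exact: is_deriveB. Qed.

Lemma partialC_add a f g x : CkC 1 f -> CkC 1 g ->
  partialC a (fun x => f x + g x) x = partialC a f x + partialC a g x.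
Proof.
case=> f1 f2 [g1 g2]; rewrite /partialC.
rewrite (funext (fun x => Re_add (f x) (g x))) (funext (fun x => Im_add (f x) (g x))).
have [_ ->] := is_derive_partial (is_deriveDf (Ck_is_derive a x f1) (Ck_is_derive a x g1)).
by have [_ ->] := is_derive_partial (is_deriveDf (Ck_is_derive a x f2) (Ck_is_derive a x g2)).
Qed.

Lemma partialC_mul a f g x : CkC 1 f -> CkC 1 g ->
  partialC a (fun x => f x * g x) x = partialC a f x * g x + f x * partialC a g x.
Proof.
case=> f1 f2 [g1 g2]; rewrite /partialC.
rewrite (funext (fun x => Re_mul (f x) (g x))) (funext (fun x => Im_mul (f x) (g x))).
have B1 := is_deriveMf (Ck_is_derive a x f1) (Ck_is_derive a x g1).
have B2 := is_deriveMf (Ck_is_derive a x f2) (Ck_is_derive a x g2).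
have B3 := is_deriveMf (Ck_is_derive a x f1) (Ck_is_derive a x g2).
have B4 := is_deriveMf (Ck_is_derive a x f2) (Ck_is_derive a x g1).
have [_ ->] := is_derive_partial (is_deriveBf B1 B2).
have [_ ->] := is_derive_partial (is_deriveDf B3 B4).
case: (f x) => p q; case: (g x) => r s; apply: eq_ReIm => /=; ring.
Qed.

Lemma partialC_cst a (c : C) x : partialC a (fun _ : pt => c) x = 0.
Proof.
rewrite /partialC; have [_ E] := is_derive_cstf (complex.Re c) a x.
by have [_ E'] := is_derive_cstf (complex.Im c) a x; rewrite /partial E E'.
Qed.

Lemma partialC_conj a f x : CkC 1 f -> partialC a (fun x => conjc (f x)) x = conjc (partialC a f x).
Proof.
case=> f1 f2; rewrite /partialC.
rewrite (funext (fun x => Re_conjc (f x))) (funext (fun x => Im_conjc (f x))).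
by have [_ ->] := is_derive_partial (is_deriveNf (Ck_is_derive a x f2)).
Qed.

Lemma partialC_real a (f : pt -> R) x : partialC a (fun x => (f x)%:C) x = (partial a f x)%:C.
Proof.
by rewrite /partialC /=; have [_ E] := is_derive_cstf 0 a x; rewrite /partial E.
Qed.

Lemma partialC_CkC k a f : CkC k.+1 f -> CkC k (partialC a f).
Proof. by case=> f1 f2; split; exact: Ck_partial. Qed.

(** What [d_z] and [d_zbar] have in common: first-order operators without
    constant term. *)
Record derivation (D : (pt -> C) -> pt -> C) : Prop := Derivation {
  derD : forall f g x, CkC 1 f -> CkC 1 g -> D (fun x => f x + g x) x = D f x + D g x;
  derM : forall f g x, CkC 1 f -> CkC 1 g -> D (fun x => f x * g x) x = D f x * g x + f x * D g x;
  der_cst : forall c x, D (fun=> c) x = 0 }.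

Lemma derivation_dz j : derivation (@d_z R n j).
Proof.
split=> [f g x hf hg|f g x hf hg|c x]; rewrite /d_z.
- by rewrite !partialC_add //; ring.
- by rewrite !partialC_mul //; ring.
- by rewrite !partialC_cst; ring.
Qed.

Lemma derivation_dzbar j : derivation (@d_zbar R n j).
Proof.
split=> [f g x hf hg|f g x hf hg|c x]; rewrite /d_zbar.
- by rewrite !partialC_add //; ring.
- by rewrite !partialC_mul //; ring.
- by rewrite !partialC_cst; ring.
Qed.

Lemma CkC_dz k j f : CkC k.+1 f -> CkC k (d_z j f).
Proof.
move=> hf; apply: CkCM; last exact: CkC_cst.
apply: CkCD; first exact: partialC_CkC.
apply: (@eq_CkC _ (fun x => - 'i * partialC (rshift n j) f x)); first by move=> x; rewrite mulNr.
by apply: CkCM; [exact: CkC_cst|exact: partialC_CkC].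
Qed.

Lemma CkC_dzbar k j f : CkC k.+1 f -> CkC k (d_zbar j f).
Proof.
move=> hf; apply: CkCM; last exact: CkC_cst.
apply: CkCD; first exact: partialC_CkC.
by apply: CkCM; [exact: CkC_cst|exact: partialC_CkC].
Qed.

Lemma conjcD (z w : C) : conjc (z + w) = conjc z + conjc w.
Proof. exact: rmorphD. Qed.
Lemma conjcB (z w : C) : conjc (z - w) = conjc z - conjc w.
Proof. exact: rmorphB. Qed.
Lemma conj2 : conjc (2 : C) = 2.
Proof. exact: conjc_nat. Qed.

Lemma conj_dz j f x : CkC 1 f -> conjc (d_z j f x) = d_zbar j (fun x => conjc (f x)) x.
Proof.
move=> hf; rewrite /d_z /d_zbar !partialC_conj // conjcM conjc_inv conj2.
by rewrite conjcB conjcM conjc_i mulNr opprK.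
Qed.

Lemma conj_dzbar j f x : CkC 1 f -> conjc (d_zbar j f x) = d_z j (fun x => conjc (f x)) x.
Proof.
move=> hf; rewrite /d_z /d_zbar !partialC_conj // conjcM conjc_inv conj2.
by rewrite conjcD conjcM conjc_i mulNr.
Qed.

Lemma partialC_l j f x : partialC (lshift n j) f x = d_z j f x + d_zbar j f x.
Proof. by rewrite /d_z /d_zbar; field. Qed.

Lemma partialC_r j f x : partialC (rshift n j) f x = 'i * (d_z j f x - d_zbar j f x).
Proof.
rewrite /d_z /d_zbar.
transitivity (- ('i * 'i) * partialC (rshift n j) f x); last by field.
by rewrite -expr2 sqr_i opprK mul1r.
Qed.

Section Derivation.
Variable D : (pt -> C) -> pt -> C.
Hypothesis dD : derivation D.

Lemma der_sum (J : Type) (r : seq J) (F : J -> pt -> C) x : (forall j, CkC 1 (F j)) ->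
  D (fun x => \sum_(j <- r) F j x) x = \sum_(j <- r) D (F j) x.
Proof.
move=> hF; elim: r => [|j r IH].
  rewrite (_ : (fun _ => _) = fun=> 0) ?(der_cst dD) ?big_nil //.
  by apply/funext => y; rewrite big_nil.
rewrite (_ : (fun _ => _) = fun x => F j x + \sum_(j <- r) F j x); last first.
  by apply/funext => y; rewrite big_cons.
by rewrite (derD dD) // ?big_cons ?IH //; exact: CkC_sum.
Qed.

Lemma derZ (c : C) f x : CkC 1 f -> D (fun x => c * f x) x = c * D f x.
Proof. by move=> hf; rewrite (derM dD) ?(der_cst dD) ?mul0r ?add0r //; exact: CkC_cst. Qed.

Lemma der_prod m (F : 'I_m -> pt -> C) x : (forall j, CkC 1 (F j)) ->
  D (fun x => \prod_j F j x) x = \sum_i \prod_j (if j == i then D (F j) x else F j x).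
Proof.
elim: m F => [|m IH] F hF.
  rewrite big_ord0 (_ : (fun _ => _) = fun=> 1) ?(der_cst dD) //.
  by apply/funext => y; rewrite big_ord0.
rewrite (_ : (fun _ => _) = fun x => F ord0 x * \prod_j F (lift ord0 j) x); last first.
  by apply/funext => y; rewrite big_ord_recl.
rewrite (derM dD) //; last by apply: CkC_prod => j.
rewrite IH => [|j //]; rewrite big_ord_recl big_ord_recl eqxx; congr (_ * _ + _).
rewrite mulr_sumr; apply: eq_bigr => i _; rewrite big_ord_recl /=.
by congr (_ * _); apply: eq_bigr => j _; rewrite (inj_eq (@lift_inj _ ord0)).
Qed.

Variables (m : nat) (g : pt -> 'M[C]_m).
Hypothesis hg : forall i j, CkC 1 (fun x => g x i j).

Definition der_mx x : 'M[C]_m := \matrix_(i, j) D (fun y => g y i j) x.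

(** Jacobi's formula. *)
Lemma der_det x : D (fun y => \det (g y)) x = \tr (\adj (g x) *m der_mx x).
Proof.
rewrite der_sum => [|s]; last first.
  by apply: CkCM; [exact: CkC_cst|apply: CkC_prod => i; exact: hg].
transitivity (\sum_i \det (\matrix_(a, b) (if a == i then D (fun y => g y a b) x else g x a b))).
  rewrite exchange_big /=; apply: eq_bigr => s _.
  rewrite derZ; last by apply: CkC_prod => i; exact: hg.
  rewrite der_prod => [|i //]; rewrite mulr_sumr; apply: eq_bigr => i _.
  congr (_ * _); apply: eq_bigr => j _; by rewrite mxE.
rewrite mxtrace_mulC; apply: eq_bigr => i _.
rewrite (expand_det_row _ i) mxE; apply: eq_bigr => k _.
rewrite !mxE eqxx; congr (_ * _); rewrite /cofactor; congr (_ * \det _).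
by apply/matrixP => a b; rewrite !mxE eq_sym (negbTE (neq_lift _ _)).
Qed.

(** Differentiate [adj g *m g = det g]. *)
Lemma der_adj x : g x \in unitmx ->
  (\matrix_(k, j) D (fun y => (\adj (g y)) k j) x) =
  \det (g x) *: (\tr (invmx (g x) *m der_mx x) *: invmx (g x)
                 - invmx (g x) *m der_mx x *m invmx (g x)).
Proof.
move=> gu; set A := (\matrix_(k, j) _).
(* Leibniz rule on both sides, the right-hand one by Jacobi's formula. *)
have E : A *m g x + \adj (g x) *m der_mx x = (\tr (\adj (g x) *m der_mx x))%:M.
  apply/matrixP => k l; rewrite !mxE.
  have /(congr1 (fun F => D F x)) : (fun y => \sum_p (\adj (g y)) k p * g y p l) =
      (fun y => \det (g y) * (k == l)%:R).
    apply/funext => y; have /matrixP/(_ k l) := mul_adj_mx (g y).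
    by rewrite !mxE => ->; rewrite mulr_natr.
  rewrite (derM dD); [|exact: CkC_det|exact: CkC_cst].
  rewrite (der_cst dD) mulr0 addr0 der_det mulr_natr => <-.
  rewrite der_sum => [|p]; last by apply: CkCM => //; exact: CkC_adj.
  rewrite -big_split; apply: eq_bigr => p _.
  by rewrite /= (derM dD) ?mxE //; exact: CkC_adj.
have adjE : \adj (g x) = \det (g x) *: invmx (g x).
  by rewrite /invmx gu scalerA divff ?scale1r // -unitfE -unitmxE.
have -> : A = (A *m g x) *m invmx (g x) by rewrite mulmxK.
have -> : A *m g x = (\tr (\adj (g x) *m der_mx x))%:M - \adj (g x) *m der_mx x by rewrite -E addrK.
rewrite mulmxBl mul_scalar_mx adjE -!scalemxAl linearZ /= -scalerA -scalerBr.
by [].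
Qed.

End Derivation.

(** The cofactors have divergence zero: of the two terms of [der_adj], each
    becomes the other when closedness exchanges the index of differentiation
    with the index of the row. *)
Lemma piola (Ds : 'I_n -> (pt -> C) -> pt -> C) (g : pt -> 'M[C]_n) x k :
  (forall j, derivation (Ds j)) -> (forall i j, CkC 1 (fun x => g x i j)) ->
  g x \in unitmx ->
  (forall l j q, Ds l (fun y => g y j q) x = Ds j (fun y => g y l q) x) ->
  \sum_j Ds j (fun y => (\adj (g y)) k j) x = 0.
Proof.
move=> dD hg gu closed.
pose X j := der_mx (Ds j) g x; pose G := invmx (g x).
have E j : Ds j (fun y => (\adj (g y)) k j) x =
    \det (g x) * (\tr (G *m X j) * G k j - \sum_a G k a * \sum_b X j a b * G b j).
  have /matrixP/(_ k j) := der_adj (dD j) hg gu; rewrite [LHS]mxE => ->.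
  rewrite mxE; congr (_ * _); rewrite !mxE; congr (_ * _ - _).
  under eq_bigr => b _ do rewrite mxE mulr_suml.
  rewrite exchange_big /=; apply: eq_bigr => a _; rewrite mulr_sumr.
  by apply: eq_bigr => b _; rewrite mulrA.
rewrite (eq_bigr _ (fun j _ => E j)) -mulr_sumr sumrB.
rewrite (_ : \sum_j \tr (G *m X j) * G k j = \sum_j \sum_a G k a * \sum_b X j a b * G b j) ?subrr ?mulr0 //.
rewrite exchange_big /=; apply: eq_bigr => a _; rewrite -mulr_sumr mulrC; congr (_ * _).
rewrite mxtrace_mulC /mxtrace; apply: eq_bigr => j _; rewrite mxE; apply: eq_bigr => b _.
by congr (_ * _); rewrite !mxE closed.
Qed.

End ComplexCalculus.

(** * Curvature and closedness of a Kaehler metric *)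

Section Closedness.
Variables (R : realType) (n : nat).
Local Notation pt := 'rV[R]_(n + n).
Local Notation C := R[i].

Lemma del_coef (al : pt -> ext_form R n) x S :
  del al x S = \sum_j (if lshift n j \in S then
    (-1) ^+ #|[set s in S | (s < lshift n j)%N]|%SET *
      d_z j (fun y => al y (S :\ lshift n j)%SET) x else 0).
Proof.
rewrite /del sum_ffunE; apply: eq_bigr => j _; rewrite wedge_coframe.
by case: ifP => // _; rewrite ffunE.
Qed.

Lemma delbar_coef (al : pt -> ext_form R n) x S :
  delbar al x S = \sum_j (if rshift n j \in S then
    (-1) ^+ #|[set s in S | (s < rshift n j)%N]|%SET *
      d_zbar j (fun y => al y (S :\ rshift n j)%SET) x else 0).
Proof.
rewrite /delbar sum_ffunE; apply: eq_bigr => j _; rewrite wedge_coframe.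
by case: ifP => // _; rewrite ffunE.
Qed.

(** The coefficient of [dz_l /\ dz_j /\ dzbar_k], to which only [del]
    contributes. *)
Lemma closed_lt (g : pt -> 'M[C]_n) (l j k : 'I_n) x :
  (forall i j, CkC 1 (fun x => g x i j)) -> ext_d (kahler_form g) x = 0 -> (l < j)%N ->
  d_z l (fun y => g y j k) x = d_z j (fun y => g y l k) x.
Proof.
move=> hg closed lj; have ljE : (l == j) = false by apply: ltn_eqF.
pose S : {set 'I_(n + n)} := [set lshift n l; lshift n j; rshift n k]%SET.
have inl m : (lshift n m \in S) = (m == l) || (m == j).
  by rewrite !inE !eq_lshift eq_lrshift orbF.
have inr m : (rshift n m \in S) = (m == k).
  by rewrite !inE !eq_rlshift eq_rshift.
(* Removing an antiholomorphic index from [S] leaves none, while every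
   coefficient of a (1,1)-form has one. *)
have dbar0 : delbar (kahler_form g) x S = 0.
  rewrite delbar_coef; apply: big1 => m _; rewrite inr; case: eqP => // ->.
  rewrite (_ : (fun y => kahler_form g y (S :\ rshift n k)%SET) = fun=> 0); last first.
    apply/funext => y; rewrite /kahler_form form11E big1 // => a _; rewrite big1 // => b _.
    case: eqP => [E|_]; last by rewrite mulr0.
    have : rshift n b \in (S :\ rshift n k)%SET by rewrite E !inE eqxx orbT.
    by rewrite finset.in_setD1 inr eq_rshift andNb.
  by rewrite (der_cst (derivation_dzbar R k)) mulr0.
have : del (kahler_form g) x S = 0.
  have := congr1 (fun a : ext_form R n => a S) closed.
  by rewrite /ext_d ffunE dbar0 addr0 => ->; rewrite ffunE.
rewrite del_coef; under eq_bigr => m _ do rewrite inl.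
rewrite (bigD1 l) //= eqxx (bigD1 j) /=; last by rewrite eq_sym ljE.
rewrite eqxx orbT big1 ?addr0; last by move=> m /andP[/negbTE -> /negbTE ->].
have Sl : (S :\ lshift n l)%SET = [set lshift n j; rshift n k]%SET.
  apply/setP => s; rewrite !inE; case: (split_ordP s) => m ->.
    rewrite !eq_lshift !eq_lrshift !orbF; case: eqP => // ->; by rewrite /= ljE.
  by rewrite !eq_rlshift eq_rshift.
have Sj : (S :\ lshift n j)%SET = [set lshift n l; rshift n k]%SET.
  apply/setP => s; rewrite !inE; case: (split_ordP s) => m ->.
    rewrite !eq_lshift !eq_lrshift !orbF; case: eqP => [->|_] /=; first by rewrite eq_sym ljE.
    by rewrite orbF.
  by rewrite !eq_rlshift eq_rshift.
rewrite Sl Sj.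
have cl : #|[set s in S | (s < lshift n l)%N]|%SET = 0%N.
  apply/eqP; rewrite cards_eq0; apply/eqP/setP => s; rewrite !inE.
  apply/negbTE/negP => /andP[/orP[/orP[]|]] /eqP -> /=; first by rewrite ltnn.
    by rewrite ltnNge ltnW.
  by move=> h; have := ltn_ord l; lia.
have cj : #|[set s in S | (s < lshift n j)%N]|%SET = 1%N.
  apply/eqP/cards1P; exists (lshift n l); apply/setP => s; rewrite !inE.
  apply/andP/eqP => [[/orP[/orP[]|] /eqP -> //=]|-> /=].
  - by rewrite ltnn.
  - by move=> h; have := ltn_ord j; lia.
  - by rewrite eqxx.
rewrite cl cj expr0 expr1 mul1r mulN1r.
under [X in d_z l X]funext => y do rewrite /kahler_form form11_lr.
under [X in d_z j X]funext => y do rewrite /kahler_form form11_lr.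
rewrite (derZ (derivation_dz R l)) // (derZ (derivation_dz R j)) // -mulrBr => /eqP.
by rewrite mulf_eq0 (negbTE (i_neq0 R)) /= subr_eq0 => /eqP.
Qed.

Lemma closed_dz (g : pt -> 'M[C]_n) (l j k : 'I_n) x :
  (forall i j, CkC 1 (fun x => g x i j)) -> ext_d (kahler_form g) x = 0 ->
  d_z l (fun y => g y j k) x = d_z j (fun y => g y l k) x.
Proof.
move=> hg closed; case: (ltngtP l j) => lj; first exact: closed_lt.
  exact/esym/closed_lt.
by have -> : l = j by exact: val_inj.
Qed.

Lemma wedge_coframe_form1 k : wedgef (coframe R k) (form1 R n) = coframe R k.
Proof.
apply/ffunP => S; rewrite wedge_coframe !ffunE; case: ifPn => kS; last first.
  by case: eqP => // E; move: kS; rewrite E finset.set11.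
case: (altP (S =P [set k]%SET)) => [->|Sk].
  rewrite (_ : [set _ in _ | _]%SET = finset.set0) ?cards0 ?mul1r; last first.
    by apply/setP => s; rewrite !inE; case: eqP => // ->; rewrite ltnn.
  by rewrite (_ : _ == _ = true) //; apply/eqP/setP => s; rewrite !inE andNb.
case: eqP => [E|_]; last by rewrite mulr0.
by move: Sk; rewrite -(finset.setD1K kS) E finset.setU0 eqxx.
Qed.

Lemma ricci_formE (g : pt -> 'M[C]_n) x : Ck 2 (log_det g) ->
  ricci_form g x = form11 (\matrix_(j, k)
    - d_z j (fun y => d_zbar k (fun z => (log_det g z)%:C) y) x).
Proof.
move=> hF; pose F z := (log_det g z)%:C; have FC : CkC 2 F by apply: CkC_real.
have Fb k : CkC 1 (d_zbar k F) by apply: CkC_dzbar.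
have E1 y : delbar (fun y => F y *: form1 R n) y = \sum_k d_zbar k F y *: coframe R (rshift n k).
  apply: eq_bigr => k _; rewrite -wedge_coframe_form1 -wedgefZr; congr (wedgef _ _).
  apply/ffunP => S; rewrite !ffunE.
  under [X in d_zbar k X]funext => z do rewrite !ffunE /GRing.scale /= mulrC.
  by rewrite (derZ (derivation_dzbar R k)); [rewrite /GRing.scale /= mulrC|exact: CkCS].
rewrite /ricci_form (_ : delbar _ = fun y => \sum_k d_zbar k F y *: coframe R (rshift n k)); last first.
  by apply/funext => y; rewrite E1.
have E2 : del (fun y => \sum_k d_zbar k F y *: coframe R (rshift n k)) x =
    \sum_j \sum_k d_z j (d_zbar k F) x *: wedgef (dz R j) (dzbar R k).
  apply: eq_bigr => j _; under [RHS]eq_bigr do rewrite -wedgefZr.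
  rewrite -wedgef_sumr; congr (wedgef _ _); apply/ffunP => S; rewrite ffunE sum_ffunE.
  under [X in d_z j X]funext => z do rewrite sum_ffunE.
  rewrite (der_sum (derivation_dz R j)) => [|k]; last first.
    apply: (@eq_CkC _ _ _ (fun y => coframe R (rshift n k) S * d_zbar k F y)).
      by move=> y; rewrite [RHS]ffunE /GRing.scale /= mulrC.
    by apply: CkCM => //; exact: CkC_cst.
  apply: eq_bigr => k _; rewrite [RHS]ffunE /GRing.scale /= [RHS]mulrC -(derZ (derivation_dz R j)) //.
  by congr (d_z j _ x); apply/funext => y; rewrite ffunE /GRing.scale /= mulrC.
rewrite E2 /form11 scaler_sumr; apply: eq_bigr => j _.
rewrite scaler_sumr; apply: eq_bigr => k _; rewrite scalerA mxE.
by congr (_ *: _); ring.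
Qed.

End Closedness.

Section KahlerMetric.
Variables (R : realType) (n : nat) (B : 'M[R]_(n + n)) (g : 'rV[R]_(n + n) -> 'M[R[i]]_n).
Hypotheses (n0 : (0 < n)%N) (Bu : B \in unitmx) (gK : kahler B g).
Local Notation pt := 'rV[R]_(n + n).
Local Notation C := R[i].
Local Notation M := (torus_mean B).

Lemma kahler_posdef x : posdef (g x).
Proof. by split; [exact: kahler_herm gK x|exact: kahler_pos gK x]. Qed.

Lemma kahler_CkC k i j : CkC k (fun x => g x i j).
Proof. by have [h1 h2] := kahler_smooth gK i j; split. Qed.

Definition vol_density x : R := detR (g x).

Lemma vol_density_gt0 x : 0 < vol_density x.
Proof. exact/posdef_det_gt0/kahler_posdef. Qed.

Lemma vol_density_Ck k : Ck k vol_density.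
Proof. by have [] := CkC_det (kahler_CkC k). Qed.

Lemma vol_density_periodic : lattice_periodic B vol_density.
Proof. by move=> x v lv; rewrite /vol_density (kahler_periodic gK). Qed.

Lemma kahler_det x : \det (g x) = (vol_density x)%:C.
Proof. exact/posdef_det/kahler_posdef. Qed.

Lemma kahler_closed_dz l j k x : d_z l (fun y => g y j k) x = d_z j (fun y => g y l k) x.
Proof. by apply: closed_dz; [move=> *; exact: kahler_CkC|exact: kahler_closed gK x]. Qed.

Lemma kahler_conj j k : (fun y => conjc (g y j k)) = fun y => g y k j.
Proof. by apply/funext => y; rewrite -(kahler_herm gK). Qed.

Lemma kahler_closed_dzbar l j k x :
  d_zbar l (fun y => g y j k) x = d_zbar k (fun y => g y j l) x.
Proof.
rewrite -(kahler_conj k j) -(kahler_conj l j) -!conj_dz; [|exact: kahler_CkC|exact: kahler_CkC].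
by rewrite kahler_closed_dz.
Qed.

Lemma adj_conj k j : (fun y => conjc ((\adj (g y)) j k)) = fun y => (\adj (g y)) k j.
Proof.
apply/funext => y; rewrite !mxE /cofactor conjcM -det_map_mx -[in LHS]det_tr.
rewrite rmorphXn rmorphN rmorph1 /= addnC; congr (_ * \det _).
by apply/matrixP => a b; rewrite !mxE -(kahler_herm gK).
Qed.

Lemma adj_CkC m k j : CkC m (fun y => (\adj (g y)) k j).
Proof. by apply: CkC_adj => a b; exact: kahler_CkC. Qed.

Lemma piola_dz k x : \sum_j d_z j (fun y => (\adj (g y)) k j) x = 0.
Proof.
apply: piola.
- by move=> j; exact: derivation_dz.
- by move=> *; exact: kahler_CkC.
- exact/posdef_unit/kahler_posdef.
- by move=> *; exact: kahler_closed_dz.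
Qed.

Lemma piola_dzbar j x : \sum_k d_zbar k (fun y => (\adj (g y)) k j) x = 0.
Proof.
transitivity (conjc (\sum_k d_z k (fun y => (\adj (g y)) j k) x)); last by rewrite piola_dz conjc0.
rewrite rmorph_sum; apply: eq_bigr => k _.
transitivity (conjc (d_z k (fun y => (\adj (g y)) j k) x)); last by [].
by rewrite conj_dz ?adj_conj //; exact: adj_CkC.
Qed.

Lemma scalar_curvatureE x :
  scalar_curvature g x = - complex.Re (\tr (invmx (g x) *m
    \matrix_(j, k) d_z j (fun y => d_zbar k (fun z => (log_det g z)%:C) y) x)).
Proof.
rewrite /scalar_curvature ricci_formE; last first.
  apply: Ck_ln; first by move=> y; exact: vol_density_gt0.
  exact: vol_density_Ck.
rewrite trace_form11 //; last exact/posdef_unit/kahler_posdef.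
rewrite -Re_opp -raddfN -mulmxN; congr (complex.Re (\tr (_ *m _))).
by apply/matrixP => j k; rewrite !mxE.
Qed.

(** Stokes' theorem for (1, 0)- and (0, 1)-vector fields. *)
Lemma mean_Re_dz j (f : pt -> C) : CkC 1 f -> lattice_periodic B f ->
  M (fun x => complex.Re (d_z j f x)) = 0.
Proof.
case=> f1 f2 pf.
have p1 : lattice_periodic B (fun x => complex.Re (f x)) by move=> x v lv; rewrite pf.
have p2 : lattice_periodic B (fun x => complex.Im (f x)) by move=> x v lv; rewrite pf.
have mM := mean_torus B.
have c1 := Ck_cont (Ck_partial (lshift n j) f1); have c2 := Ck_cont (Ck_partial (rshift n j) f2).
transitivity (M (fun x => 2^-1 * (partial (lshift n j) (fun x => complex.Re (f x)) x +
    partial (rshift n j) (fun x => complex.Im (f x)) x))).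
  congr (M _); apply/funext => x; rewrite /d_z /partialC.
  have -> : (2 : C)^-1 = (2^-1 : R)%:C by rewrite fmorphV rmorph_nat.
  rewrite mulrC Re_realM; congr (_ * _).
  by rewrite Re_add Re_opp Re_mul /=; ring.
rewrite (meanZ mM) ?(meanD mM) //; last exact: contD.
by rewrite !(torus_mean_partial Bu) // addr0 mulr0.
Qed.

Lemma mean_Re_dzbar j (f : pt -> C) : CkC 1 f -> lattice_periodic B f ->
  M (fun x => complex.Re (d_zbar j f x)) = 0.
Proof.
move=> hf pf; rewrite -(mean_Re_dz j (CkC_conj hf)); last by move=> x v lv; rewrite pf.
by congr (M _); apply/funext => x; rewrite -Re_conjc conj_dzbar.
Qed.

End KahlerMetric.

(** * The average of a Kaehler metric *)

Section OneMetric.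
Variables (R : realType) (n : nat) (B : 'M[R]_(n + n)) (g : 'rV[R]_(n + n) -> 'M[R[i]]_n).
Hypotheses (n0 : (0 < n)%N) (Bu : B \in unitmx) (gK : kahler B g).
Local Notation pt := 'rV[R]_(n + n).
Local Notation C := R[i].
Local Notation M := (torus_mean B).
Local Notation u := (vol_density g).
Let mM := mean_torus B.

Lemma u_gt0 x : 0 < u x. Proof. exact: (vol_density_gt0 gK). Qed.
Lemma u_Ck k : Ck k u. Proof. exact: (vol_density_Ck gK). Qed.
Lemma u_cont : continuous u. Proof. exact: (Ck_cont (u_Ck 0)). Qed.

Lemma d_z_shift j (f : pt -> C) y x : d_z j (fun x => f (x + y)) x = d_z j f (x + y).
Proof. by rewrite /d_z /partialC !(partial_shift (fun z => complex.Re (f z))) !(partial_shift (fun z => complex.Im (f z))). Qed.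

Lemma d_zbar_shift j (f : pt -> C) y x : d_zbar j (fun x => f (x + y)) x = d_zbar j f (x + y).
Proof. by rewrite /d_zbar /partialC !(partial_shift (fun z => complex.Re (f z))) !(partial_shift (fun z => complex.Im (f z))). Qed.

Lemma CkC_shift k (f : pt -> C) y : CkC k f -> CkC k (fun x => f (x + y)).
Proof. by case=> h1 h2; split; [exact: (Ck_shift y h1)|exact: (Ck_shift y h2)]. Qed.

Lemma contC_mul (F G : pt -> C) : contC F -> contC G -> contC (fun x => F x * G x).
Proof.
move=> [F1 F2] [G1 G2]; split.
  by rewrite (funext (fun x => Re_mul (F x) (G x))); apply: contB; exact: contM.
by rewrite (funext (fun x => Im_mul (F x) (G x))); apply: contD; exact: contM.
Qed.

Lemma contC_shift y (F : pt -> C) : contC F -> contC (fun x => F (x + y)).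
Proof.
by move=> [F1 F2]; split; [exact: (@cont_shift R n _ y F1)|exact: (@cont_shift R n _ y F2)].
Qed.

Lemma contC_sum (J : Type) (r : seq J) (F : J -> pt -> C) :
  (forall j, contC (F j)) -> contC (fun x => \sum_(j <- r) F j x).
Proof.
move=> hF; split.
  rewrite (funext (fun x => Re_sum r xpredT (fun j => F j x))).
  by apply: cont_sum => j _; case: (hF j).
rewrite (funext (fun x => Im_sum r xpredT (fun j => F j x))).
by apply: cont_sum => j _; case: (hF j).
Qed.

Lemma mean_Re_sum (J : Type) (r : seq J) (F : J -> pt -> C) : (forall j, contC (F j)) ->
  M (fun x => complex.Re (\sum_(j <- r) F j x)) = \sum_(j <- r) M (fun x => complex.Re (F j x)).
Proof.
move=> hF; rewrite -(mean_sum mM) => [|j _]; last by case: (hF j).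
by congr (M _); apply/funext => x; rewrite Re_sum.
Qed.

(** Since [d_z l g_(jk) = d_z j g_(lk)], the pairing is a divergence. *)
Lemma pairing_dz l (c : C) y :
  M (fun x => complex.Re (c * \sum_j \sum_k (\adj (g x)) k j * d_z l (fun z => g z j k) (x + y))) = 0.
Proof.
pose V k j x := c * ((\adj (g x)) k j * g (x + y) l k).
have hV k j : CkC 1 (V k j).
  apply: CkCM; first exact: CkC_cst.
  by apply: CkCM; [exact: (adj_CkC gK)|apply: (@CkC_shift 1 (fun x => g x l k)); exact: (kahler_CkC gK)].
have hd k j : contC (d_z j (V k j)) by apply: (@CkC_contC _ _ 0); exact: CkC_dz.
rewrite (_ : (fun _ => _) = fun x => complex.Re (\sum_k \sum_j d_z j (V k j) x)).
  rewrite mean_Re_sum => [|k]; last by apply: contC_sum.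
  apply: big1 => k _; rewrite mean_Re_sum //; apply: big1 => j _.
  apply: (mean_Re_dz Bu) => // x v lv.
  rewrite /V (kahler_periodic gK x lv) (_ : x + v + y = x + y + v) ?(kahler_periodic gK (x + y) lv) //.
  exact: addrAC.
apply/funext => x; congr (complex.Re _); rewrite exchange_big mulr_sumr; apply: eq_bigr => k _.
have hs : CkC 1 (fun x => g (x + y) l k).
  by apply: (@CkC_shift 1 (fun x => g x l k)); exact: (kahler_CkC gK).
transitivity (\sum_j (c * (d_z j (fun x => (\adj (g x)) k j) x * g (x + y) l k)
   + c * ((\adj (g x)) k j * d_z j (fun x => g (x + y) l k) x))).
  rewrite big_split /= -mulr_sumr -mulr_suml (piola_dz gK) mul0r mulr0 add0r mulr_sumr.
  apply: eq_bigr => j _; rewrite (d_z_shift j (fun x => g x l k)).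
  by rewrite (kahler_closed_dz gK l j k).
apply: eq_bigr => j _; have dD := derivation_dz R (n := n) j.
rewrite /V (derZ dD); last by apply: CkCM => //; exact: (adj_CkC gK).
by rewrite (derM dD) //; [rewrite mulrDr|exact: (adj_CkC gK)].
Qed.

Lemma pairing_dzbar l (c : C) y :
  M (fun x => complex.Re (c * \sum_j \sum_k (\adj (g x)) k j * d_zbar l (fun z => g z j k) (x + y))) = 0.
Proof.
pose V j k x := c * ((\adj (g x)) k j * g (x + y) j l).
have hV k j : CkC 1 (V k j).
  apply: CkCM; first exact: CkC_cst.
  by apply: CkCM; [exact: (adj_CkC gK)|apply: (@CkC_shift 1 (fun x => g x k l)); exact: (kahler_CkC gK)].
have hd j k : contC (d_zbar k (V j k)) by apply: (@CkC_contC _ _ 0); exact: CkC_dzbar.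
rewrite (_ : (fun _ => _) = fun x => complex.Re (\sum_j \sum_k d_zbar k (V j k) x)).
  rewrite mean_Re_sum => [|k]; last by apply: contC_sum.
  apply: big1 => j _; rewrite mean_Re_sum //; apply: big1 => k _.
  apply: (mean_Re_dzbar Bu) => // x v lv.
  rewrite /V (kahler_periodic gK x lv) (_ : x + v + y = x + y + v) ?(kahler_periodic gK (x + y) lv) //.
  exact: addrAC.
apply/funext => x; congr (complex.Re _); rewrite mulr_sumr; apply: eq_bigr => j _.
have hs : CkC 1 (fun x => g (x + y) j l).
  by apply: (@CkC_shift 1 (fun x => g x j l)); exact: (kahler_CkC gK).
transitivity (\sum_k (c * (d_zbar k (fun x => (\adj (g x)) k j) x * g (x + y) j l)
   + c * ((\adj (g x)) k j * d_zbar k (fun x => g (x + y) j l) x))).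
  rewrite big_split /= -mulr_sumr -mulr_suml (piola_dzbar gK) mul0r mulr0 add0r mulr_sumr.
  apply: eq_bigr => k _; rewrite (d_zbar_shift k (fun x => g x j l)).
  by rewrite (kahler_closed_dzbar gK l j k).
apply: eq_bigr => k _; have dD := derivation_dzbar R (n := n) k.
rewrite /V (derZ dD); last by apply: CkCM => //; exact: (adj_CkC gK).
by rewrite (derM dD) //; [rewrite mulrDr|exact: (adj_CkC gK)].
Qed.

(** The constant form in the cohomology class of the metric. *)
Definition mean_mx : 'M[C]_n := \matrix_(j, k)
  (M (fun x => complex.Re (g x j k)) +i* M (fun x => complex.Im (g x j k))).

Lemma g_cont j k : contC (fun x => g x j k).
Proof. exact: (CkC_contC (kahler_CkC gK 0 j k)). Qed.

(** In cohomological terms, [n [w]^n = n [w]^(n-1) [A] ] for the constant form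
    [A] in the class of [w].  The cofactors of the metric pair to zero with all
    first derivatives of its translates, so that the metric can be replaced by
    its mean in the pairing with its cofactors. *)
Lemma cohomology_pairing :
  n%:R * M u = M (fun x => complex.Re (\tr (\adj (g x) *m mean_mx))).
Proof.
pose J := ('I_n * 'I_n * bool)%type.
pose phi (i : J) x := if i.2 then complex.Re ((\adj (g x)) i.1.2 i.1.1)
  else - complex.Im ((\adj (g x)) i.1.2 i.1.1).
pose f (i : J) x := if i.2 then complex.Re (g x i.1.1 i.1.2) else complex.Im (g x i.1.1 i.1.2).
have split_sum (F : J -> R) : \sum_i F i = \sum_j \sum_k (F (j, k, true) + F (j, k, false)).
  rewrite (eq_bigr (fun i : J => F (i.1, i.2))) => [|[] //].
  rewrite -(pair_bigA _ (fun jk b => F (jk, b))) /=.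
  rewrite (eq_bigr (fun p : 'I_n * 'I_n => \sum_b F ((p.1, p.2), b))) => [|[] //].
  rewrite -(pair_bigA _ (fun j k => \sum_b F (j, k, b))) /=.
  by apply: eq_bigr => j _; apply: eq_bigr => k _; rewrite big_bool.
have trE x (h : 'M[C]_n) := Re_trace_mul (\adj (g x)) h.
transitivity (M (fun x => \sum_i phi i x * f i x)).
  rewrite -(meanZ mM); last exact: u_cont.
  congr (M _); apply/funext => x; rewrite split_sum.
  transitivity (complex.Re (\tr (\adj (g x) *m g x))).
    rewrite mul_adj_mx mxtrace_scalar (kahler_det gK) -rmorphMn /=.
    by rewrite mulr_natl.
  rewrite trE; apply: eq_bigr => j _; apply: eq_bigr => k _.
  by rewrite /phi /f /= mulNr.
transitivity (M (fun x => \sum_i phi i x * M (f i))); last first.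
  congr (M _); apply/funext => x; rewrite split_sum trE.
  apply: eq_bigr => j _; apply: eq_bigr => k _; by rewrite /phi /f /mean_mx !mxE /= mulNr.
have hadj k j := adj_CkC gK 1 k j.
have padj k j : lattice_periodic B (fun x => (\adj (g x)) k j).
  by move=> x v lv; rewrite (kahler_periodic gK).
have hgC j k := kahler_CkC gK 1 j k.
apply: (pairing_mean Bu).
- move=> [[j k] []]; rewrite /phi /=; have [h1 h2] := hadj k j; first exact: (Ck_cont h1).
  by apply: contN; exact: (Ck_cont h2).
- by move=> [[j k] []] x v lv; rewrite /phi /= padj.
- by move=> [[j k] []]; rewrite /f /=; have [h1 h2] := hgC j k.
- by move=> [[j k] []] x v lv; rewrite /f /= (kahler_periodic gK).
move=> a y.
transitivity (M (fun x => complex.Re (\sum_j \sum_k (\adj (g x)) k j *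
    partialC a (fun z => g z j k) (x + y)))).
  congr (M _); apply/funext => x; rewrite split_sum Re_sum; apply: eq_bigr => j _.
  rewrite Re_sum; apply: eq_bigr => k _; rewrite Re_mul /phi /f /= mulNr.
  by [].
have cdz l j k : contC (d_z l (fun z => g z j k)).
  by apply: (@CkC_contC _ _ 0); apply: CkC_dz; exact: hgC.
have cdzb l j k : contC (d_zbar l (fun z => g z j k)).
  by apply: (@CkC_contC _ _ 0); apply: CkC_dzbar; exact: hgC.
have S1 (c : C) l : contC (fun x => c * \sum_j \sum_k (\adj (g x)) k j * d_z l (fun z => g z j k) (x + y)).
  apply: contC_mul; first by split; exact: cont_cst.
  apply: contC_sum => j; apply: contC_sum => k; apply: contC_mul; first exact: (CkC_contC (hadj k j)).
  exact: (@contC_shift y _ (cdz l j k)).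
have S2 (c : C) l : contC (fun x => c * \sum_j \sum_k (\adj (g x)) k j * d_zbar l (fun z => g z j k) (x + y)).
  apply: contC_mul; first by split; exact: cont_cst.
  apply: contC_sum => j; apply: contC_sum => k; apply: contC_mul; first exact: (CkC_contC (hadj k j)).
  exact: (@contC_shift y _ (cdzb l j k)).
suff [l [c1 [c2 E]]] : exists l (c1 c2 : C), forall (F : pt -> C) x, partialC a F x = c1 * d_z l F x + c2 * d_zbar l F x.
  transitivity (M (fun x =>
      complex.Re (c1 * \sum_j \sum_k (\adj (g x)) k j * d_z l (fun z => g z j k) (x + y)) +
      complex.Re (c2 * \sum_j \sum_k (\adj (g x)) k j * d_zbar l (fun z => g z j k) (x + y)))).
    congr (M _); apply/funext => x; rewrite -Re_add; congr (complex.Re _).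
    rewrite !mulr_sumr -big_split; apply: eq_bigr => j _ /=.
    rewrite !mulr_sumr -big_split; apply: eq_bigr => k _ /=.
    by rewrite E; ring.
  rewrite (meanD mM); [|by case: (S1 c1 l)|by case: (S2 c2 l)].
  by rewrite pairing_dz pairing_dzbar addr0.
case: (split_ordP a) => l ->; exists l.
  by exists 1, 1 => F x; rewrite partialC_l !mul1r.
by exists 'i, (- 'i) => F x; rewrite partialC_r mulrBr mulNr.
Qed.

Lemma mean_linear (P : 'M[C]_n) :
  complex.Re (\tr (P *m mean_mx)) = M (fun x => complex.Re (\tr (P *m g x))).
Proof.
rewrite Re_trace_mul (funext (fun x => Re_trace_mul P (g x))).
have cc j k : continuous (fun x => complex.Re (P k j) * complex.Re (g x j k)).
  by apply: contM; [exact: cont_cst|case: (g_cont j k)].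
have cc' j k : continuous (fun x => complex.Im (P k j) * complex.Im (g x j k)).
  by apply: contM; [exact: cont_cst|case: (g_cont j k)].
rewrite (mean_sum mM) => [|j _]; last by apply: cont_sum => k _; exact: contB.
apply: eq_bigr => j _; rewrite (mean_sum mM) => [|k _]; last exact: contB.
apply: eq_bigr => k _; rewrite (meanB mM) // !(meanZ mM); [|by case: (g_cont j k)|by case: (g_cont j k)].
by rewrite mxE.
Qed.

Lemma mean_selfadjoint : selfadjoint mean_mx.
Proof.
move=> j k; rewrite !mxE; apply: eq_ReIm => /=.
  by congr (M _); apply/funext => x; rewrite (kahler_herm gK x j k) Re_conjc.
rewrite -(meanN mM); last by case: (g_cont j k).
by congr (M _); apply/funext => x; rewrite (kahler_herm gK x j k) Im_conjc.
Qed.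

Lemma form_as_trace (h : 'M[C]_n) (v : 'rV[C]_n) : (v *m h *m ctr v) 0 0 = \tr (ctr v *m v *m h).
Proof.
by rewrite -[ctr v *m v *m h]mulmxA [in RHS]mxtrace_mulC /mxtrace big_ord1.
Qed.

Lemma mean_form (v : 'rV[C]_n) :
  complex.Re ((v *m mean_mx *m ctr v) 0 0) = M (fun x => complex.Re ((v *m g x *m ctr v) 0 0)).
Proof.
rewrite form_as_trace mean_linear; congr (M _); apply/funext => x.
by rewrite form_as_trace.
Qed.

Lemma form_cont (P : 'M[C]_n) : continuous (fun x => complex.Re (\tr (P *m g x))).
Proof.
rewrite (funext (fun x => Re_trace_mul P (g x))).
apply: cont_sum => j _; apply: cont_sum => k _; have [h1 h2] := g_cont j k.
by apply: contB; apply: contZ.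
Qed.

(** An average of positive forms. *)
Lemma mean_posdef : posdef mean_mx.
Proof.
split; first exact: mean_selfadjoint.
move=> v v0; rewrite ltcE; apply/andP; split.
  have : conjc ((v *m mean_mx *m ctr v) 0 0) = (v *m mean_mx *m ctr v) 0 0.
    have := selfadjointP mean_mx; case=> /(_ mean_selfadjoint) hA _.
    have E : ctr (v *m mean_mx *m ctr v) = v *m mean_mx *m ctr v.
      by rewrite !ctrM ctrK hA mulmxA.
    by rewrite -[in RHS]E !mxE.
  move/(congr1 (@complex.Im R)); rewrite Im_conjc /= => h.
  by apply/eqP; move: h; lra.
rewrite mean_form; apply: (torus_mean_gt0 Bu).
- rewrite (_ : (fun _ => _) = fun x => complex.Re (\tr (ctr v *m v *m g x))); first exact: form_cont.
  by apply/funext => x; rewrite form_as_trace.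
- by move=> x w lw; rewrite (kahler_periodic gK).
- by move=> x; have := kahler_pos gK x v0; rewrite ltcE => /andP[].
Qed.

Lemma trace_mean : trR mean_mx = M (fun x => trR (g x)).
Proof.
have := mean_linear 1%:M; rewrite mul1mx /trR => ->.
by congr (M _); apply/funext => x; rewrite mul1mx.
Qed.

Lemma trace_cont : continuous (fun x => trR (g x)).
Proof.
rewrite (_ : (fun x => trR (g x)) = fun x => complex.Re (\tr (1%:M *m g x))).
  exact: form_cont.
by apply/funext => x; rewrite mul1mx.
Qed.

End OneMetric.

(** * The energy estimate *)

Section RealPowers.
Variable R : realType.

Lemma cont_powR (T : topologicalType) (f : T -> R) (r : R) : continuous f -> (forall x, 0 < f x) ->
  continuous (fun x => f x `^ r).
Proof.
move=> cf f0; rewrite (_ : (fun _ => _) = fun x => expR (r * ln (f x))); last first.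
  by apply/funext => x; rewrite /powR gt_eqF.
have cl : continuous (fun x => r * ln (f x)).
  apply: contM; first exact: cont_cst.
  by move=> x; apply: (@continuous_comp _ _ _ f (@ln R)); [exact: cf|exact: continuous_ln].
by move=> x; apply: (@continuous_comp _ _ _ (fun x => r * ln (f x)) (@expR R)); [exact: cl|exact: continuous_expR].
Qed.

Lemma powR_lt_of_lt (t e s : R) : 0 <= t -> 0 < s -> 0 < e -> t < e `^ s^-1 -> t `^ s < e.
Proof.
move=> t0 s0 e0 h; have : t `^ s < (e `^ s^-1) `^ s by apply: gt0_ltr_powR; rewrite ?nnegrE ?powR_ge0.
by rewrite -powRrM mulVf ?gt_eqF // powRr1 // ltW.
Qed.

Lemma cont_norm_powR (T : topologicalType) (f : T -> R) (s : R) : continuous f -> 0 < s ->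
  continuous (fun x => `|f x| `^ s).
Proof.
move=> cf s0.
suff cp : continuous (fun t : R => `|t| `^ s).
  by move=> x; apply: (@continuous_comp _ _ _ f (fun t : R => `|t| `^ s)); [exact: cf|exact: cp].
move=> t; have [->|t0] := eqVneq t 0.
  apply/cvgrPdist_lt => e e0; rewrite normr0 powR0 ?gt_eqF //.
  have d0 : 0 < e `^ s^-1 by rewrite powR_gt0.
  apply/nbhs_ballP; exists (e `^ s^-1) => //= x; rewrite /ball /= sub0r normrN => xe.
  by rewrite sub0r normrN ger0_norm ?powR_ge0 //; exact: powR_lt_of_lt.
have n0 : 0 < `|t| by rewrite normr_gt0.
have ln_c : {for t, continuous (fun t : R => expR (s * ln `|t|))}.
  apply: (@continuous_comp _ _ _ (fun t : R => s * ln `|t|) (@expR R)); last exact: continuous_expR.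
  apply: cvgM; first exact: cvg_cst.
  apply: (@continuous_comp _ _ _ (fun t : R => `|t|) (@ln R)); first exact: norm_continuous.
  exact: continuous_ln.
rewrite /continuous_at [X in _ --> X](_ : _ = expR (s * ln `|t|)); last by rewrite /powR gt_eqF.
apply: cvg_trans ln_c; apply: near_eq_cvg; near=> x.
rewrite /powR gt_eqF // normr_gt0; near: x.
have : \forall x \near t, `|t - x| < `|t| by apply/nbhs_ballP; exists `|t|.
apply: filterS => x tx; apply/eqP => x0; move: tx; by rewrite x0 subr0 ltxx.
Unshelve. all: by end_near. Qed.

(** [x^a] lies between [1] and [x]. *)
Lemma powR_near1 (x a : R) : 0 < x -> 0 <= a <= 1 -> `|x `^ a - 1| <= `|x - 1|.
Proof.
move=> x0 /andP[a0 a1]; case: (leP 1 x) => x1.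
  have h1 : 1 <= x `^ a by rewrite -[1](powRr0 x) ler_powR.
  have h2 : x `^ a <= x by rewrite -[leRHS](powRr1 (ltW x0)) ler_powR.
  by rewrite !ger0_norm ?subr_ge0 // lerD2r.
have h1 : x `^ a <= 1.
  have E : 1 `^ a = 1 :> R by rewrite powR1.
  by rewrite -E ge0_ler_powR ?nnegrE // ltW.
have h2 : x <= x `^ a.
  rewrite -[leLHS](powRr1 (ltW x0)) /powR gt_eqF // ler_expR.
  have : ln x <= 0 by apply: ln_le0; exact: ltW.
  by nra.
by rewrite !ler0_norm ?subr_le0 ?(ltW x1) // lerN2 lerD2r.
Qed.

(** The exponential has derivative at most [K] where it is at most [K]. *)
Lemma exp_lipschitz (w m K : R) : expR w <= K -> expR m <= K -> `|expR w - expR m| <= K * `|w - m|.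
Proof.
have key (a b : R) : expR a <= K -> expR a - expR b <= K * `|a - b|.
  move=> aK; have h := expR_ge1Dx (b - a).
  have E : expR b = expR a * expR (b - a) by rewrite -expRD addrC subrK.
  have a0 := expR_gt0 a; have n := ler_norm (a - b); have n0 := normr_ge0 (a - b).
  apply: (@le_trans _ _ (expR a * (a - b))); first by rewrite E; nra.
  apply: (@le_trans _ _ (expR a * `|a - b|)); first by rewrite ler_pM2l.
  by rewrite ler_wpM2r.
move=> wK mK; rewrite ler_norml; apply/andP; split; last exact: key.
by rewrite lerNl opprB distrC; exact: key.
Qed.

(** Young's inequality, for an energy density [q] that dominates the Euclidean
    one up to the trace [t] of the metric. *)
Lemma gradient_young (lam p q v t N : R) : 0 < lam -> 0 < v -> 0 < t ->
  p ^+ 2 <= 4 * N -> N <= t * q -> `|p / v| <= lam * (q / v ^+ 2) + lam^-1 * t.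
Proof.
move=> lam0 v0 t0 h1 h2.
have N0 : 0 <= N by have := sqr_ge0 p; lra.
have q0 : 0 <= q by rewrite -(pmulr_rge0 _ t0); exact: le_trans h2.
have r0 : 0 <= lam * (q / v ^+ 2) + lam^-1 * t.
  by rewrite addr_ge0 // mulr_ge0 ?divr_ge0 ?sqr_ge0 ?invr_ge0 // ltW.
rewrite -(@ler_pXn2r _ 2) ?nnegrE // real_normK ?num_real // exprMn.
have v2 : 0 < v ^- 2 by rewrite invr_gt0 exprn_gt0.
apply: (@le_trans _ _ (4 * (lam * (q / v ^+ 2)) * (lam^-1 * t))).
  have -> : 4 * (lam * (q / v ^+ 2)) * (lam^-1 * t) = (4 * (t * q)) * v ^- 2.
    by field; rewrite !gt_eqF.
  by rewrite exprVn ler_pM2r //; lra.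
rewrite -subr_ge0.
have -> : (lam * (q / v ^+ 2) + lam^-1 * t) ^+ 2 - 4 * (lam * (q / v ^+ 2)) * (lam^-1 * t) =
   (lam * (q / v ^+ 2) - lam^-1 * t) ^+ 2 by ring.
exact: sqr_ge0.
Qed.

End RealPowers.

Section Gradient.
Variables (R : realType) (n : nat) (B : 'M[R]_(n + n)) (g : 'rV[R]_(n + n) -> 'M[R[i]]_n).
Hypotheses (n0 : (0 < n)%N) (Bu : B \in unitmx) (gK : kahler B g).
Local Notation pt := 'rV[R]_(n + n).
Local Notation C := R[i].
Local Notation M := (torus_mean B).
Local Notation u := (vol_density g).
Let mM := mean_torus B.

Lemma d_zbar_chain (f h : pt -> R) (c : R) k x :
  (forall a, partial a h x = partial a f x * c) ->
  d_zbar k (fun y => (h y)%:C) x = d_zbar k (fun y => (f y)%:C) x * c%:C.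
Proof.
by move=> E; rewrite /d_zbar !partialC_real !E !rmorphM mulrA -mulrDl mulrAC.
Qed.

Lemma d_z_chain (f h : pt -> R) (c : R) k x :
  (forall a, partial a h x = partial a f x * c) ->
  d_z k (fun y => (h y)%:C) x = d_z k (fun y => (f y)%:C) x * c%:C.
Proof.
by move=> E; rewrite /d_z !partialC_real !E !rmorphM mulrA -mulrBl mulrAC.
Qed.

Definition grad_row x : 'rV[C]_n := \row_k d_zbar k (fun y => (u y)%:C) x.

Lemma partial_le_grad a x : partial a u x ^+ 2 <= 4 * norm2 (grad_row x).
Proof.
have E k : grad_row x 0 k = (2^-1 : R)%:C *
    (partial (lshift n k) u x +i* partial (rshift n k) u x).
  rewrite mxE /d_zbar !partialC_real mulrC fmorphV rmorph_nat; congr (_ * _).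
  by rewrite [RHS]complexE.
have term k : (partial (lshift n k) u x) ^+ 2 + (partial (rshift n k) u x) ^+ 2 <= 4 * norm2 (grad_row x).
  rewrite /norm2 (bigD1 k) //= E Re_realM Im_realM /=.
  set s := \sum_(_ | _) _; have s0 : 0 <= s by apply: sumr_ge0 => j _; rewrite addr_ge0 ?sqr_ge0.
  move: s s0 (partial (lshift n k) u x) (partial (rshift n k) u x) => s s0 p q; lra.
case: (split_ordP a) => k ->; apply: le_trans (term k).
  by rewrite lerDl sqr_ge0.
by rewrite lerDr sqr_ge0.
Qed.

Lemma u1_gt0 x : 0 < 1 + u x.
Proof. by rewrite addr_gt0 // (u_gt0 gK). Qed.

Lemma u1_Ck k : Ck k (fun x => 1 + u x).
Proof. by apply: CkD; [exact: Ck_cst|exact: (u_Ck gK)]. Qed.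

Lemma partial_u1 a x : is_derive x (delta_mx 0 a) (fun y => 1 + u y) (partial a u x).
Proof.
have := is_deriveDf (is_derive_cstf 1 a x) (Ck_is_derive a x (u_Ck gK 1)).
by rewrite add0r.
Qed.

Lemma partial_ln_u a x : partial a (log_det g) x = partial a u x * (u x)^-1.
Proof.
by have [] := is_derive_partial (is_derive_lnf (u_gt0 gK x) (Ck_is_derive a x (u_Ck gK 1))).
Qed.

Lemma partial_ln_u1 a x : partial a (fun y => ln (1 + u y)) x = partial a u x * (1 + u x)^-1.
Proof.
by have [] := is_derive_partial (is_derive_lnf (u1_gt0 x) (partial_u1 a x)).
Qed.

Lemma partial_inv_u1 a x : partial a (fun y => (1 + u y)^-1) x = partial a u x * - ((1 + u x)^-1 * (1 + u x)^-1).
Proof.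
have u10 : 1 + u x != 0 by rewrite gt_eqF // u1_gt0.
have [_ ->] := is_derive_partial (is_deriveVf u10 (partial_u1 a x)).
by rewrite mulrN mulNr.
Qed.

(** Energy of [ln (1 + u)], measured with the metric itself. *)
Definition energy x : R :=
  complex.Re ((grad_row x *m invmx (g x) *m ctr (grad_row x)) 0 0) / (1 + u x) ^+ 2.

(** Multiply [tr Ric = - Laplacian (ln det g)] by [1 / (1 + det g)] and
    integrate by parts against the volume form.  The test function decreases in
    [det g], so that a lower bound on the curvature bounds the energy from above. *)
Lemma energy_mean (e : R) : 0 <= e -> (forall x, - e <= scalar_curvature g x) ->
  continuous energy /\ M energy <= e.
Proof.
move=> e0 scal.
pose F z := (log_det g z)%:C.
have FC : CkC 2 F by apply: CkC_real; apply: Ck_ln; [exact: (u_gt0 gK)|exact: (u_Ck gK)].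
have Fb k : CkC 1 (d_zbar k F) by apply: CkC_dzbar.
(* The gradient of [ln det g], times the volume density. *)
pose V j x := \sum_k (\adj (g x)) k j * d_zbar k F x.
have hadj k j := adj_CkC gK 1 k j.
have hV j : CkC 1 (V j) by apply: CkC_sum => k; apply: CkCM.
pose psi x := ((1 + u x)^-1)%:C.
have u1n x : 1 + u x != 0 by rewrite gt_eqF // u1_gt0.
have hpsi : CkC 1 psi by apply: CkC_real; apply: CkV => //; exact: u1_Ck.
have cI : continuous (fun x => (1 + u x)^-1) by apply: cont_inv => //; exact: (Ck_cont (u1_Ck 0)).
pose D x := \sum_j d_z j (V j) x.
(* The divergence of the cofactors vanishes, so that only second derivatives of
   [ln det g] remain. *)
have DE x : complex.Re (D x) = - (u x * scalar_curvature g x).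
  rewrite (scalar_curvatureE n0 gK) mulrN opprK -Re_realM; congr (complex.Re _).
  set H := \matrix_(_, _) _.
  transitivity (\tr (\adj (g x) *m H)); last first.
    rewrite /invmx (posdef_unit (kahler_posdef gK x)) -scalemxAl linearZ /= (kahler_det gK).
    rewrite mulrA -fmorphV -rmorphM /= divff ?gt_eqF ?(u_gt0 gK) //.
    by rewrite mul1r.
  transitivity (\sum_j \sum_k (d_z j (fun y => (\adj (g y)) k j) x * d_zbar k F x +
      (\adj (g x)) k j * d_z j (d_zbar k F) x)).
    apply: eq_bigr => j _; rewrite (der_sum (derivation_dz R j)) => [|k]; last exact: CkCM.
    by apply: eq_bigr => k _; rewrite (derM (derivation_dz R j)).
  rewrite exchange_big /= /mxtrace; apply: eq_bigr => k _.
  rewrite big_split /= -mulr_suml (piola_dz gK) mul0r add0r mxE.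
  by apply: eq_bigr => j _; rewrite [H j k]mxE.
have EE x : energy x = - complex.Re (\sum_j V j x * d_z j psi x).
  rewrite -Re_opp -sumrN /energy.
  have -> : \sum_j - (V j x * d_z j psi x) =
      (((1 + u x) ^- 2)%:C) * (grad_row x *m invmx (g x) *m ctr (grad_row x)) 0 0.
    rewrite mxE mulr_sumr; apply: eq_bigr => j _.
    rewrite mxE -mulNr -sumrN !mulr_suml mulr_sumr; apply: eq_bigr => k _.
    rewrite (d_z_chain (f := u) (c := - ((1 + u x)^-1 * (1 + u x)^-1))); last by move=> a; exact: partial_inv_u1.
    rewrite (d_zbar_chain (f := u) (c := (u x)^-1)); last by move=> a; exact: partial_ln_u.
    have -> : ctr (grad_row x) j 0 = d_z j (fun y => (u y)%:C) x.
      rewrite !mxE conj_dzbar; last by apply: CkC_real; exact: (u_Ck gK).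
      by congr (d_z j _ x); apply/funext => y; rewrite conjc_real.
    have iE : invmx (g x) k j = ((u x)^-1)%:C * (\adj (g x)) k j.
      by rewrite /invmx (posdef_unit (kahler_posdef gK x)) [LHS]mxE (kahler_det gK) fmorphV.
    rewrite iE [grad_row x 0 k]mxE expr2 invfM rmorphN rmorphM.
    move: (d_zbar _ _ _) (d_z _ _ _) ((u x)^-1)%:C ((1 + u x)^-1)%:C ((\adj (g x)) k j) => p q r s t.
    by ring.
  by rewrite Re_realM mulrC.
have cE : continuous energy.
  rewrite (funext EE); apply: contN.
  suff [h _] : contC (fun x => \sum_j V j x * d_z j psi x) by [].
  apply: contC_sum => j; apply: contC_mul; first exact: CkC_contC (hV j).
  by apply: (@CkC_contC _ _ 0); exact: CkC_dz.
split=> //.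
have cD : contC D by apply: contC_sum => j; apply: (@CkC_contC _ _ 0); exact: CkC_dz.
have parts : M (fun x => complex.Re (\sum_j d_z j (fun y => V j y * psi y) x)) = 0.
  rewrite mean_Re_sum => [|j]; last by apply: (@CkC_contC _ _ 0); apply: CkC_dz; exact: CkCM.
  apply: big1 => j _; apply: (mean_Re_dz Bu); first exact: CkCM.
  move=> x v lv.
  have Fp : (fun y => F (y + v)) = F.
    by apply/funext => y; rewrite /F /log_det (kahler_periodic gK y lv).
  have dF k : d_zbar k F (x + v) = d_zbar k F x by rewrite -d_zbar_shift Fp.
  have Vp : V j (x + v) = V j x.
    by apply: eq_bigr => k _; rewrite dF (kahler_periodic gK x lv).
  have pp : psi (x + v) = psi x by rewrite /psi (vol_density_periodic gK x lv).
  by rewrite Vp pp.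
have E1 x : complex.Re (\sum_j d_z j (fun y => V j y * psi y) x) =
    complex.Re (D x) * (1 + u x)^-1 - energy x.
  rewrite EE opprK mulrC -Re_realM -Re_add; congr (complex.Re _).
  rewrite mulrC /D mulr_suml -big_split; apply: eq_bigr => j _ /=.
  by rewrite (derM (derivation_dz R j)).
have cDD : continuous (fun x => complex.Re (D x) * (1 + u x)^-1).
  by apply: contM => //; case: cD.
rewrite (funext E1) (meanB mM) // in parts.
have -> : M energy = M (fun x => complex.Re (D x) * (1 + u x)^-1) by apply/esym/subr0_eq.
apply: (mean_le_cst mM) => // x _; rewrite DE -mulrN.
have ux := u_gt0 gK x; have u1x := u1_gt0 x; rewrite ler_pdivrMr //.
by have := scal x; nra.
Qed.

(** The energy is measured by the metric, which may degenerate or blow up: only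
    an L^1 norm of the gradient is controlled, with a free parameter [lam]
    between the energy and the trace. *)
Lemma gradient_bound (e lam : R) a : 0 <= e -> (forall x, - e <= scalar_curvature g x) -> 0 < lam ->
  M (fun x => `|partial a (fun y => ln (1 + u y)) x|) <= lam * e + lam^-1 * M (fun x => trR (g x)).
Proof.
move=> e0 scal lam0; have [cE ME] := energy_mean e0 scal.
have ct := trace_cont gK.
have cw : continuous (partial a (fun y => ln (1 + u y))).
  by apply: (@Ck_cont _ _ 0); apply: Ck_partial; apply: Ck_ln; [exact: u1_gt0|exact: u1_Ck].
apply: (@le_trans _ _ (M (fun x => lam * energy x + lam^-1 * trR (g x)))).
  apply: (mean_le mM).
  - exact: cont_norm.
  - by apply: contD; (apply: contM; [exact: cont_cst|by []]).
  move=> x _; have gp := kahler_posdef gK x.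
  have h1 := partial_le_grad a x; have h2 := posdef_inv_form (grad_row x) gp.
  have t0 := posdef_trace_gt0 n0 gp; have u1x := u1_gt0 x.
  rewrite partial_ln_u1 /energy.
  move: (partial a u x) (complex.Re _) (1 + u x) (trR (g x)) (norm2 _) u1x t0 h1 h2.
  by move=> p q v t N v0 t0 h1 h2; exact: gradient_young h1 h2.
rewrite (meanD mM) ?(meanZ mM) //; [|by apply: contM; [exact: cont_cst|]|by apply: contM; [exact: cont_cst|]].
by rewrite lerD2r ler_pM2l.
Qed.

End Gradient.

(** * Limits of real sequences *)

Section Limits.
Variable R : realType.
Implicit Types (a d : nat -> R).

(** The errors below split into a part made small by the choice of constants
    and, once these are fixed, a part that tends to zero. *)
Lemma cvg0_approx d : (forall e : R, 0 < e ->
    exists2 a, a k @[k --> \oo] --> (0 : R) & forall k, `|d k| <= e + a k) ->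
  d k @[k --> \oo] --> (0 : R).
Proof.
move=> h; apply/cvgr0Pnorm_le => e e0.
have e2 : 0 < e / 2 by rewrite divr_gt0.
have [a a0 da] := h _ e2; have h2 : \forall k \near \oo, `|a k| <= e / 2.
  by move/cvgr0Pnorm_le: a0; apply.
near=> k; have ak : `|a k| <= e / 2 by near: k.
apply: le_trans (da k) _.
by have := ler_norm (a k); lra.
Unshelve. all: by end_near. Qed.

Lemma cvg0_le d a : a k @[k --> \oo] --> (0 : R) -> (forall k, `|d k| <= a k) ->
  d k @[k --> \oo] --> (0 : R).
Proof.
by move=> a0 h; apply: cvg0_approx => e e0; exists a => // k; apply: le_trans (h k) _; rewrite lerDr ltW.
Qed.

Lemma cvg0Z (c : R) d : d k @[k --> \oo] --> (0 : R) -> c * d k @[k --> \oo] --> (0 : R).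
Proof. by move=> h; have := cvgMr (a := c) h; rewrite mulr0; apply. Qed.

Lemma cvg0D a d : a k @[k --> \oo] --> (0 : R) -> d k @[k --> \oo] --> (0 : R) ->
  a k + d k @[k --> \oo] --> (0 : R).
Proof. by move=> h h'; have := cvgD h h'; rewrite addr0; apply. Qed.

Lemma cvg0_norm d : d k @[k --> \oo] --> (0 : R) -> `|d k| @[k --> \oo] --> (0 : R).
Proof. by move=> h; have := cvg_norm h; rewrite normr0; apply. Qed.

Lemma cvg0_sum (J : Type) (r : seq J) (F : J -> nat -> R) :
  (forall j, F j k @[k --> \oo] --> (0 : R)) -> \sum_(j <- r) F j k @[k --> \oo] --> (0 : R).
Proof.
move=> hF; elim: r => [|j r IH].
  by rewrite (_ : (fun _ => _) = fun=> 0); [exact: cvg_cst|apply/funext => k; rewrite big_nil].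
rewrite (_ : (fun _ => _) = fun k => F j k + \sum_(j <- r) F j k).
  exact: cvg0D.
by apply/funext => k; rewrite big_cons.
Qed.

Lemma cvg_dist0 (a : nat -> R) (l : R) : (a k @[k --> \oo] --> l) <-> (a k - l @[k --> \oo] --> (0 : R)).
Proof.
split=> h; first by have := cvgB h (cvg_cst l); rewrite subrr; apply.
have : (a k - l) + l @[k --> \oo] --> 0 + l by apply: cvgD h (cvg_cst l).
rewrite add0r; suff -> : (fun k => a k - l + l) = a by [].
by apply/funext => k /=; rewrite subrK.
Qed.

(** Finitely many successive applications of Bolzano-Weierstrass. *)
Lemma bounded_subsequences (J : finType) (a : J -> nat -> R) (C : R) : (forall j k, `|a j k| <= C) ->
  exists2 phi : nat -> nat, {homo phi : k l / (k < l)%N} &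
    exists b : J -> R, forall j, a j (phi k) @[k --> \oo] --> b j.
Proof.
move=> aC.
have [phi ph cv] : exists2 phi : nat -> nat, {homo phi : k l / (k < l)%N} &
    forall j, j \in enum J -> cvgn (fun k => a j (phi k)).
  elim: (enum J) => [|j s [phi ph IH]]; first by exists id.
  have [|psi psim cpsi] := @bolzano_weierstrass R (fun k => a j (phi k)).
    by exists C; split; [exact: num_real|move=> M CM k _; exact: le_trans (aC _ _) (ltW CM)].
  have psih : {homo psi : k l / (k < l)%N}.
    by move=> k l kl; rewrite ltnNge; apply/negP => h; have := psim l k; rewrite !leEnat h => /esym; rewrite leqNgt kl.
  exists (phi \o psi) => [k l kl|i]; first exact/ph/psih.
  rewrite in_cons => /orP[/eqP ->|/IH ci]; first exact: cpsi.
  have [b hb] := (cvg_ex _).1 ci; apply/cvg_ex; exists b.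
  have psioo : psi k @[k --> \oo] --> \oo.
    have le k : (k <= psi k)%N by elim: k => // k IHk; apply: leq_ltn_trans IHk (psih _ _ _).
    by move=> A [N _ NA]; exists N => // k Nk; apply: NA => /=; exact: leq_trans (le k).
  exact: cvg_comp psioo hb.
exists phi => //; exists (fun j => lim (a j (phi k) @[k --> \oo])) => j.
by apply: cv; rewrite mem_enum.
Qed.

Lemma homo_cvg_oo (phi : nat -> nat) : {homo phi : k l / (k < l)%N} -> phi k @[k --> \oo] --> \oo.
Proof.
move=> ph; have le k : (k <= phi k)%N by elim: k => // k IHk; apply: leq_ltn_trans IHk (ph _ _ _).
by move=> A [N _ NA]; exists N => // k Nk; apply: NA => /=; exact: leq_trans (le k).
Qed.

(** Pointwise form of Chebyshev's inequality. *)
Lemma powR_tail (r K t : R) : 1 <= r -> 0 < K -> K <= t -> t <= t `^ r * K `^ (1 - r).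
Proof.
move=> r1 K0 Kt; have t0 : 0 < t by exact: lt_le_trans Kt.
have -> : t `^ r = t * t `^ (r - 1).
  by rewrite -{2}[t](powRr1 (ltW t0)) -powRD; [rewrite addrC subrK|rewrite (gt_eqF t0) implybT].
rewrite -(opprB r 1) powRN -mulrA ler_peMr ?(ltW t0) //.
by rewrite ler_pdivlMr ?powR_gt0 // mul1r ge0_ler_powR ?subr_ge0 // nnegrE ltW.
Qed.

Lemma powR_small (s P e K0 : R) : 0 < s -> 0 <= P -> 0 < e -> 0 < K0 ->
  exists2 K : R, K0 <= K & P * K `^ (- s) <= e.
Proof.
move=> s0 P0 e0 K00; set c := (P / e) `^ s^-1.
have c0 : 0 <= c by exact: powR_ge0.
exists (K0 + c); first by rewrite lerDl.
have Kp : 0 < K0 + c by rewrite ltr_pwDl.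
rewrite powRN ler_pdivrMr ?powR_gt0 // mulrC -ler_pdivrMr //.
have -> : P / e = c `^ s by rewrite /c -powRrM mulVf ?gt_eqF // powRr1 // divr_ge0 // ltW.
by rewrite ge0_ler_powR ?nnegrE ?(ltW s0) ?(ltW Kp) // lerDr ltW.
Qed.

(** Integrated, this says that convergence in L^1 and boundedness in L^r imply
    convergence in L^s for [s < r]. *)
Lemma powR_interpolation (s r e K t : R) : 0 < s -> s < r -> 0 < e -> 0 < K -> 0 <= t ->
  t `^ s <= e + K `^ s / e `^ s^-1 * t + K `^ (s - r) * t `^ r.
Proof.
move=> s0 sr e0 K0 t0.
have tau0 : 0 < e `^ s^-1 by rewrite powR_gt0.
have A0 : 0 <= K `^ s / e `^ s^-1 * t by rewrite mulr_ge0 // divr_ge0 ?powR_ge0 // ltW.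
have B0 : 0 <= K `^ (s - r) * t `^ r by rewrite mulr_ge0 ?powR_ge0.
case: (ltP t (e `^ s^-1)) => h1.
  by have := powR_lt_of_lt t0 s0 e0 h1; lra.
have tp : 0 < t by exact: lt_le_trans h1.
case: (leP t K) => h2.
  suff : t `^ s <= K `^ s / e `^ s^-1 * t by lra.
  rewrite -mulrA -[leLHS]mulr1; apply: ler_pM; rewrite ?powR_ge0 //.
    by rewrite ge0_ler_powR ?nnegrE ?(ltW s0) ?(ltW K0).
  by rewrite mulrC ler_pdivlMr ?mul1r.
suff : t `^ s <= K `^ (s - r) * t `^ r by lra.
have -> : t `^ s = t `^ (s - r) * t `^ r by rewrite -powRD ?gt_eqF ?implybT // subrK.
rewrite ler_pM2r ?powR_gt0 // -(opprB r s) !powRN lef_pV2 ?posrE ?powR_gt0 //.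
by rewrite ge0_ler_powR ?subr_ge0 ?nnegrE ?(ltW K0) ?(ltW sr) ?(ltW h2).
Qed.

Lemma powR_sub1_le (t r : R) : 0 <= t -> 0 <= r -> `|t - 1| `^ r <= 1 + t `^ r.
Proof.
move=> t0 r0; case: (leP t 1) => h.
  have : `|t - 1| `^ r <= 1.
    rewrite -[leRHS](_ : 1 `^ r = 1); last by rewrite powR1.
    by rewrite ge0_ler_powR ?nnegrE // ler_norml; apply/andP; split; lra.
  by have := powR_ge0 t r; lra.
have : `|t - 1| `^ r <= t `^ r.
  by rewrite ge0_ler_powR ?nnegrE // ger0_norm; lra.
by lra.
Qed.

End Limits.

(** * The volume density of one metric *)

Section VolumeEstimates.
Variables (R : realType) (n : nat) (B : 'M[R]_(n + n)) (g : 'rV[R]_(n + n) -> 'M[R[i]]_n).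
Hypotheses (n0 : (0 < n)%N) (Bu : B \in unitmx) (gK : kahler B g).
Local Notation pt := 'rV[R]_(n + n).
Local Notation C := R[i].
Local Notation M := (torus_mean B).
Local Notation u := (vol_density g).
Local Notation w := (fun x : pt => ln (1 + u x)).
Local Notation A := (mean_mx B g).
Let mM := mean_torus B.

Lemma volume_mean_gt0 : 0 < M u.
Proof. exact: (torus_mean_gt0 Bu (u_cont gK) (vol_density_periodic gK) (u_gt0 gK)). Qed.

Lemma w_cont : continuous w.
Proof. by apply: (@Ck_cont _ _ 0); apply: Ck_ln; [exact: (u1_gt0 gK)|exact: (u1_Ck gK)]. Qed.

Lemma upow_cont r : continuous (fun x => u x `^ r).
Proof. by apply: cont_powR; [exact: (u_cont gK)|exact: (u_gt0 gK)]. Qed.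

Lemma w_ge0 x : 0 <= w x.
Proof. by rewrite ln_ge0 // lerDl ltW // (u_gt0 gK). Qed.

Lemma mean_w_ge0 : 0 <= M w.
Proof. by apply: (mean_ge0 mM w_cont) => x _; exact: w_ge0. Qed.

Lemma mean_w_le : M w <= M u.
Proof.
apply: (mean_le mM w_cont (u_cont gK)) => x _; apply: le_ln1Dx.
by apply: lt_trans (u_gt0 gK x); rewrite ltrN10.
Qed.

(** Where [u <= K], the oscillation of [u] is controlled by that of
    [ln (1 + u)]; where [u > K], by the integrability of [u ^ r]. *)
Lemma volume_spread (K r : R) : 1 < r -> expR (M w) <= K ->
  M (fun x => `|u x - M u|) <=
  2 * ((1 + K) * M (fun x => `|w x - M w|) + K `^ (1 - r) * M (fun x => u x `^ r)).
Proof.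
move=> r1 mK.
(* The comparison constant [b] is the value of [u] at which [ln (1 + u)] equals
   its mean; it is replaced by [M u] at the cost of a factor [2]. *)
set m := M w in mK *; pose b := expR m - 1.
have K0 : 0 < K by exact: lt_le_trans (expR_gt0 m) mK.
have b0 : 0 <= b.
  by rewrite subr_ge0 -expR0 ler_expR; exact: mean_w_ge0.
have cb : continuous (fun x : pt => `|u x - b|) := cont_dist (u_cont gK).
have cm : continuous (fun x : pt => `|w x - m|) := cont_dist w_cont.
have cr : continuous (fun x : pt => u x `^ r) by exact: upow_cont.
have h1 : M (fun x => `|u x - b|) <= (1 + K) * M (fun x => `|w x - m|) + K `^ (1 - r) * M (fun x => u x `^ r).
  rewrite -(meanZ mM) // -(meanZ mM) // -(meanD mM); [|by apply: contM => //; exact: cont_cst..].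
  apply: (mean_le mM) => //.
    by apply: contD; apply: contM => //; exact: cont_cst.
  move=> x _; have ux := u_gt0 gK x; have u1x := u1_gt0 gK x.
  have p1 : 0 <= (1 + K) * `|w x - m| by rewrite mulr_ge0 // addr_ge0 // ltW.
  have p2 : 0 <= K `^ (1 - r) * u x `^ r by rewrite mulr_ge0 // powR_ge0.
  have eb : u x - b = expR (w x) - expR m by rewrite lnK ?posrE // /b; ring.
  case: (leP (u x) K) => uK.
    apply: le_trans (_ : (1 + K) * `|w x - m| <= _); last by rewrite lerDl.
    rewrite eb; apply: exp_lipschitz; first by rewrite lnK ?posrE // lerD2l.
    by apply: le_trans mK _; rewrite lerDr.
  apply: le_trans (_ : u x <= _).
    by rewrite ger0_norm; [rewrite gerBl|rewrite subr_ge0; apply: le_trans (ltW uK); rewrite lerBlDr (le_trans mK) // lerDl].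
  by apply: le_trans (powR_tail (ltW r1) K0 (ltW uK)) _; rewrite mulrC lerDr.
have h2 : `|M u - b| <= M (fun x => `|u x - b|).
  have := mean_abs mM (contB (u_cont gK) (@cont_cst R _ b)).
  by rewrite (meanB mM) ?(mean_cst mM) //; [exact: (u_cont gK)|exact: cont_cst].
have h3 : M (fun x => `|u x - M u|) <= M (fun x => `|u x - b| + `|M u - b|).
  apply: (mean_le mM); [exact: cont_dist (u_cont gK)|by apply: contD => //; exact: cont_cst|].
  by move=> x _; rewrite [`|M u - b|]distrC -[u x - M u](subrKA b) ler_normD.
rewrite (meanD mM) ?(mean_cst mM) // in h3; last exact: cont_cst.
by move: h1 h2 h3; move: (M _) (M _) (`|_ - b|) (_ * _ + _) => p q s t; lra.
Qed.

(** Fractional powers of [u / M u] are closer to [1] than [u / M u] itself. *)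
Lemma mean_upow_ge (a : R) : 0 <= a <= 1 ->
  1 - M (fun x => `|u x - M u|) / M u <= M (fun x => u x `^ a) / M u `^ a.
Proof.
move=> a01; have c0 := volume_mean_gt0; set c := M u in c0 *.
have cu : continuous (fun x : pt => u x `^ a) by exact: upow_cont.
have cd : continuous (fun x : pt => `|u x - c|) := cont_dist (u_cont gK).
rewrite ler_pdivlMr ?powR_gt0 //.
have -> : (1 - M (fun x => `|u x - c|) / c) * c `^ a = M (fun x => c `^ a - c `^ a / c * `|u x - c|).
  rewrite (meanB mM) ?(mean_cst mM) ?(meanZ mM) //; [by ring|exact: cont_cst|].
  by apply: contM => //; exact: cont_cst.
apply: (mean_le mM) => //.
  by apply: contB; [exact: cont_cst|apply: contM => //; exact: cont_cst].
move=> x _; have ux := u_gt0 gK x.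
have y0 : 0 < u x / c by rewrite divr_gt0.
have h := powR_near1 y0 a01.
have E1 : u x / c - 1 = (u x - c) / c by rewrite mulrBl divff ?gt_eqF.
have E2 : (u x / c) `^ a = u x `^ a / c `^ a.
  by rewrite powRM ?invr_ge0 ?(ltW ux) ?(ltW c0) // -powR_inv1 ?(ltW c0) // -powRrM mulN1r powRN.
rewrite E1 E2 normrM [`|c^-1|]ger0_norm ?invr_ge0 ?(ltW c0) // in h.
have ca : 0 < c `^ a by rewrite powR_gt0.
have h' : 1 - u x `^ a / c `^ a <= `|u x - c| / c.
  by apply: le_trans h; rewrite distrC ler_norm.
have : c `^ a * (1 - u x `^ a / c `^ a) <= c `^ a * (`|u x - c| / c) by rewrite ler_pM2l.
rewrite mulrBr mulr1 mulrCA divff ?gt_eqF // mulr1 mulrA mulrAC; lra.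
Qed.

Lemma powR_div (x y a : R) : 0 < x -> 0 < y -> (x / y) `^ a = x `^ a / y `^ a.
Proof.
move=> x0 y0; rewrite powRM ?invr_ge0 ?(ltW x0) ?(ltW y0) //.
by rewrite -powR_inv1 ?(ltW y0) // -powRrM mulN1r powRN.
Qed.

Let a : R := n%:R^-1.

Lemma inv_n_itv : 0 <= a <= 1.
Proof. by rewrite invr_ge0 ler0n invf_le1 ?ltr0n // ler1n. Qed.

(** Concavity of [det ^ (1/n)], tested against the average metric. *)
Lemma det_mean_ge : (1 - M (fun x => `|u x - M u|) / M u) * M u `^ a <= detR A `^ a.
Proof.
have D0 := posdef_det_gt0 (mean_posdef Bu gK); have c0 := volume_mean_gt0.
rewrite -ler_pdivlMr ?powR_gt0 //; apply: le_trans (mean_upow_ge inv_n_itv) _.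
rewrite ler_pdivrMr ?powR_gt0 //.
rewrite divfK ?gt_eqF ?powR_gt0 //.
have ca : continuous (fun x => u x `^ a) by exact: upow_cont.
have h : M (fun x => n%:R / detR A `^ a * u x `^ a) <= n%:R.
  apply: (@le_trans _ _ (M (fun x => complex.Re (\tr (invmx A *m g x))))).
    apply: (mean_le mM); [by apply: contM => //; exact: cont_cst|exact: (form_cont gK)|].
    move=> x _; have := posdef_amgm_compare n0 (kahler_posdef gK x) (mean_posdef Bu gK).
    by rewrite (powR_div _ (u_gt0 gK x) D0) mulrA mulrAC.
  rewrite -(mean_linear gK) mulVmx ?(posdef_unit (mean_posdef Bu gK)) // mxtrace1.
  by rewrite -(rmorph_nat (@real_complex_def R (Phant R))).
by move: h; rewrite (meanZ mM) // -mulrA ger_pMr ?ltr0n // mulrC ler_pdivrMr ?powR_gt0 // mul1r.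
Qed.

(** The reverse inequality: the arithmetic-geometric inequality for the average
    metric relative to [g], integrated by means of [cohomology_pairing]. *)
Lemma det_mean_le : (1 - M (fun x => `|u x - M u|) / M u) * detR A `^ a <= M u `^ a.
Proof.
have D0 := posdef_det_gt0 (mean_posdef Bu gK); have c0 := volume_mean_gt0.
have b01 : 0 <= 1 - a <= 1 by have := inv_n_itv; lra.
have cb : continuous (fun x => u x `^ (1 - a)) by exact: upow_cont.
have h : M (fun x => n%:R * detR A `^ a * u x `^ (1 - a)) <= n%:R * M u.
  rewrite (cohomology_pairing Bu gK); apply: (mean_le mM).
  - by apply: contM => //; exact: cont_cst.
  - rewrite (_ : (fun x => _) = fun x : pt => complex.Re (\sum_j \sum_k (\adj (g x)) j k * A k j)).
      suff [] : contC (fun x : pt => \sum_j \sum_k (\adj (g x)) j k * A k j) by [].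
      apply: contC_sum => j; apply: contC_sum => k; apply: contC_mul.
        exact: CkC_contC (adj_CkC gK 0 j k).
      exact: CkC_contC (@CkC_cst R n 0 (A k j)).
    by apply/funext => x; congr (complex.Re _); apply: eq_bigr => j _; rewrite [LHS]mxE.
  move=> x _; have ux := u_gt0 gK x.
  have := posdef_amgm_compare n0 (mean_posdef Bu gK) (kahler_posdef gK x).
  rewrite -(ler_pM2l ux) (powR_div _ D0 ux).
  have -> : u x * complex.Re (\tr (invmx (g x) *m A)) = complex.Re (\tr (\adj (g x) *m A)).
    rewrite -Re_realM /invmx (posdef_unit (kahler_posdef gK x)) -scalemxAl linearZ /=.
    rewrite (kahler_det gK) mulrA -fmorphV -rmorphM /= divff ?gt_eqF //.
    by rewrite mul1r.
  apply: le_trans; rewrite -[X in n%:R * _ * X](_ : u x / u x `^ a = _); last first.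
    by rewrite -{1}[u x](powRr1 (ltW ux)) -powRB // (gt_eqF ux) implybT.
  by rewrite le_eqVlt; apply/orP; left; apply/eqP; ring.
rewrite (meanZ mM) // -mulrA ler_pM2l ?ltr0n // in h.
have h2 := mean_upow_ge b01; rewrite ler_pdivlMr ?powR_gt0 // in h2.
have ca : 0 < M u `^ (1 - a) by rewrite powR_gt0.
rewrite -(ler_pM2r ca); have -> : M u `^ a * M u `^ (1 - a) = M u.
  by rewrite -powRD; [rewrite addrC subrK powRr1 // ltW|rewrite (gt_eqF c0) implybT].
apply: le_trans h; rewrite mulrAC mulrC ler_pM2l ?powR_gt0 //.
Qed.

End VolumeEstimates.

(** * Limits of matrices *)

Section MatrixLimits.
Variable R : realType.
Local Notation C := R[i].

Definition cvgC (f : nat -> C) (l : C) := cabs (f k - l) @[k --> \oo] --> (0 : R).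

Lemma cabs_opp (z : C) : cabs (- z) = cabs z.
Proof. by rewrite /cabs Re_opp Im_opp !normrN. Qed.

Lemma cvgC_cst (l : C) : cvgC (fun=> l) l.
Proof. by rewrite /cvgC subrr /cabs /= normr0 addr0; exact: cvg_cst. Qed.

Lemma cvgCD (f h : nat -> C) l m : cvgC f l -> cvgC h m -> cvgC (fun k => f k + h k) (l + m).
Proof.
move=> fl hm; apply: cvg0_le (cvg0D fl hm) _ => k; rewrite ger0_norm ?cabs_ge0 // opprD addrACA.
exact: cabsD.
Qed.

Lemma cvgCM (f h : nat -> C) l m : cvgC f l -> cvgC h m -> cvgC (fun k => f k * h k) (l * m).
Proof.
move=> fl hm.
have h1 : cabs l * cabs (h k - m) + (cabs (f k - l) * cabs (h k - m) + cabs m * cabs (f k - l)) @[k --> \oo] --> (0 : R).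
  apply: cvg0D; first exact: cvg0Z; apply: cvg0D; last exact: cvg0Z.
  by have := cvgM fl hm; rewrite mulr0; apply.
apply: cvg0_le h1 _ => k; rewrite ger0_norm ?cabs_ge0 //.
have -> : f k * h k - l * m = l * (h k - m) + ((f k - l) * (h k - m) + (f k - l) * m).
  by move: (f k) (h k) => p q; ring.
apply: le_trans (cabsD _ _) _; apply: lerD; first exact: cabsM.
apply: le_trans (cabsD _ _) _; apply: lerD; first exact: cabsM.
by rewrite mulrC; exact: cabsM.
Qed.

Lemma cvgC_sum (J : Type) (r : seq J) (F : J -> nat -> C) (l : J -> C) :
  (forall j, cvgC (F j) (l j)) -> cvgC (fun k => \sum_(j <- r) F j k) (\sum_(j <- r) l j).
Proof.
move=> hF; elim: r => [|j r IH].
  rewrite big_nil (_ : (fun _ => _) = fun=> 0); first exact: cvgC_cst.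
  by apply/funext => k; rewrite big_nil.
rewrite big_cons (_ : (fun _ => _) = fun k => F j k + \sum_(j <- r) F j k); first exact: cvgCD.
by apply/funext => k; rewrite big_cons.
Qed.

Lemma cvgC_prod (J : Type) (r : seq J) (F : J -> nat -> C) (l : J -> C) :
  (forall j, cvgC (F j) (l j)) -> cvgC (fun k => \prod_(j <- r) F j k) (\prod_(j <- r) l j).
Proof.
move=> hF; elim: r => [|j r IH].
  rewrite big_nil (_ : (fun _ => _) = fun=> 1); first exact: cvgC_cst.
  by apply/funext => k; rewrite big_nil.
rewrite big_cons (_ : (fun _ => _) = fun k => F j k * \prod_(j <- r) F j k); first exact: cvgCM.
by apply/funext => k; rewrite big_cons.
Qed.

Lemma cvgC_Re (f : nat -> C) l : cvgC f l -> complex.Re (f k) @[k --> \oo] --> complex.Re l.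
Proof.
move=> fl; apply: (cvg_dist0 _ _).2; apply: (cvg0_le (a := fun k => cabs (f k - l))) => // k.
by rewrite -Re_opp -Re_add; exact: Re_le_cabs.
Qed.

Lemma cvg_lower (a : nat -> R) (l m : R) : a k @[k --> \oo] --> l -> (forall k, m <= a k) -> m <= l.
Proof.
move=> al ma; have <- : lim (a k @[k --> \oo]) = l by apply/cvg_lim.
by apply: limr_ge; [apply/cvg_ex; exists l|exact: nearW].
Qed.

Lemma cabs_eq0 (z : C) : cabs z <= 0 -> z = 0.
Proof.
move=> h; have h1 := Re_le_cabs z; have h2 := Im_le_cabs z.
have z1 : `|complex.Re z| <= 0 by exact: le_trans h.
have z2 : `|complex.Im z| <= 0 by exact: le_trans h.
by rewrite !normr_le0 in z1 z2; apply: eq_ReIm; apply/eqP.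
Qed.

Lemma cvgC_unique (f : nat -> C) l m : cvgC f l -> cvgC f m -> l = m.
Proof.
move=> fl fm; apply/subr0_eq/cabs_eq0; apply: (cvg_lower (cvg0D fl fm)) => k.
rewrite -[l - m](subrKA (f k)) -[X in _ <= X + _]cabs_opp opprB.
exact: cabsD.
Qed.

Lemma cvgC_conj (f : nat -> C) l : cvgC f l -> cvgC (fun k => conjc (f k)) (conjc l).
Proof.
by rewrite /cvgC (_ : (fun k => cabs (conjc (f k) - conjc l)) = fun k => cabs (f k - l)) //;
   apply/funext => k; rewrite -conjcB cabs_conj.
Qed.

Variable m : nat.
Implicit Types (X : nat -> 'M[C]_m) (A : 'M[C]_m).

Definition cvg_mx X A := forall j k, cvgC (fun i => X i j k) (A j k).

Lemma cvg_mx_det X A : cvg_mx X A -> cvgC (fun i => \det (X i)) (\det A).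
Proof.
move=> h; apply: cvgC_sum => s; apply: cvgCM; first exact: cvgC_cst.
by apply: cvgC_prod => j; exact: h.
Qed.

Lemma cvg_mx_trace (P : 'M[C]_m) X A : cvg_mx X A -> cvgC (fun i => \tr (P *m X i)) (\tr (P *m A)).
Proof.
move=> h; rewrite (_ : \tr (P *m A) = \sum_j \sum_k P j k * A k j); last first.
  by apply: eq_bigr => j _; rewrite [LHS]mxE.
rewrite (_ : (fun _ => _) = fun i => \sum_j \sum_k P j k * X i k j); last first.
  by apply/funext => i; apply: eq_bigr => j _; rewrite [LHS]mxE.
by apply: cvgC_sum => j; apply: cvgC_sum => k; apply: cvgCM; [exact: cvgC_cst|exact: h].
Qed.

(** Near-equality in the arithmetic-geometric inequality for [h] relative to [A],
    together with a ratio of determinants near [1], forces [h] to be close to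
    [A]. *)
Lemma metric_deviation A : (0 < m)%N -> posdef A -> exists2 c : R, 0 < c & forall (h : 'M[C]_m) (K : R) j k,
  posdef h -> 0 < K ->
  cabs (h j k - A j k) <= c * (4 * m%:R * (K * (complex.Re (\tr (invmx A *m h)) - m%:R * (detR h / detR A) `^ m%:R^-1)
     + 4 / K * complex.Re (\tr (invmx A *m h))) + `|(detR h / detR A) `^ m%:R^-1 - 1|).
Proof.
move=> m0 Ap; have [P [Q [PQ QP AE]]] := posdef_factor Ap.
exists (1 + \sum_j \sum_k \sum_a \sum_b cabs (Q j b) * cabs (Q k a)).
  rewrite ltr_pwDl //; do 4 (apply: sumr_ge0 => ? _).
  by rewrite mulr_ge0 ?cabs_ge0.
move=> h K j k hp K0.
pose H := P *m h *m ctr P; have Hp : posdef H by exact: posdef_congr PQ hp.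
have trH : trR H = complex.Re (\tr (invmx A *m h)) by rewrite /trR (congr_trace h PQ AE).
have dH : detR H = detR h / detR A by exact: congr_det PQ AE hp Ap.
rewrite -trH -dH; set G := detR H `^ m%:R^-1.
set E := 4 * m%:R * _ + _.
have HE a b : cabs (H a b - (1%:M : 'M[C]_m) a b) <= E.
  have -> : H a b - (1%:M : 'M[C]_m) a b = (H a b - (G%:C)%:M a b) + ((G%:C)%:M a b - (1%:M : 'M[C]_m) a b).
    by rewrite addrA subrK.
  apply: le_trans (cabsD _ _) _; apply: lerD; first exact: posdef_near_scalar.
  rewrite !mxE; case: (a == b); rewrite ?mulr1n ?mulr0n ?subr0 ?subrr.
    by rewrite -[1](rmorph1 (@real_complex_def R (Phant R))) -rmorphB cabs_real.
  by rewrite /cabs /= normr0 addr0 normr_ge0.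
have E0 : 0 <= E by apply: le_trans (cabs_ge0 _) (HE j j).
have hE : h = Q *m H *m ctr Q.
  rewrite /H !mulmxA QP mul1mx -mulmxA -ctrM QP ctr1 mulmx1 //.
have hA : h - A = Q *m (H - 1%:M) *m ctr Q.
  by rewrite mulmxBr mulmxBl -hE mulmx1 -AE.
have -> : h j k - A j k = (h - A) j k by rewrite !mxE.
rewrite hA mxE; apply: le_trans (cabs_sum _ _ _) _.
apply: (@le_trans _ _ (\sum_a \sum_b cabs (Q j b) * cabs (Q k a) * E)).
  apply: ler_sum => a _; rewrite [X in X * _]mxE mulr_suml.
  apply: le_trans (cabs_sum _ _ _) _; apply: ler_sum => b _.
  apply: le_trans (cabsM _ _) _; rewrite mulrAC.
  have -> : cabs ((ctr Q) a k) = cabs (Q k a) by rewrite /ctr !mxE cabs_conj.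
  rewrite ler_wpM2r ?cabs_ge0 //; apply: le_trans (cabsM _ _) _.
  rewrite ler_wpM2l ?cabs_ge0 //.
  by have := HE b a; rewrite !mxE.
rewrite (_ : \sum_a _ = (\sum_a \sum_b cabs (Q j b) * cabs (Q k a)) * E); last first.
  by rewrite mulr_suml; apply: eq_bigr => a _; rewrite mulr_suml.
apply: ler_wpM2r => //.
pose S j k := \sum_a \sum_b cabs (Q j b) * cabs (Q k a).
have S0 i l : 0 <= S i l.
  by apply: sumr_ge0 => a _; apply: sumr_ge0 => b _; rewrite mulr_ge0 ?cabs_ge0.
suff : S j k <= \sum_i \sum_l S i l by rewrite /S; lra.
have h1 : 0 <= \sum_(l | l != k) S j l by apply: sumr_ge0.
have h2 : 0 <= \sum_(i | i != j) \sum_l S i l by apply: sumr_ge0 => i _; apply: sumr_ge0.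
by rewrite [leRHS](bigD1 j) //= [X in _ <= X + _](bigD1 k) //= -addrA lerDl addr_ge0.
Qed.

End MatrixLimits.

(** * Convergence of the volume densities *)

Section MetricSequence.
Variables (R : realType) (n : nat) (B : 'M[R]_(n + n)) (g : nat -> 'rV[R]_(n + n) -> 'M[R[i]]_n).
Hypotheses (n0 : (0 < n)%N) (Bu : B \in unitmx) (gK : forall i, kahler B (g i)).
Local Notation pt := 'rV[R]_(n + n).
Local Notation C := R[i].
Local Notation M := (torus_mean B).
Local Notation u := (fun i => vol_density (g i)).
Local Notation w := (fun i (x : pt) => ln (1 + vol_density (g i) x)).
Let mM := mean_torus B.

Variables (T P r v : R).
Hypotheses (r1 : 1 < r) (v0 : 0 < v).
Hypothesis scal : forall i x, - i.+1%:R^-1 <= scalar_curvature (g i) x.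
Hypothesis trace_bound : forall i, M (fun x => trR (g i x)) <= T.
Hypothesis power_bound : forall i, M (fun x => u i x `^ r) <= P.
Hypothesis volume_bound : forall i, v <= M (u i).

Lemma trace_bound_gt0 : 0 < T.
Proof.
apply: lt_le_trans (trace_bound 0); rewrite -(trace_mean (gK 0)).
exact: (posdef_trace_gt0 n0 (mean_posdef Bu (gK 0))).
Qed.

Lemma power_bound_ge0 : 0 <= P.
Proof.
apply: le_trans (power_bound 0); apply: (mean_ge0 mM); first exact: upow_cont (gK 0) _.
by move=> x _; exact: powR_ge0.
Qed.

(** With parameter [T / e] the trace contributes at most [e], and the curvature
    a multiple of [1 / (i + 1)]. *)
Lemma gradient_cvg0 a : M (fun x => `|partial a (w i) x|) @[i --> \oo] --> (0 : R).
Proof.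
apply: cvg0_approx => e e0; have T0 := trace_bound_gt0; have lam0 : 0 < T / e by rewrite divr_gt0.
exists (fun i => T / e * i.+1%:R^-1); first by apply: cvg0Z; exact: cvg_harmonic.
move=> i; have i0 : 0 <= i.+1%:R^-1 :> R by rewrite invr_ge0.
have cw : continuous (partial a (w i)).
  by apply: (@Ck_cont _ _ 0); apply: Ck_partial; apply: Ck_ln; [exact: (u1_gt0 (gK i))|exact: (u1_Ck (gK i))].
rewrite ger0_norm; last by apply: (mean_ge0 mM) => [|x _]; [exact: cont_norm|exact: normr_ge0].
apply: le_trans (gradient_bound n0 Bu (gK i) a i0 (scal i) lam0) _.
rewrite addrC lerD2r invf_div; apply: (@le_trans _ _ (e / T * T)).
  by rewrite ler_pM2l ?divr_gt0.
by rewrite divfK ?gt_eqF.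
Qed.

Lemma log_oscillation_cvg0 : M (fun x => `|w i x - M (w i)|) @[i --> \oo] --> (0 : R).
Proof.
have [c c0 hc] := poincare Bu.
apply: (cvg0_le (a := fun i => c * \sum_a M (fun x => `|partial a (w i) x|))).
  by apply: cvg0Z; apply: cvg0_sum => a; exact: gradient_cvg0.
move=> i; have cw := w_cont (gK i); rewrite ger0_norm; last first.
  by apply: (mean_ge0 mM) => [|x _]; [exact: cont_dist|exact: normr_ge0].
apply: hc; first by apply: Ck_ln; [exact: (u1_gt0 (gK i))|exact: (u1_Ck (gK i))].
by move=> x l lv /=; rewrite (vol_density_periodic (gK i) x lv).
Qed.

Lemma volume_mean_le i : M (u i) <= 1 + P.
Proof.
have cr := upow_cont (gK i) (r := r).
apply: (@le_trans _ _ (M (fun x => 1 + u i x `^ r))).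
  apply: (mean_le mM); [exact: u_cont (gK i)|by apply: contD => //; exact: cont_cst|].
  move=> x _; have ux := u_gt0 (gK i) x; case: (leP (u i x) 1) => h.
    by have := powR_ge0 (u i x) r; lra.
  have : u i x `^ 1 <= u i x `^ r by rewrite ler_powR // ltW.
  by rewrite powRr1 ?(ltW ux) //; lra.
rewrite (meanD mM) ?(mean_cst mM) //; last exact: cont_cst.
by rewrite lerD2l.
Qed.

Lemma volume_oscillation_cvg0 : M (fun x => `|u i x - M (u i)|) @[i --> \oo] --> (0 : R).
Proof.
apply: cvg0_approx => e e0; have P0 := power_bound_ge0.
have [K K1 KP] : exists2 K : R, expR (1 + P) <= K & P * K `^ (- (r - 1)) <= e / 2.
  by apply: powR_small; rewrite ?subr_gt0 ?divr_gt0 ?expR_gt0.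
exists (fun i => 2 * (1 + K) * M (fun x => `|w i x - M (w i)|)).
  by apply: cvg0Z; exact: log_oscillation_cvg0.
move=> i; have cu := u_cont (gK i); rewrite ger0_norm; last first.
  by apply: (mean_ge0 mM) => [|x _]; [exact: cont_dist|exact: normr_ge0].
have h : expR (M (w i)) <= K.
  apply: le_trans K1; rewrite ler_expR; apply: le_trans (mean_w_le (gK i)) _.
  exact: volume_mean_le.
apply: le_trans (volume_spread (gK i) r1 h) _; rewrite opprB in KP.
have k0 : 0 <= K `^ (1 - r) by exact: powR_ge0.
have : K `^ (1 - r) * M (fun x => u i x `^ r) <= P * K `^ (1 - r).
  by rewrite mulrC ler_wpM2r.
rewrite mulrDr mulrA; move: (M _) (2 * _ * M _) (P * _) KP => p q s; lra.
Qed.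

(** The two inequalities between [det ^ (1/n)] of the average metric and the
    average volume squeeze the ratio of the determinant and the volume, since
    the relative oscillation of the volume density tends to zero. *)
Lemma det_mean_cvg : detR (mean_mx B (g i)) - M (u i) @[i --> \oo] --> (0 : R).
Proof.
pose D i := detR (mean_mx B (g i)); pose c i := M (u i); pose a : R := n%:R^-1.
have D0 i : 0 < D i := posdef_det_gt0 (mean_posdef Bu (gK i)).
have c0 i : 0 < c i := lt_le_trans v0 (volume_bound i).
pose d i := M (fun x => `|u i x - c i|) / c i.
have m0 i : 0 <= M (fun x => `|u i x - c i|).
  by apply: (mean_ge0 mM) => [|x _]; [exact: cont_dist (u_cont (gK i))|exact: normr_ge0].
have d0 : d i @[i --> \oo] --> (0 : R).
  apply: (cvg0_le (a := fun i => v^-1 * M (fun x => `|u i x - c i|))).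
    by apply: cvg0Z; exact: volume_oscillation_cvg0.
  move=> i; rewrite ger0_norm ?divr_ge0 ?(ltW (c0 i)) // /d mulrC ler_wpM2r //.
  by rewrite lef_pV2 ?posrE //; exact: volume_bound.
pose y i := D i `^ a / c i `^ a.
have y1 i : 1 - d i <= y i.
  by rewrite ler_pdivlMr ?powR_gt0 //; exact: det_mean_ge.
have y2 i : (1 - d i) * y i <= 1.
  by rewrite mulrA ler_pdivrMr ?powR_gt0 // mul1r; exact: det_mean_le.
have ycvg : y i @[i --> \oo] --> (1 : R).
  have e1 : (1 - d i) @[i --> \oo] --> (1 : R).
    by have := cvgB (cvg_cst (1 : R)) d0; rewrite subr0; apply.
  have e2 : (1 - d i)^-1 @[i --> \oo] --> (1 : R).
    have := cvgV (oner_neq0 R) e1; rewrite invr1; apply.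
  apply: squeeze_cvgr e1 e2; near=> i; rewrite y1 /=.
  have di : 0 < 1 - d i.
    rewrite subr_gt0; apply: le_lt_trans (ler_norm _) _; near: i.
    by move/cvgr0Pnorm_lt: d0; apply.
  by rewrite -[leRHS]mul1r ler_pdivlMr // mulrC.
have yn i : D i = c i * y i ^+ n.
  have root x : 0 < x -> (x `^ a) ^+ n = x.
    move=> x0; rewrite -powR_mulrn ?powR_ge0 // -powRrM mulVf ?powRr1 ?(ltW x0) //.
    by rewrite pnatr_eq0 -lt0n.
  rewrite /y exprMn exprVn !root // mulrCA divff ?mulr1 //.
  by rewrite gt_eqF.
have ync : (1 + P) * (y i ^+ n - 1) @[i --> \oo] --> (0 : R).
  apply: cvg0Z; apply: (cvg_dist0 _ _).1.
  have := @cvg_comp _ _ _ y (fun t : R => t ^+ n) _ _ _ ycvg (@exprn_continuous R n 1).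
  by rewrite expr1n; apply.
apply: cvg0_approx => e e0; exists (fun i => `|(1 + P) * (y i ^+ n - 1)|).
  by have := cvg_norm ync; rewrite normr0; apply.
move=> i; rewrite -/(D i) -/(c i) yn -{2}[c i]mulr1 -mulrBr !normrM.
have cP : `|c i| <= `|1 + P|.
  by rewrite !ger0_norm ?(ltW (c0 i)) ?addr_ge0 ?power_bound_ge0 //; exact: volume_mean_le.
apply: le_trans (ler_wpM2r (normr_ge0 _) cP) _.
by rewrite lerDr ltW.
Unshelve. all: by end_near. Qed.

(** The average metrics are bounded by their traces, so a subsequence has a
    limit; its determinant is the limit of the volumes, hence positive, and the
    limit is a metric. *)
Lemma mean_mx_converges : exists (A : 'M[C]_n) (phi : nat -> nat),
  [/\ {homo phi : k l / (k < l)%N}, posdef A, cvg_mx (fun k => mean_mx B (g (phi k))) A &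
      M (fun x => `|u (phi k) x - detR A|) @[k --> \oo] --> (0 : R)].
Proof.
pose X i := mean_mx B (g i).
have Xp i : posdef (X i) := mean_posdef Bu (gK i).
pose a (s : 'I_n * 'I_n * bool) i := if s.2 then complex.Re (X i s.1.1 s.1.2) else complex.Im (X i s.1.1 s.1.2).
have [|phi ph [b hb]] := @bounded_subsequences R _ a (4 * T).
  move=> s i; apply: (@le_trans _ _ (cabs (X i s.1.1 s.1.2))).
    by rewrite /a; case: s.2; [exact: Re_le_cabs|exact: Im_le_cabs].
  apply: le_trans (posdef_entry_le _ _ (Xp i)) _.
  by rewrite ler_pM2l // (trace_mean (gK i)).
pose A : 'M[C]_n := \matrix_(j, k) (b (j, k, true) +i* b (j, k, false)).
have cA : cvg_mx (fun k => X (phi k)) A.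
  move=> j k; have h1 := (cvg_dist0 _ _).1 (hb (j, k, true)); have h2 := (cvg_dist0 _ _).1 (hb (j, k, false)).
  have h3 := cvg0D (cvg0_norm h1) (cvg0_norm h2).
  apply: (cvg0_le h3) => i; rewrite ger0_norm ?cabs_ge0 // /cabs Re_add Im_add Re_opp Im_opp [A j k]mxE.
  by [].
have phoo := homo_cvg_oo ph.
have cD : detR (X (phi k)) @[k --> \oo] --> detR A by apply: cvgC_Re; exact: cvg_mx_det.
have cc : M (u (phi k)) @[k --> \oo] --> detR A.
  have h := cvg_comp _ _ phoo det_mean_cvg.
  have : detR (X (phi k)) - (detR (X (phi k)) - M (u (phi k))) @[k --> \oo] --> detR A - 0 by exact: cvgB cD h.
  rewrite subr0; suff -> : (fun k => detR (X (phi k)) - (detR (X (phi k)) - M (u (phi k)))) = fun k => M (u (phi k)) by [].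
  by apply/funext => k; rewrite opprB addrCA subrr addr0.
have Asa : selfadjoint A.
  move=> j k; have E i : X i k j = conjc (X i j k) by have [h _] := Xp i; exact: h.
  apply: (cvgC_unique (cA k j)); have := cvgC_conj (cA j k).
  by congr (cvgC _ _); apply/funext => i; rewrite E.
have Ap : posdef A.
  apply: psd_posdef => // [x|].
    rewrite form_as_trace; apply: (cvg_lower (cvgC_Re (cvg_mx_trace _ cA))) => k.
    rewrite -form_as_trace; have [_ h] := Xp (phi k); have [->|x0] := eqVneq x 0.
      by rewrite !mul0mx mxE.
    by have := h x x0; rewrite ltcE => /andP[_ /ltW].
  apply: lt_le_trans v0 _; apply: (cvg_lower cc) => k; exact: volume_bound.
exists A, phi; split=> //.
have h1 := cvg_comp _ _ phoo volume_oscillation_cvg0.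
have h2 := cvg0_norm ((cvg_dist0 _ _).1 cc).
apply: (cvg0_le (cvg0D h1 h2)) => k /=; set c := M (u (phi k)).
have cu := u_cont (gK (phi k)).
rewrite ger0_norm; last by apply: (mean_ge0 mM) => [|x _]; [exact: cont_dist|exact: normr_ge0].
apply: (@le_trans _ _ (M (fun x => `|u (phi k) x - c| + `|c - detR A|))).
  apply: (mean_le mM); [exact: cont_dist|by apply: contD; [exact: cont_dist|exact: cont_cst]|].
  by move=> x _; rewrite -[u (phi k) x - detR A](subrKA c) ler_normD.
by rewrite (meanD mM) ?(mean_cst mM) //; [exact: cont_dist|exact: cont_cst].
Unshelve. all: by end_near. Qed.

End MetricSequence.

(** * Strong convergence of the metrics *)

Section StrongConvergence.
Variables (R : realType) (n : nat) (B : 'M[R]_(n + n)) (g : nat -> 'rV[R]_(n + n) -> 'M[R[i]]_n).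
Variable A : 'M[R[i]]_n.
Hypotheses (n0 : (0 < n)%N) (Bu : B \in unitmx) (gK : forall i, kahler B (g i)).
Local Notation pt := 'rV[R]_(n + n).
Local Notation C := R[i].
Local Notation M := (torus_mean B).
Local Notation u := (fun i => vol_density (g i)).
Let mM := mean_torus B.
Hypotheses (Ap : posdef A) (mean_cvg : cvg_mx (fun k => mean_mx B (g k)) A).
Hypothesis volume_cvg : M (fun x => `|u k x - detR A|) @[k --> \oo] --> (0 : R).

Local Notation x_ := (fun k x => u k x / detR A).

Lemma ratio_cont k : continuous (x_ k).
Proof. by apply: contM; [exact: u_cont (gK k)|exact: cont_cst]. Qed.

Lemma ratio_gt0 k x : 0 < x_ k x.
Proof. by rewrite divr_gt0 ?(u_gt0 (gK k)) // (posdef_det_gt0 Ap). Qed.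

Lemma ratio_cvg0 : M (fun x => `|x_ k x - 1|) @[k --> \oo] --> (0 : R).
Proof.
have D0 := posdef_det_gt0 Ap.
rewrite (_ : (fun k => _) = fun k => (detR A)^-1 * M (fun x => `|u k x - detR A|)).
  exact: cvg0Z.
apply/funext => k; rewrite -(meanZ mM); last exact: cont_dist (u_cont (gK k)).
congr (M _); apply/funext => x.
by rewrite -[X in _ = X * _]ger0_norm ?invr_ge0 ?(ltW D0) // -normrM mulrBr mulVf ?gt_eqF // mulrC.
Qed.

Lemma entry_cont i j k : continuous (fun x => cabs (g i x j k - A j k)).
Proof.
have [h1 h2] := g_cont (gK i) j k.
rewrite (_ : (fun x => _) = fun x : pt => `|complex.Re (g i x j k) - complex.Re (A j k)| +
   `|complex.Im (g i x j k) - complex.Im (A j k)|).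
  by apply: contD; apply: cont_dist.
by apply/funext => x; rewrite /cabs Re_add Im_add Re_opp Im_opp.
Qed.

(** Relative to [A], the trace of the metric is linear, so its mean is known from
    the average metric, and the determinant is close to [1] in L^1.  The mean
    deficit in the arithmetic-geometric inequality therefore tends to zero, and
    [metric_deviation] applies. *)
Lemma metric_cvg j k : M (fun x => cabs (g i x j k - A j k)) @[i --> \oo] --> (0 : R).
Proof.
have D0 := posdef_det_gt0 Ap; have [c c0 dev] := metric_deviation n0 Ap.
pose a : R := n%:R^-1.
pose tau i x := complex.Re (\tr (invmx A *m g i x)).
pose G i (x : pt) := (x_ i x) `^ a.
have ctau i : continuous (tau i) by exact: (form_cont (gK i)).
have cG i : continuous (G i) by apply: cont_powR; [exact: ratio_cont|exact: ratio_gt0].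
have tauM : M (tau i) - n%:R @[i --> \oo] --> (0 : R).
  apply: (cvg_dist0 _ _).1; have := cvgC_Re (cvg_mx_trace (invmx A) mean_cvg).
  rewrite mulVmx ?(posdef_unit Ap) // mxtrace1 -(rmorph_nat (@real_complex_def R (Phant R))) /=.
  suff -> : (fun i => complex.Re (\tr (invmx A *m mean_mx B (g i)))) = fun i => M (tau i) by [].
  by apply/funext => i; rewrite (mean_linear (gK i)).
pose d i := M (fun x => `|x_ i x - 1|).
have GM i : M (fun x => `|G i x - 1|) <= d i.
  apply: (mean_le mM); [exact: cont_dist|apply: cont_dist; exact: ratio_cont|].
  by move=> x _; apply: powR_near1; [exact: ratio_gt0|exact: inv_n_itv].
have GM1 i : `|M (G i) - 1| <= d i.
  apply: le_trans (GM i); have := mean_abs mM (contB (cG i) (@cont_cst R _ 1)).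
  by rewrite (meanB mM) ?(mean_cst mM) //; exact: cont_cst.
apply: cvg0_approx => e e0.
pose N : R := n%:R; have N0 : 0 < N by rewrite ltr0n.
(* This choice of [K] bounds the last term of the deviation by [e]. *)
pose K := c * 16 * N ^+ 2 / e + 1.
have K0 : 0 < K by rewrite addr_gt0 // divr_gt0 // !mulr_gt0 ?exprn_gt0.
have Ke : c * (4 * N * (4 / K * N)) <= e.
  have -> : c * (4 * N * (4 / K * N)) = (c * 16 * N ^+ 2) / K by field; rewrite gt_eqF.
  rewrite ler_pdivrMr //; have -> : e * K = c * 16 * N ^+ 2 + e by rewrite /K; field; rewrite gt_eqF.
  by rewrite lerDl ltW.
exists (fun i => c * (4 * N * (K * (`|M (tau i) - N| + N * d i) + 4 / K * `|M (tau i) - N|) + d i)).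
  apply: cvg0Z; apply: cvg0D; last exact: ratio_cvg0.
  apply: cvg0Z; apply: cvg0D; apply: cvg0Z; last exact: cvg0_norm.
  by apply: cvg0D; [exact: cvg0_norm|apply: cvg0Z; exact: ratio_cvg0].
move=> i; rewrite ger0_norm; last first.
  by apply: (mean_ge0 mM) => [|x _]; [exact: entry_cont|exact: cabs_ge0].
pose E x := c * (4 * N * (K * (tau i x - N * G i x) + 4 / K * tau i x) + `|G i x - 1|).
have c1 : continuous (fun x => tau i x - N * G i x) by apply: contB => //; exact: contZ.
have c2 : continuous (fun x => K * (tau i x - N * G i x) + 4 / K * tau i x).
  by apply: contD; exact: contZ.
have c3 : continuous (fun x => `|G i x - 1|) by exact: cont_dist.
have cE : continuous E by apply: contZ; apply: contD => //; exact: contZ.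
apply: (@le_trans _ _ (M E)).
  by apply: (mean_le mM) => [||x _]; [exact: entry_cont|exact: cE|exact: dev (kahler_posdef (gK i) x) K0].
rewrite /E (meanZ mM); last by apply: contD => //; exact: contZ.
rewrite (meanD mM) //; last exact: contZ.
rewrite (meanZ mM) // (meanD mM) ?(meanZ mM) //; [|exact: contZ..].
rewrite (meanB mM) ?(meanZ mM) //; last exact: contZ.
apply: le_trans (lerD Ke (lexx _)); rewrite -mulrDr ler_pM2l //.
have hs := ler_norm (M (tau i) - N); have hG := ler_norm (1 - M (G i)); have h1 := GM1 i; rewrite distrC in h1.
have hg := GM i; move: hs hG h1 hg.
move: (M (tau i)) (M (G i)) (M (fun x => `|G i x - 1|)) (d i) => t y z dd.
move: (`|t - N|) (`|1 - y|) => s yy hs hG h1 hg.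
have Kinv : 0 < 4 / K by rewrite divr_gt0.
rewrite addrA; apply: lerD => //; rewrite -mulrDr ler_pM2l ?mulr_gt0 //.
have k1 : K * (t - N * y) <= K * (s + N * dd).
  rewrite ler_pM2l //; have : N * (1 - y) <= N * dd by rewrite ler_pM2l //; lra.
  by lra.
have k2 : 4 / K * t <= 4 / K * (N + s) by rewrite ler_pM2l //; lra.
rewrite mulrDr in k2; lra.
Qed.

Definition metric_gap i x : R := \sum_j \sum_k cabs (g i x j k - A j k).

Lemma metric_gap_cont i : continuous (metric_gap i).
Proof. by apply: cont_sum => j _; apply: cont_sum => k _; exact: entry_cont. Qed.

Lemma metric_gap_ge0 i x : 0 <= metric_gap i x.
Proof. by apply: sumr_ge0 => j _; apply: sumr_ge0 => k _; exact: cabs_ge0. Qed.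

Lemma metric_gap_periodic i : lattice_periodic B (metric_gap i).
Proof. by move=> x l ll; rewrite /metric_gap (kahler_periodic (gK i) x ll). Qed.

Lemma metric_gap_cvg0 : M (metric_gap i) @[i --> \oo] --> (0 : R).
Proof.
rewrite (_ : (fun i => _) = fun i => \sum_j \sum_k M (fun x => cabs (g i x j k - A j k))).
  by apply: cvg0_sum => j; apply: cvg0_sum => k; exact: metric_cvg.
apply/funext => i; rewrite (mean_sum mM) => [|j _].
  by apply: eq_bigr => j _; rewrite (mean_sum mM) // => k _; exact: entry_cont.
by apply: cont_sum => k _; exact: entry_cont.
Qed.

Variables (P r : R).
Hypothesis power_bound : forall k, M (fun x => u k x `^ r) <= P.

(** Interpolation between L^1 and L^r. *)
Lemma ratio_power_cvg0 (s : R) : 0 < s -> s < r ->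
  M (fun x => `|x_ k x - 1| `^ s) @[k --> \oo] --> (0 : R).
Proof.
move=> s0 sr; have r0 : 0 < r by exact: lt_trans sr.
have D0 := posdef_det_gt0 Ap.
pose P' := 1 + P / detR A `^ r.
have cu k := upow_cont (gK k) (r := r).
have cd k : continuous (fun x => `|x_ k x - 1|) by apply: cont_dist; exact: ratio_cont.
have cb k : continuous (fun x => x_ k x - 1) by apply: contB; [exact: ratio_cont|exact: cont_cst].
have cs k : continuous (fun x => `|x_ k x - 1| `^ s) by exact: cont_norm_powR.
have cr k : continuous (fun x => `|x_ k x - 1| `^ r) by exact: cont_norm_powR.
have bound k : M (fun x => `|x_ k x - 1| `^ r) <= P'.
  apply: (@le_trans _ _ (M (fun x => 1 + (detR A `^ r)^-1 * u k x `^ r))).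
    apply: (mean_le mM) => //; first by apply: contD; [exact: cont_cst|exact: contZ].
    move=> x _; apply: le_trans (powR_sub1_le (ltW (ratio_gt0 k x)) (ltW r0)) _.
    by rewrite lerD2l (powR_div _ (u_gt0 (gK k) x) D0) mulrC.
  rewrite (meanD mM) ?(mean_cst mM) ?(meanZ mM) //; [|exact: cont_cst|exact: contZ].
  by rewrite lerD2l mulrC ler_pM2r ?invr_gt0 ?powR_gt0.
have P0 : 0 <= P'.
  by apply: le_trans (bound 0); apply: (mean_ge0 mM) => // x _; exact: powR_ge0.
apply: cvg0_approx => e e0; have e2 : 0 < e / 2 by rewrite divr_gt0.
have [K K1 KP] : exists2 K : R, 1 <= K & P' * K `^ (- (r - s)) <= e / 2.
  by apply: powR_small; rewrite ?subr_gt0.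
have K0 : 0 < K by exact: lt_le_trans K1.
exists (fun k => K `^ s / (e / 2) `^ s^-1 * M (fun x => `|x_ k x - 1|)).
  by apply: cvg0Z; exact: ratio_cvg0.
move=> k; rewrite ger0_norm; last by apply: (mean_ge0 mM) => // x _; exact: powR_ge0.
set b := K `^ s / _.
have h : M (fun x => `|x_ k x - 1| `^ s) <=
    M (fun x => e / 2 + b * `|x_ k x - 1| + K `^ (s - r) * `|x_ k x - 1| `^ r).
  apply: (mean_le mM) => //.
    by apply: contD; [apply: contD; [exact: cont_cst|exact: contZ]|exact: contZ].
  by move=> x _; apply: powR_interpolation.
apply: le_trans h _.
rewrite (meanD mM); [|by apply: contD; [exact: cont_cst|exact: contZ]|exact: contZ].
rewrite (meanD mM) ?(mean_cst mM) ?(meanZ mM) //; [|exact: cont_cst|exact: contZ].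
rewrite opprB in KP.
have : K `^ (s - r) * M (fun x => `|x_ k x - 1| `^ r) <= P' * K `^ (s - r).
  by rewrite mulrC ler_wpM2r ?powR_ge0.
move: (P' * _) (K `^ _ * _) (b * _) KP => p1 p2 p3; lra.
Qed.

End StrongConvergence.

(** * The flat limit: currents, densities and volumes *)

Section FlatMetric.
Variables (R : realType) (n : nat) (B : 'M[R]_(n + n)) (A : 'M[R[i]]_n).
Local Notation pt := 'rV[R]_(n + n).
Local Notation C := R[i].
Hypothesis Ap : posdef A.

Lemma kahler_constant : kahler B (fun _ : pt => A).
Proof.
have [Ah Apos] := Ap; split=> //.
- by move=> j k; split=> m; exact: Ck_cst.
- move=> x; rewrite /ext_d /del /delbar !big1 ?addr0 // => j _.
    rewrite (_ : [ffun S => _] = 0) ?wedgef0r //.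
    by apply/ffunP => S; rewrite !ffunE (der_cst (derivation_dzbar R j)).
  rewrite (_ : [ffun S => _] = 0) ?wedgef0r //.
  by apply/ffunP => S; rewrite !ffunE (der_cst (derivation_dz R j)).
Qed.

Lemma partial_constant m (a : 'I_m) (c : R) x : partial a (fun _ => c) x = 0.
Proof. by have [_ ->] := is_derive_partial (is_derive_cstf c a x). Qed.

Lemma flat_constant : flat (kahler_form (fun _ : pt => A)).
Proof.
have ch c a b : christoffel (kahler_form (fun _ : pt => A)) c a b = fun=> 0.
  apply/funext => x; rewrite /christoffel big1 ?mulr0 // => d _.
  have E e i j : partial e (fun y : pt => gram (kahler_form (fun=> A) y) i j) x = 0.
    exact: (partial_constant e (gram (form11 A) i j)).
  by rewrite !E addr0 subrr mulr0.
move=> d c a b x; rewrite /curvature !ch !partial_constant subrr add0r.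
by apply: big1 => e _; rewrite !ch !mulr0 subrr.
Qed.

End FlatMetric.

Section Convergence.
Variables (R : realType) (n : nat) (B : 'M[R]_(n + n)) (g : nat -> 'rV[R]_(n + n) -> 'M[R[i]]_n).
Variable A : 'M[R[i]]_n.
Hypotheses (n0 : (0 < n)%N) (Bu : B \in unitmx) (gK : forall i, kahler B (g i)).
Local Notation pt := 'rV[R]_(n + n).
Local Notation C := R[i].
Local Notation M := (torus_mean B).
Local Notation u := (fun i => vol_density (g i)).
Let mM := mean_torus B.
Hypotheses (Ap : posdef A) (mean_cvg : cvg_mx (fun k => mean_mx B (g k)) A).
Hypothesis volume_cvg : M (fun x => `|u k x - detR A|) @[k --> \oo] --> (0 : R).

Local Notation ginf := (fun _ : pt => A).

Lemma torus_integral_cvg (f : nat -> pt -> R) (h : pt -> R) (d : nat -> pt -> R) (c : R) :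
  (forall k, continuous (f k)) -> continuous h -> (forall k, continuous (d k)) ->
  (forall k x, `|f k x - h x| <= c * d k x) -> M (d k) @[k --> \oo] --> (0 : R) ->
  torus_integral B (f k) @[k --> \oo] --> torus_integral B h.
Proof.
move=> cf ch cd fh d0; apply: (cvg_dist0 _ _).2.
apply: (cvg0_le (a := fun k => `|\det B| * (c * M (d k)))).
  by apply: cvg0Z; exact: cvg0Z.
move=> k; rewrite !torus_integralE -mulrBr normrM normr_id ler_wpM2l // -(meanB mM) //.
apply: le_trans (mean_abs mM (contB (cf k) ch)) _; rewrite -(meanZ mM) //.
apply: (mean_le mM) => [||x _]; [|by apply: contM => //; exact: cont_cst|exact: fh].
by apply: cont_norm; exact: contB.
Qed.

Lemma volume_weak_cvg : cvg_volume_weak B (fun k => kahler_form (g k)) (kahler_form ginf).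
Proof.
move=> f pf cf; have [c c0 fc] := periodic_bounded Bu cf pf.
rewrite /riem_integral.
have E k x : f x * riem_density (kahler_form (g k) x) = f x * (2 ^+ n * u k x).
  by rewrite riem_density_form11 //; exact: kahler_posdef (gK k) x.
apply: (@torus_integral_cvg (fun k x => f x * riem_density (kahler_form (g k) x)) _
  (fun k x => `|u k x - detR A|) (c * 2 ^+ n)) => //.
- move=> k; rewrite (funext (E k)); apply: contM => //; apply: contZ; exact: u_cont (gK k).
- by apply: contM => //; exact: (@cont_cst R _ (riem_density (form11 A))).
- by move=> k; apply: cont_dist; exact: u_cont (gK k).
- move=> k x; rewrite E riem_density_form11 // -mulrBr -mulrBr !normrM.
  rewrite [`|2 ^+ n|]ger0_norm ?exprn_ge0 // mulrA.
  by rewrite ler_wpM2r // ler_wpM2r ?exprn_ge0.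
Qed.

Lemma powR_cvg0 (a : nat -> R) (s : R) : 0 < s -> (forall k, 0 <= a k) ->
  a k @[k --> \oo] --> (0 : R) -> a k `^ s @[k --> \oo] --> (0 : R).
Proof.
move=> s0 ap a0; apply/cvgr0Pnorm_lt => e e0.
have e1 : 0 < e `^ s^-1 by rewrite powR_gt0.
have h : \forall k \near \oo, `|a k| < e `^ s^-1 by move/cvgr0Pnorm_lt: a0; apply.
near=> k; rewrite ger0_norm ?powR_ge0 //; apply: powR_lt_of_lt => //.
by apply: le_lt_trans (ler_norm _) _; near: k.
Unshelve. all: by end_near. Qed.

Lemma density_ratio_cvg (P r s : R) : (forall k, M (fun x => u k x `^ r) <= P) -> 0 < s -> s < r ->
  Lnorm_torus B (kahler_form ginf) s%:E
    (fun x => form_ratio (wedge_pow (kahler_form (g k) x) n) (wedge_pow (kahler_form ginf x) n) - 1)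
    @[k --> \oo] --> 0%E.
Proof.
move=> power_bound s0 sr; apply: cvg_EFin; first exact: nearW.
have E k : measure_integral B (kahler_form ginf)
    (fun x => `|form_ratio (wedge_pow (kahler_form (g k) x) n) (wedge_pow (kahler_form ginf x) n) - 1| `^ s)
  = `|\det B| * (2 ^+ n * n`!%:R * detR A) * M (fun x => `|u k x / detR A - 1| `^ s).
  have cr : continuous (fun x => `|u k x / detR A - 1| `^ s).
    by apply: cont_norm_powR => //; apply: contB; [exact: (ratio_cont gK)|exact: cont_cst].
  rewrite /measure_integral torus_integralE -mulrA -(meanZ mM (2 ^+ n * n`!%:R * detR A) cr).
  congr (_ * M _); apply/funext => x; rewrite mulrC posdef_density //.
  by rewrite posdef_ratio //; exact: kahler_posdef (gK k) x.
rewrite (_ : (fine \o _) = fun k => (`|\det B| * (2 ^+ n * n`!%:R * detR A) *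
    M (fun x => `|u k x / detR A - 1| `^ s)) `^ s^-1); last by apply/funext => k; rewrite -E.
apply: powR_cvg0; first by rewrite invr_gt0.
  move=> k; rewrite mulr_ge0 //.
    by rewrite !mulr_ge0 ?exprn_ge0 ?ler0n ?(ltW (posdef_det_gt0 Ap)).
  apply: (mean_ge0 mM) => [|x _]; last exact: powR_ge0.
  by apply: cont_norm_powR => //; apply: contB; [exact: ratio_cont|exact: cont_cst].
by apply: cvg0Z; exact: (ratio_power_cvg0 gK Ap volume_cvg power_bound).
Qed.

Lemma wedge_form11_density (eta : ext_form R n) (h : 'M[C]_n) :
  density (wedgef eta (form11 h)) =
  \sum_j \sum_k density (wedgef eta ('i *: wedgef (dz R j) (dzbar R k))) * h j k.
Proof.
have dens0 : density (0 : ext_form R n) = 0 by rewrite /density ffunE mulr0.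
have densD (a b : ext_form R n) : density (a + b) = density a + density b.
  by rewrite /density ffunE mulrDr.
have densS (J : finType) (F : J -> ext_form R n) : density (\sum_j F j) = \sum_j density (F j).
  by elim/big_rec2: _ => // j a b _ <-.
rewrite /form11 wedgef_sumr densS; apply: eq_bigr => j _.
rewrite wedgef_sumr densS; apply: eq_bigr => k _.
rewrite mulrC -scalerA !wedgefZr; move: (wedgef eta _) => p.
by rewrite /density !ffunE /GRing.scale /=; ring.
Qed.

Lemma wedge_cont (eta : pt -> ext_form R n) (b : ext_form R n) S :
  smooth_form eta -> contC (fun x => wedgef (eta x) b S).
Proof.
move=> se; rewrite (_ : (fun x => _) = fun x => \sum_(D : {set 'I_(n + n)})
    (if D \subset S then (-1) ^+ inversions D (S :\: D) * (eta x D * b (S :\: D)%SET) else 0)); last first.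
  by apply/funext => x; rewrite ffunE big_mkcond.
apply: contC_sum => D; case: (boolP (D \subset S)) => _; last exact: CkC_contC (@CkC_cst R n 0 0).
apply: contC_mul; first exact: CkC_contC (@CkC_cst R n 0 _).
apply: contC_mul; last exact: CkC_contC (@CkC_cst R n 0 _).
by have [h1 h2] := se D; split; [exact: Ck_cont (h1 0)|exact: Ck_cont (h2 0)].
Qed.

(** The integrand is linear in the entries of the metric, with bounded
    coefficients. *)
Lemma currents_cvg : cvg_currents B (fun k => kahler_form (g k)) (kahler_form ginf).
Proof.
move=> eta pe se _.
pose F j k x := density (wedgef (eta x) ('i *: wedgef (dz R j) (dzbar R k))).
have cF j k : contC (F j k).
  by apply: contC_mul; [exact: CkC_contC (@CkC_cst R n 0 _)|exact: wedge_cont].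
have pF j k : lattice_periodic B (F j k) by move=> x v lv; rewrite /F pe.
have [c c0 Fc] : exists2 c : R, 0 < c & forall j k x, cabs (F j k x) <= c.
  have bd j k : exists c : R, 0 < c /\ forall x, cabs (F j k x) <= c.
    have [c1 c2] := cF j k.
    have [|c10 p10 h1] := periodic_bounded Bu c1; first by move=> x v lv; rewrite pF.
    have [|c20 p20 h2] := periodic_bounded Bu c2; first by move=> x v lv; rewrite pF.
    by exists (c10 + c20); split; [exact: addr_gt0|move=> x; exact: lerD].
  have /choice[b1 hb1] : forall jk : 'I_n * 'I_n, exists c : R, 0 < c /\ forall x, cabs (F jk.1 jk.2 x) <= c.
    by move=> [j k]; exact: bd.
  exists (1 + \sum_jk b1 jk).
    by rewrite ltr_pwDl // sumr_ge0 // => jk _; case: (hb1 jk) => /ltW.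
  move=> j k x; have [p h] := hb1 (j, k); apply: le_trans (h x) _.
  rewrite (bigD1 (j, k)) //= addrCA lerDl addr_ge0 // sumr_ge0 // => jk _.
  by case: (hb1 jk) => /ltW.
pose W (h : pt -> 'M[C]_n) x := \sum_j \sum_k F j k x * h x j k.
have WE h x : density (wedgef (eta x) (kahler_form h x)) = W h x by exact: wedge_form11_density.
pose d := metric_gap g A.
have cd i : continuous (d i) by exact: (metric_gap_cont gK).
have d0 : M (d i) @[i --> \oo] --> (0 : R) := metric_gap_cvg0 n0 gK Ap mean_cvg volume_cvg.
have diff i x : cabs (W (g i) x - W ginf x) <= c * d i x.
  have -> : W (g i) x - W ginf x = \sum_j \sum_k F j k x * (g i x j k - A j k).
    rewrite -sumrB; apply: eq_bigr => j _; rewrite -sumrB; apply: eq_bigr => k _.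
    by rewrite mulrBr.
  rewrite mulr_sumr; apply: le_trans (cabs_sum _ _ _) _; apply: ler_sum => j _.
  rewrite mulr_sumr; apply: le_trans (cabs_sum _ _ _) _; apply: ler_sum => k _.
  apply: le_trans (cabsM _ _) _; rewrite ler_wpM2r ?cabs_ge0 //.
have cW i : contC (W (g i)).
  apply: contC_sum => j; apply: contC_sum => k; by apply: contC_mul; [exact: cF|exact: (g_cont (gK i) j k)].
have cWinf : contC (W ginf).
  apply: contC_sum => j; apply: contC_sum => k; by apply: contC_mul; [exact: cF|exact: CkC_contC (@CkC_cst R n 0 _)].
have fE : (fun i => form_integral B (fun x => wedgef (eta x) (kahler_form (g i) x))) = fun i =>
    torus_integral B (fun x => complex.Re (W (g i) x)) +i* torus_integral B (fun x => complex.Im (W (g i) x)).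
  by apply/funext => i; rewrite /form_integral; congr (_ +i* _); congr (torus_integral B _);
     apply/funext => x; rewrite WE.
have fEinf : form_integral B (fun x => wedgef (eta x) (kahler_form ginf x)) =
    torus_integral B (fun x => complex.Re (W ginf x)) +i* torus_integral B (fun x => complex.Im (W ginf x)).
  by rewrite /form_integral; congr (_ +i* _); congr (torus_integral B _);
     apply/funext => x; rewrite WE.
rewrite fEinf; split.
  rewrite (_ : (fun k => _) = fun k => torus_integral B (fun x => complex.Re (W (g k) x))); last first.
    by apply/funext => k; rewrite (congr1 (fun f => f k) fE).
  apply: (@torus_integral_cvg (fun k x => complex.Re (W (g k) x)) (fun x => complex.Re (W ginf x)) d c) => //.
  - by move=> k; case: (cW k).
  - by case: cWinf.
  - by move=> k x; apply: le_trans (diff k x); rewrite -Re_opp -Re_add; exact: Re_le_cabs.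
rewrite (_ : (fun k => _) = fun k => torus_integral B (fun x => complex.Im (W (g k) x))); last first.
  by apply/funext => k; rewrite (congr1 (fun f => f k) fE).
apply: (@torus_integral_cvg (fun k x => complex.Im (W (g k) x)) (fun x => complex.Im (W ginf x)) d c) => //.
- by move=> k; case: (cW k).
- by case: cWinf.
- by move=> k x; apply: le_trans (diff k x); rewrite -Im_opp -Im_add; exact: Im_le_cabs.
Qed.

End Convergence.

(** * Curves and their lengths *)

Section Curves.
Variables (R : realType) (n : nat) (B : 'M[R]_(n + n)).
Local Notation pt := 'rV[R]_(n + n).
Implicit Types (c : R -> pt) (cs : seq (R -> pt)).

Lemma lattice0 : lattice B 0.
Proof.
exists 0; suff -> : map_mx intr (0 : 'rV[int]_(n + n)) = 0 :> pt by rewrite mul0mx.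
by apply/rowP => j; rewrite !mxE.
Qed.

Lemma latticeD v w : lattice B v -> lattice B w -> lattice B (v + w).
Proof.
move=> [k ->] [l ->]; exists (k + l); rewrite -mulmxDl; congr (_ *m _).
by apply/rowP => j; rewrite !mxE intrD.
Qed.

Lemma joins_shift_start x y cs z : lattice B (y - x) -> joins B y cs z -> joins B x cs z.
Proof.
case: cs => [|c cs] /= xy; first by move=> yz; rewrite -(subrKA y); exact: latticeD.
by move=> [cC cy cz]; split=> //; rewrite -(subrKA y); exact: latticeD.
Qed.

Lemma joins_cat x cs y ds z : joins B x cs y -> joins B y ds z -> joins B x (cs ++ ds) z.
Proof.
elim: cs x => [|c cs IH] x /=; first by move=> xy; exact: joins_shift_start.
by move=> [cC cx cy] yz; split=> //; exact: IH.
Qed.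

Lemma segment_derive (a z : pt) (t : R) : is_derive t 1 (fun t => a + t *: z) z.
Proof.
have h : (fun h : R => h^-1 *: (((fun t => a + t *: z) \o shift t) (h *: 1) - (a + t *: z))) @ 0^' --> z.
  apply: cvg_near_cst; near=> h => /=.
  have h0 : h != 0 by near: h; exact: nbhs_dnbhs_neq.
  rewrite scalerDl opprD addrACA subrr add0r addrK [h *: 1]mulr1 scalerA mulVf // scale1r //.
by apply: DeriveDef; [apply/cvg_ex; exists z|exact/cvg_lim].
Unshelve. all: by end_near. Qed.

Lemma segment_derive1 (a z : pt) : derive1 (fun t => a + t *: z) = fun=> z.
Proof. by apply/funext => t; rewrite derive1E; have [_ ->] := segment_derive a z t. Qed.

Lemma segment_C1 (a z : pt) : C1_curve (fun t => a + t *: z).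
Proof.
split=> [t|]; first by have [] := segment_derive a z t.
by rewrite segment_derive1; exact: cont_const.
Qed.

Lemma translate_derive1 c z : derive1 (fun t => c t + z) = derive1 c.
Proof.
apply/funext => t.
have E : (fun h : R => h^-1 *: (c (h + t) + z - (c t + z))) = (fun h : R => h^-1 *: (c (h + t) - c t)).
  by apply/funext => h; rewrite opprD addrACA subrr addr0.
by rewrite /derive1 E.
Qed.

Lemma translate_C1 c z : C1_curve c -> C1_curve (fun t => c t + z).
Proof.
move=> [cd cc]; split; last by rewrite translate_derive1.
move=> t; have := cd t; rewrite /derivable.
have E : (fun h : R => h^-1 *: (((fun t0 : R => c t0 + z) \o shift t) (h *: (1 : R)) - (c t + z))) =
    (fun h : R => h^-1 *: ((c \o shift t) (h *: (1 : R)) - c t)).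
  by apply/funext => h /=; rewrite opprD addrACA subrr addr0.
by rewrite E.
Qed.

Lemma C1_cont c : C1_curve c -> continuous c.
Proof.
by move=> [cd _] t; apply: (@differentiable_continuous _ _ _ t c); apply/derivable1_diffP; exact: cd.
Qed.

Lemma joins_translate x cs y z : joins B x cs y ->
  joins B (x + z) [seq (fun t => c t + z) | c <- cs] (y + z).
Proof.
elim: cs x => [|c cs IH] x /=; first by rewrite opprD addrACA subrr addr0.
move=> [cC cx cy]; split; [exact: translate_C1| |exact: IH].
by rewrite opprD addrACA subrr addr0.
Qed.

(** Two straight segments keep the endpoints fixed while the curves are moved. *)
Definition moved_chain x cs y z : seq (R -> pt) :=
  (fun t => x + t *: z) :: [seq (fun t => c t + z) | c <- cs] ++ [:: (fun t => (y + z) + t *: - z)].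

Lemma moved_chain_joins x cs y z : joins B x cs y -> joins B x (moved_chain x cs y z) y.
Proof.
move=> h; rewrite /moved_chain -cat1s; apply: (@joins_cat _ _ (x + z)).
  split; [exact: segment_C1|by rewrite scale0r addr0 subrr; exact: lattice0|].
  by rewrite /= scale1r subrr; exact: lattice0.
apply: joins_cat (joins_translate z h) _; split; first exact: segment_C1.
  by rewrite scale0r addr0 subrr; exact: lattice0.
by rewrite /= scale1r addrK subrr; exact: lattice0.
Qed.

End Curves.

Section Length.
Variables (R : realType) (n : nat).
Local Notation pt := 'rV[R]_(n + n).
Local Notation C := R[i].
Implicit Types (h A : 'M[C]_n).

(** A norm on tangent vectors adapted to entrywise bounds on metrics. *)
Definition speed_bound (v : pt) : R := \sum_j cabs (zcoord v 0 j).

Lemma speed_bound_ge0 v : 0 <= speed_bound v.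
Proof. by apply: sumr_ge0 => j _; exact: cabs_ge0. Qed.

Lemma form_cabs_le h (v : pt) :
  `|2 * complex.Re (\sum_j \sum_k h j k * (zcoord v 0 j * conjc (zcoord v 0 k)))| <=
  2 * (\sum_j \sum_k cabs (h j k)) * speed_bound v ^+ 2.
Proof.
rewrite normrM [`|2|]ger0_norm // -mulrA ler_pM2l //.
apply: le_trans (Re_le_cabs _) _; apply: le_trans (cabs_sum _ _ _) _.
rewrite mulr_suml; apply: ler_sum => j _; apply: le_trans (cabs_sum _ _ _) _.
rewrite mulr_suml; apply: ler_sum => k _; apply: le_trans (cabsM _ _) _.
rewrite ler_wpM2l ?cabs_ge0 //; apply: le_trans (cabsM _ _) _; rewrite cabs_conj expr2.
have le i : cabs (zcoord v 0 i) <= speed_bound v.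
  rewrite /speed_bound (bigD1 i) //= lerDl; apply: sumr_ge0 => l _; exact: cabs_ge0.
by apply: ler_pM; rewrite ?cabs_ge0.
Qed.

Lemma riem_dist_le h A v : selfadjoint h -> selfadjoint A ->
  `|riem (form11 h) v v - riem (form11 A) v v| <=
  2 * (\sum_j \sum_k cabs (h j k - A j k)) * speed_bound v ^+ 2.
Proof.
move=> hh hA; rewrite !riem_form11 // -mulrBr -Re_opp -Re_add -sumrB.
apply: le_trans (le_trans _ (form_cabs_le (h - A) v)) _.
  rewrite le_eqVlt; apply/orP; left; apply/eqP; congr (`|2 * complex.Re _|).
  apply: eq_bigr => j _; rewrite -sumrB; apply: eq_bigr => k _.
  by rewrite !mxE mulrBl.
rewrite le_eqVlt; apply/orP; left; apply/eqP; congr (2 * _ * _).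
by apply: eq_bigr => j _; apply: eq_bigr => k _; rewrite !mxE.
Qed.

Lemma riem_trace_le h v : posdef h ->
  riem (form11 h) v v <= 8 * n%:R ^+ 2 * trR h * speed_bound v ^+ 2.
Proof.
move=> hp; have [hh _] := hp; rewrite riem_form11 //.
apply: le_trans (ler_norm _) _; apply: le_trans (form_cabs_le _ _) _.
rewrite ler_wpM2r ?sqr_ge0 //.
have : \sum_j \sum_k cabs (h j k) <= \sum_(j < n) \sum_(k < n) 4 * trR h.
  by apply: ler_sum => j _; apply: ler_sum => k _; exact: posdef_entry_le.
rewrite !sumr_const !card_ord -mulrnA -[_ *+ (n * n)]mulr_natr natrM.
by move: (\sum_j _) (trR h) (n%:R) => s t m; nra.
Qed.

Lemma riem_cont (T : topologicalType) (h : T -> 'M[C]_n) (v : T -> pt) :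
  (forall t, selfadjoint (h t)) ->
  (forall j k, continuous (fun t => complex.Re (h t j k))) ->
  (forall j k, continuous (fun t => complex.Im (h t j k))) -> continuous v ->
  continuous (fun t => riem (form11 (h t)) (v t) (v t)).
Proof.
move=> hh hr hi cv.
have cvj a : continuous (fun t => v t 0 a) by exact: cont_entry.
rewrite (_ : (fun t => _) = fun t => 2 * \sum_j \sum_k
  (complex.Re (h t j k) * (v t 0 (lshift n j) * v t 0 (lshift n k) + v t 0 (rshift n j) * v t 0 (rshift n k))
  - complex.Im (h t j k) * (v t 0 (rshift n j) * v t 0 (lshift n k) - v t 0 (lshift n j) * v t 0 (rshift n k)))).
  apply: contM; first exact: cont_cst.
  apply: cont_sum => j _; apply: cont_sum => k _; apply: contB; apply: contM => //.
    by apply: contD; apply: contM.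
  by apply: contB; apply: contM.
apply/funext => t; rewrite riem_form11 //; congr (2 * _); rewrite Re_sum; apply: eq_bigr => j _.
rewrite Re_sum; apply: eq_bigr => k _; rewrite Re_mul Re_mul Im_mul !mxE /=.
by rewrite !mulrN opprK [X in _ * X - _]addrC mulrC; ring.
Qed.

Lemma cont_sqrt (T : topologicalType) (f : T -> R) : continuous f -> continuous (fun t => Num.sqrt (f t)).
Proof.
by move=> cf t; apply: (@continuous_comp _ _ _ f (@Num.sqrt R)); [exact: cf|exact: sqrt_continuous].
Qed.

(** [sqrt a - sqrt b <= sqrt |a - b|], and Young's inequality with weight [lam]. *)
Lemma sqrt_perturb (a b lam : R) : 0 <= a -> 0 <= b -> 0 < lam ->
  Num.sqrt a <= Num.sqrt b + (2 * lam)^-1 + lam / 2 * `|a - b|.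
Proof.
move=> a0 b0 lam0; set s := Num.sqrt a; set t := Num.sqrt b; set d := `|a - b|.
have as2 : a = s ^+ 2 by rewrite sqr_sqrtr.
have bs2 : b = t ^+ 2 by rewrite sqr_sqrtr.
have s0 : 0 <= s := sqrtr_ge0 _; have t0 : 0 <= t := sqrtr_ge0 _.
have d1 : s ^+ 2 - t ^+ 2 <= d by rewrite -as2 -bs2; exact: ler_norm.
have d0 : 0 <= d := normr_ge0 _.
case: (leP s t) => st.
  by rewrite -addrA (le_trans st) // lerDl addr_ge0 // ?mulr_ge0 ?invr_ge0 ?mulr_ge0 // ltW.
have h : (s - t) ^+ 2 <= d by nra.
have E : (2 * lam)^-1 + lam / 2 * (s - t) ^+ 2 - (s - t) = lam / 2 * (s - t - lam^-1) ^+ 2.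
  by field; rewrite gt_eqF.
have p : 0 <= lam / 2 * (s - t - lam^-1) ^+ 2 by rewrite mulr_ge0 ?sqr_ge0 // divr_ge0 // ltW.
have q : lam / 2 * (s - t) ^+ 2 <= lam / 2 * d by rewrite ler_pM2l // divr_gt0.
by lra.
Qed.

Lemma riem_ge0 h v : posdef h -> 0 <= riem (form11 h) v v.
Proof.
move=> [hh hp]; rewrite riem_form11 // mulr_ge0 //.
have -> : \sum_j \sum_k h j k * (zcoord v 0 j * conjc (zcoord v 0 k)) =
    (zcoord v *m h *m ctr (zcoord v)) 0 0.
  rewrite exchange_big [RHS]mxE; apply: eq_bigr => k _; rewrite [X in _ = X * _]mxE mulr_suml.
  apply: eq_bigr => j _; rewrite [ctr _ _ _]mxE [map_mx _ _ _ _]mxE; by ring.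
have [->|v0] := eqVneq (zcoord v) 0; first by rewrite !mul0mx mxE.
by have := hp _ v0; rewrite ltcE => /andP[_ /ltW].
Qed.

End Length.

(** * Distances *)

Section Distance.
Variables (R : realType) (n : nat) (B : 'M[R]_(n + n)) (g : nat -> 'rV[R]_(n + n) -> 'M[R[i]]_n).
Variable A : 'M[R[i]]_n.
Hypotheses (n0 : (0 < n)%N) (Bu : B \in unitmx) (gK : forall i, kahler B (g i)).
Local Notation pt := 'rV[R]_(n + n).
Local Notation C := R[i].
Local Notation M := (torus_mean B).
Local Notation u := (fun i => vol_density (g i)).
Let mM := mean_torus B.
Let mU := mean_unit R.
Hypotheses (Ap : posdef A) (mean_cvg : cvg_mx (fun k => mean_mx B (g k)) A).
Hypothesis volume_cvg : M (fun x => `|u k x - detR A|) @[k --> \oo] --> (0 : R).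
Variable H : R.
Hypothesis trace_bound : forall k x, trR (g k x) <= H.

Local Notation ginf := (fun _ : pt => A).
Local Notation d := (metric_gap g A).
Implicit Types (c : R -> pt) (cs : seq (R -> pt)).

Lemma speed_bound_cont : continuous (@speed_bound R n).
Proof.
apply: cont_sum => j _; rewrite (_ : (fun v => _) = fun v : pt => `|v 0 (lshift n j)| + `|v 0 (rshift n j)|).
  by apply: contD; apply: cont_norm; apply: cont_entry; exact: cont_id.
by apply/funext => v; rewrite /cabs mxE.
Qed.

Lemma speed_boundZ a (v : pt) : speed_bound (a *: v) = `|a| * speed_bound v.
Proof.
rewrite /speed_bound mulr_sumr; apply: eq_bigr => j _.
by rewrite /cabs !mxE /= !normrM mulrDr.
Qed.

Lemma moved_speed_cont k c z : C1_curve c ->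
  continuous (fun t => riem (form11 (g k (c t + z))) (derive1 c t) (derive1 c t)).
Proof.
move=> cC; have cc := C1_cont cC.
have cz : continuous (fun t => c t + z) by apply: cont_addmx; [exact: cc|exact: cont_const].
apply: riem_cont => [t|j l|j l|]; last by case: cC.
- by have [h _] := kahler_posdef (gK k) (c t + z).
- by have [h _] := g_cont (gK k) j l; exact: (cont_comp cz h).
- by have [_ h] := g_cont (gK k) j l; exact: (cont_comp cz h).
Qed.

Lemma flat_speed_cont c : C1_curve c ->
  continuous (fun t => riem (form11 A) (derive1 c t) (derive1 c t)).
Proof.
move=> cC; apply: (@riem_cont R n R (fun=> A)) => [t|j l|j l|]; last by case: cC.
- by case: Ap.
- exact: cont_cst.
- exact: cont_cst.
Qed.

Lemma gap_cont k c z : C1_curve c -> continuous (fun t => d k (c t + z)).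
Proof.
move=> cC; apply: (cont_comp (p := fun t => c t + z)); last exact: metric_gap_cont gK k.
by apply: cont_addmx; [exact: C1_cont|exact: cont_const].
Qed.

Lemma moved_curve_length c : C1_curve c -> exists2 Q : R, 0 < Q & forall k z lam, 0 < lam ->
  unit_integral (fun t => Num.sqrt (riem (kahler_form (g k) (c t + z)) (derive1 c t) (derive1 c t))) <=
  unit_integral (fun t => Num.sqrt (riem (kahler_form ginf (c t)) (derive1 c t) (derive1 c t))) + (2 * lam)^-1 +
  lam * Q * unit_integral (fun t => d k (c t + z)).
Proof.
move=> cC; have [cd cc'] := cC.
have [Q Q0 hQ] := compact_bounded_fun (mean_compact mU) (cont_compT cc' speed_bound_cont).
exists (Q ^+ 2); first by rewrite exprn_gt0.
move=> k z lam lam0; rewrite /kahler_form.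
have c5 := cont_sqrt (moved_speed_cont (k := k) (z := z) cC).
have c1 := cont_sqrt (flat_speed_cont cC).
have c2 : continuous (fun t => d k (c t + z)) by exact: gap_cont.
have c3 : continuous (fun t => lam * Q ^+ 2 * d k (c t + z)) by apply: contM => //; exact: cont_cst.
rewrite -(meanZ mU) // -[X in _ + X + _](mean_cst mU) -(meanD mU) //; last exact: cont_cst.
have c4 : continuous (fun t : R => Num.sqrt (riem (form11 A) (derive1 c t) (derive1 c t)) + (2 * lam)^-1).
  by apply: contD => //; exact: cont_cst.
rewrite -(meanD mU) //; apply: (mean_le mU).
- exact: c5.
- exact: contD.
move=> t t01; have gp := kahler_posdef (gK k) (c t + z).
apply: le_trans (sqrt_perturb (riem_ge0 (derive1 c t) gp) (riem_ge0 (derive1 c t) Ap) lam0) _.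
rewrite lerD2l -!mulrA ler_pM2l //.
have [hh _] := gp; have [hA _] := Ap.
have h1 := riem_dist_le (derive1 c t) hh hA.
have h2 : speed_bound (derive1 c t) ^+ 2 <= Q ^+ 2.
  rewrite ler_pXn2r ?nnegrE ?speed_bound_ge0 ?(ltW Q0) //.
  by apply: le_trans (hQ t t01); exact: ler_norm.
have h3 : d k (c t + z) * speed_bound (derive1 c t) ^+ 2 <= d k (c t + z) * Q ^+ 2.
  by rewrite ler_wpM2l // metric_gap_ge0.
rewrite /metric_gap in h3 *; move: h1 h3.
move: (\sum_j _) (`|_|) (speed_bound _ ^+ 2) => p q s; lra.
Qed.

Definition gap_integral cs k z : R := \sum_(c <- cs) unit_integral (fun t => d k (c t + z)).

Lemma gap_integral_ge0 x cs y k z : joins B x cs y -> 0 <= gap_integral cs k z.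
Proof.
rewrite /gap_integral; elim: cs x => [|c cs IH] x /=; first by rewrite big_nil.
move=> [cC _ h]; rewrite big_cons addr_ge0 //; last exact: IH h.
by apply: unit_integral_ge0 => t _; exact: metric_gap_ge0.
Qed.

Lemma riem_length_cons (w : pt -> ext_form R n) c cs : riem_length w (c :: cs) =
  unit_integral (fun t => Num.sqrt (riem (w (c t)) (derive1 c t) (derive1 c t))) + riem_length w cs.
Proof. by rewrite /riem_length big_cons. Qed.

Lemma moved_length x cs y : joins B x cs y -> exists2 Q : R, 0 < Q & forall k z lam, 0 < lam ->
  riem_length (kahler_form (g k)) [seq (fun t => c t + z) | c <- cs] <=
  riem_length (kahler_form ginf) cs + (size cs)%:R * (2 * lam)^-1 + lam * Q * gap_integral cs k z.
Proof.
rewrite /gap_integral; elim: cs x => [|c cs IH] x /=.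
  by exists 1 => // k z lam _; rewrite /riem_length !big_nil mul0r mulr0 !addr0.
move=> [cC _ h]; have [Q Q0 hQ] := IH _ h; have [Q' Q'0 hQ'] := moved_curve_length cC.
exists (Q + Q'); first exact: addr_gt0.
move=> k z lam lam0; rewrite !riem_length_cons big_cons translate_derive1.
have h1 := hQ k z _ lam0; have h2 := hQ' k z _ lam0.
have J0 := gap_integral_ge0 k z h; rewrite /gap_integral in J0.
have I0 : 0 <= unit_integral (fun t => d k (c t + z)).
  by apply: unit_integral_ge0 => t _; exact: metric_gap_ge0.
rewrite mulrSr.
set e' := unit_integral (fun t => d k (c t + z)) in h2 I0 *.
set e := \sum_(_ <- cs) _ in h1 J0 *.
have -> : lam * (Q + Q') * (e' + e) = lam * Q * e + lam * Q' * e' + (lam * Q * e' + lam * Q' * e) by ring.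
have p1 : 0 <= lam * Q * e' + lam * Q' * e.
  by rewrite addr_ge0 // !mulr_ge0 // ltW.
rewrite mulrDl mul1r; set s := (size cs)%:R / _ in h1 *; set s' := (2 * lam)^-1 in h2 *.
set q := _ + _ in p1 *; move: h1 h2 p1.
move: (unit_integral _) (unit_integral _) (riem_length _ _) (riem_length _ _) s s' => *; lra.
Qed.

Lemma segment_length k (a z : pt) : riem_length (kahler_form (g k)) [:: fun t => a + t *: z] <=
  Num.sqrt (8 * n%:R ^+ 2 * H) * speed_bound z.
Proof.
rewrite /riem_length big_seq1 segment_derive1.
have cC := segment_C1 a z.
have cs : continuous (fun t : R => Num.sqrt (riem (form11 (g k (a + t *: z))) z z)).
  apply: cont_sqrt; have cc := C1_cont cC.
  apply: riem_cont => [t|j l|j l|]; last exact: cont_const.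
  - by have [h _] := kahler_posdef (gK k) (a + t *: z).
  - by have [h _] := g_cont (gK k) j l; exact: (cont_comp cc h).
  - by have [_ h] := g_cont (gK k) j l; exact: (cont_comp cc h).
apply: (mean_le_cst mU cs) => t _.
have H0 : 0 <= H by apply: le_trans (trace_bound 0 0); exact: posdef_trace_ge0 (kahler_posdef (gK 0) 0).
have q0 := speed_bound_ge0 z.
rewrite -[X in _ * X]ger0_norm // -sqrtr_sqr -sqrtrM ?mulr_ge0 ?sqr_ge0 //.
apply: ler_wsqrtr; apply: le_trans (riem_trace_le _ (kahler_posdef (gK k) _)) _.
by rewrite ler_wpM2r ?sqr_ge0 // ler_wpM2l ?mulr_ge0 ?sqr_ge0.
Qed.

(** L^1 convergence of the metrics says nothing along a given curve.  Averaged
    over small translations, however, the integral of the gap along a curve is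
    an integral over a small parallelepiped, hence at most a constant times the
    mean over the torus; so some translation is good. *)
Lemma good_translation x cs y k (c0 eta : R) : joins B x cs y -> 0 < c0 -> c0 <= 1 -> 0 < eta ->
  exists2 s : pt, cube s & gap_integral cs k ((c0 *: s) *m B) <=
    (size cs)%:R * (c0^-1 ^+ (n + n) * M (d k)) + eta.
Proof.
move=> h c00 c01 eta0; have mC := mean_cube R (n + n).
pose F c (s : pt) := unit_integral (fun t => d k (c t + (c0 *: s) *m B)).
have cz : continuous (fun s : pt => (c0 *: s) *m B).
  by apply: cont_mulmx; apply: cont_scalemx; [exact: cont_cst|exact: cont_id].
have cpair c : C1_curve c -> continuous (fun p : pt * R => d k (c p.2 + (c0 *: p.1) *m B)).
  move=> cC; apply: (cont_comp (p := fun p : pt * R => c p.2 + (c0 *: p.1) *m B)); last exact: metric_gap_cont gK k.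
  apply: cont_addmx; first exact: (cont_compT (@cont_snd _ _) (C1_cont cC)).
  exact: (cont_compT (@cont_fst _ _) cz).
have Fc c : C1_curve c -> continuous (F c) by move=> cC; exact: (mean_cont mU (cpair c cC)).
have E c cs1 : (fun s : pt => gap_integral (c :: cs1) k ((c0 *: s) *m B)) =
    fun s => F c s + gap_integral cs1 k ((c0 *: s) *m B).
  by apply/funext => s; rewrite /gap_integral big_cons.
have E0 : (fun s : pt => gap_integral [::] k ((c0 *: s) *m B)) = fun=> 0.
  by apply/funext => s; rewrite /gap_integral big_nil.
have cG cs1 x1 : joins B x1 cs1 y -> continuous (fun s : pt => gap_integral cs1 k ((c0 *: s) *m B)).
  elim: cs1 x1 => [|c cs1 IH] x1 /=; first by rewrite E0 => _; exact: cont_cst.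
  by move=> [cC _ h1]; rewrite E; apply: contD; [exact: Fc|exact: IH h1].
have FM c : C1_curve c -> cube_integral (F c) <= c0^-1 ^+ (n + n) * M (d k).
  move=> cC; rewrite (mean_swap_cube mU (cpair c cC)).
  have cI : continuous (fun t : R => cube_integral (fun s : pt => d k (c t + (c0 *: s) *m B))).
    apply: (mean_cont mC (F := fun (t : R) (s : pt) => d k (c t + (c0 *: s) *m B))).
    exact: (swap_pair_cont (F := fun (s : pt) (t : R) => d k (c t + (c0 *: s) *m B)) (cpair c cC)).
  apply: (mean_le_cst mU cI) => t _.
  apply: torus_mean_zoom => //; first exact: metric_gap_cont gK k.
    exact: metric_gap_periodic gK k.
  exact: metric_gap_ge0.
have GM cs1 x1 : joins B x1 cs1 y -> cube_integral (fun s : pt => gap_integral cs1 k ((c0 *: s) *m B)) <=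
    (size cs1)%:R * (c0^-1 ^+ (n + n) * M (d k)).
  elim: cs1 x1 => [|c cs1 IH] x1 /=; first by rewrite E0 (mean_cst mC) mul0r.
  move=> [cC _ h1]; rewrite E (meanD mC); [|exact: Fc|exact: cG h1].
  by rewrite mulrSr mulrDl mul1r addrC; apply: lerD; [exact: IH h1|exact: FM].
apply: contrapT => hn.
have : (size cs)%:R * (c0^-1 ^+ (n + n) * M (d k)) + eta <=
   cube_integral (fun s : pt => gap_integral cs k ((c0 *: s) *m B)).
  apply: (mean_ge_cst mC (cG _ _ h)) => s cs1; rewrite leNgt; apply/negP => lt; apply: hn.
  by exists s => //; exact: ltW.
by move/le_trans => /(_ _ (GM _ _ h)); rewrite gerDl leNgt eta0.
Qed.

Lemma limn_esup_le (f : nat -> \bar R) (l : \bar R) :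
  (\forall k \near \oo, (f k <= l)%E) -> (limn_esup f <= l)%E.
Proof.
move=> fl; apply: (@le_trans _ _ (ereal_sup [set f k | k in [set k | (f k <= l)%E]])).
  by apply: ereal_inf_lbound; exists [set k | (f k <= l)%E].
by apply: ge_ereal_sup => _ [k kl <-].
Qed.

(** The curves of a chain are moved by a small good translation and joined to the
    endpoints by short segments, whose lengths are small because the metrics
    are uniformly bounded.  The four errors are made at most [e / 4] each. *)
Lemma distance_limsup x y :
  (limn_esup (fun k => riem_dist B (kahler_form (g k)) x y) <= riem_dist B (kahler_form ginf) x y)%E.
Proof.
apply: le_ereal_inf_tmp => _ [cs h <-]; apply/lee_addgt0Pr => e e0.
apply: limn_esup_le.
have [Q Q0 hQ] := moved_length h.
have [q q0 hq] : exists2 q : R, 0 < q & forall s : pt, cube s -> speed_bound (s *m B) <= q.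
  have cB : continuous (fun s : pt => speed_bound (s *m B)).
    by apply: (cont_compT _ speed_bound_cont); apply: cont_mulmx; exact: cont_id.
  have [q q0 hq] := compact_bounded_fun (mean_compact (mean_cube R (n + n))) cB.
  by exists q => // s /hq; apply: le_trans; exact: ler_norm.
pose S := Num.sqrt (8 * n%:R ^+ 2 * H); have S0 : 0 <= S := sqrtr_ge0 _.
pose N : R := (size cs)%:R; have N0 : 0 <= N by [].
(* Small enough for the two added segments: [2 * (S * (c0 * q)) <= e / 4]. *)
pose c0 := e / (8 * (S * q + 1) + e).
have Sq : 0 <= S * q by rewrite mulr_ge0 // ltW.
have c00 : 0 < c0 by rewrite divr_gt0 // addr_gt0 // mulr_gt0 //; lra.
have c01 : c0 <= 1 by rewrite ler_pdivrMr ?mul1r; lra.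
have c0S : 2 * (S * (c0 * q)) <= e / 4.
  have -> : 2 * (S * (c0 * q)) = 2 * e * (S * q) / (8 * (S * q + 1) + e).
    by rewrite /c0; field; rewrite gt_eqF //; lra.
  rewrite ler_pdivrMr; last by lra.
  by move: (S * q) Sq => t t0; nra.
pose lam := 2 * (N + 1) / e; have lam0 : 0 < lam by rewrite divr_gt0 // mulr_gt0 // ltr_wpDl.
have lamN : N * (2 * lam)^-1 <= e / 4.
  have -> : N * (2 * lam)^-1 = e * N / (4 * (N + 1)) by rewrite /lam; field; rewrite !gt_eqF //; lra.
  by rewrite ler_pdivrMr; nra.
pose eta := e / (4 * (lam * Q)); have lQ : 0 < lam * Q by rewrite mulr_gt0.
have eta0 : 0 < eta by rewrite divr_gt0 // mulr_gt0.
have lQe : lam * Q * eta = e / 4 by rewrite /eta; field; rewrite !gt_eqF.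
have small : \forall k \near \oo, `|lam * Q * (N * c0^-1 ^+ (n + n)) * M (d k)| <= e / 4.
  have := cvg0Z (lam * Q * (N * c0^-1 ^+ (n + n))) (metric_gap_cvg0 n0 gK Ap mean_cvg volume_cvg).
  by move/cvgr0Pnorm_le; apply; rewrite divr_gt0.
near=> k.
have sk : lam * Q * (N * c0^-1 ^+ (n + n)) * M (d k) <= e / 4.
  by apply: le_trans (ler_norm _) _; near: k.
have [s cs1 hs] := good_translation k h c00 c01 eta0.
set z := (c0 *: s) *m B in hs.
have zq : speed_bound z <= c0 * q.
  by rewrite /z -scalemxAl speed_boundZ ger0_norm ?(ltW c00) // ler_pM2l //; exact: hq.
apply: (@le_trans _ _ (riem_length (kahler_form (g k)) (moved_chain x cs y z))%:E).
  by apply: ereal_inf_lbound; exists (moved_chain x cs y z) => //; exact: moved_chain_joins.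
rewrite -EFinD lee_fin.
have -> : riem_length (kahler_form (g k)) (moved_chain x cs y z) =
    riem_length (kahler_form (g k)) [:: fun t => x + t *: z] +
    (riem_length (kahler_form (g k)) [seq (fun t => c t + z) | c <- cs] +
     riem_length (kahler_form (g k)) [:: fun t => (y + z) + t *: - z]).
  by rewrite /moved_chain /riem_length big_cons big_seq1 big_cat.
have l1 := segment_length k x z; have l2 := segment_length k (y + z) (- z).
rewrite -scaleN1r speed_boundZ normrN normr1 mul1r scaleN1r -/S in l2; rewrite -/S in l1.
have l3 := hQ k z _ lam0; rewrite -/N in l3 hs.
have l4 : S * speed_bound z <= S * (c0 * q) by rewrite ler_wpM2l.
have l5 : lam * Q * gap_integral cs k z <= lam * Q * (N * (c0^-1 ^+ (n + n) * M (d k)) + eta).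
  by rewrite ler_pM2l.
rewrite mulrDr lQe !mulrA in l5; rewrite !mulrA in sk.
move: l1 l2 l3 l4 l5 sk lamN c0S.
move: (riem_length _ _) (riem_length _ _) (riem_length _ _) (riem_length _ _) (lam * Q * gap_integral cs k z).
move: (S * speed_bound z) (S * (c0 * q)) (N / (2 * lam)) (_ * M (d k)) => *; lra.
Unshelve. all: by end_near. Qed.

End Distance.

(** * Integral bounds and the theorem *)

Section Hypotheses.
Variables (R : realType) (n : nat) (B : 'M[R]_(n + n)) (gh : 'rV[R]_(n + n) -> 'M[R[i]]_n).
Variable g : nat -> 'rV[R]_(n + n) -> 'M[R[i]]_n.
Hypotheses (n0 : (0 < n)%N) (Bu : B \in unitmx) (ghK : kahler B gh) (gK : forall i, kahler B (g i)).
Local Notation pt := 'rV[R]_(n + n).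
Local Notation C := R[i].
Local Notation M := (torus_mean B).
Let mM := mean_torus B.
Let tau i (x : pt) : R := trace_form (kahler_form gh x) (kahler_form (g i) x).
Variable Lambda : R.
Hypothesis Lambda0 : 0 < Lambda.

Definition mass : R := `|\det B| * (2 ^+ n * n`!%:R).

Lemma mass_gt0 : 0 < mass.
Proof. by rewrite mulr_gt0 ?det_pos // mulr_gt0 ?exprn_gt0 // ltr0n fact_gt0. Qed.

Lemma measure_integralE h f : kahler B h -> continuous f ->
  measure_integral B (kahler_form h) f = mass * M (fun x => f x * vol_density h x).
Proof.
move=> hK cf; rewrite /measure_integral torus_integralE /mass -mulrA.
rewrite -(meanZ mM (2 ^+ n * n`!%:R)); last by apply: contM => //; exact: u_cont hK.
congr (_ * M _); apply/funext => x.
by rewrite posdef_density; [rewrite /vol_density; ring|exact: kahler_posdef hK x].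
Qed.

Lemma tauE i x : tau i x = complex.Re (\tr (invmx (gh x) *m g i x)).
Proof. by rewrite /tau trace_form11 // posdef_unit //; exact: kahler_posdef ghK x. Qed.

Lemma tau_ge0 i x : 0 <= tau i x.
Proof.
by rewrite tauE; have [] := posdef_trace_compare (kahler_posdef (gK i) x) (kahler_posdef ghK x).
Qed.

Lemma tau_cont i : continuous (tau i).
Proof.
rewrite (_ : tau i = fun x => (vol_density gh x)^-1 *
    complex.Re (\sum_j \sum_k (\adj (gh x)) j k * g i x k j)).
  apply: contM.
    by apply: cont_inv; [exact: u_cont ghK|move=> x; rewrite gt_eqF // (u_gt0 ghK)].
  suff [] : contC (fun x : pt => \sum_j \sum_k (\adj (gh x)) j k * g i x k j) by [].
  apply: contC_sum => j; apply: contC_sum => k; apply: contC_mul.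
    exact: CkC_contC (adj_CkC ghK 0 j k).
  exact: (g_cont (gK i) k j).
apply/funext => x; rewrite tauE -Re_realM; congr (complex.Re _).
rewrite /invmx (posdef_unit (kahler_posdef ghK x)) -scalemxAl linearZ /= (kahler_det ghK) -fmorphV.
by congr (_ * _); apply: eq_bigr => j _; rewrite [LHS]mxE.
Qed.

Lemma tau_pow_cont i (r : R) : 0 < r -> continuous (fun x => tau i x `^ r).
Proof.
move=> r0; rewrite (_ : (fun x => _) = fun x => `|tau i x| `^ r).
  by apply: cont_norm_powR => //; exact: tau_cont.
by apply/funext => x; rewrite ger0_norm // tau_ge0.
Qed.

Lemma trace_compare : exists2 H : R, 0 < H & forall i x, trR (g i x) <= H * tau i x.
Proof.
have pt' : lattice_periodic B (fun x => trR (gh x)).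
  by move=> x l ll; rewrite (kahler_periodic ghK x ll).
have [H H0 hH] := periodic_bounded Bu (trace_cont ghK) pt'.
exists H => // i x; rewrite tauE.
have [t0 le] := posdef_trace_compare (kahler_posdef (gK i) x) (kahler_posdef ghK x).
by apply: le_trans le _; rewrite ler_wpM2r // (le_trans _ (hH x)) // ler_norm.
Qed.

(** Either [p'] is [p], and the volume density of the reference metric is bounded
    below; or [p] is infinite, and the integrand is bounded. *)
Lemma trace_moment (p : \bar R) (p' : R) : 0 < p' -> p = p'%:E \/ p = +oo%E ->
  (forall i, (Lnorm_torus B (kahler_form gh) p (tau i) <= Lambda%:E)%E) ->
  exists S : R, forall i, M (fun x => tau i x `^ p') <= S.
Proof.
move=> p'0 pE hL.
have ct i : continuous (fun x => tau i x `^ p') by exact: tau_pow_cont.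
have [E|E] := pE; rewrite E /= in hL.
  have [c c0 hc] := periodic_lower Bu (u_cont ghK) (vol_density_periodic ghK) (u_gt0 ghK).
  exists (Lambda `^ p' / (mass * c)) => i.
  rewrite ler_pdivlMr; last exact: mulr_gt0 mass_gt0 c0.
  have := hL i; rewrite lee_fin.
  rewrite measure_integralE //; last by apply: cont_norm_powR => //; exact: tau_cont.
  set J := mass * _ => hJ.
  have J0 : mass * c * M (fun x => tau i x `^ p') <= J.
    rewrite -mulrA ler_pM2l ?mass_gt0 // -(meanZ mM) //; apply: (mean_le mM).
    - by apply: contM => //; exact: cont_cst.
    - by apply: contM; [apply: cont_norm_powR => //; exact: tau_cont|exact: u_cont ghK].
    - move=> x _; rewrite ger0_norm ?tau_ge0 // mulrC ler_wpM2l ?powR_ge0 //.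
  rewrite mulrC; apply: le_trans J0 _.
  have Jp : 0 <= J.
    rewrite mulr_ge0 ?(ltW mass_gt0) //; apply: (mean_ge0 mM).
      by apply: contM; [apply: cont_norm_powR => //; exact: tau_cont|exact: u_cont ghK].
    by move=> x _; rewrite mulr_ge0 ?powR_ge0 // ltW // (u_gt0 ghK).
  have -> : J = (J `^ p'^-1) `^ p' by rewrite -powRrM mulVf ?gt_eqF // powRr1.
  by rewrite ge0_ler_powR ?nnegrE ?powR_ge0 // ltW.
exists (Lambda `^ p') => i; apply: (mean_le_cst mM) => // x _.
rewrite ge0_ler_powR ?nnegrE ?tau_ge0 ?(ltW p'0) ?(ltW Lambda0) //.
rewrite -lee_fin; apply: le_trans (hL i); apply: ereal_sup_ubound; exists x => //.
by rewrite ger0_norm // tau_ge0.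
Qed.

Lemma trace_sup : (forall i, (Lnorm_torus B (kahler_form gh) +oo (tau i) <= Lambda%:E)%E) ->
  exists H : R, forall i x, trR (g i x) <= H.
Proof.
move=> hL; have [H H0 hH] := trace_compare; exists (H * Lambda) => i x.
apply: le_trans (hH i x) _; rewrite ler_pM2l // -lee_fin; apply: le_trans (hL i).
by apply: ereal_sup_ubound; exists x => //; rewrite ger0_norm // tau_ge0.
Qed.

(** The determinant is at most the [n]-th power of the trace, so that moments of
    exponent [p'] of the trace bound moments of exponent [p' / n] of the volume
    density. *)
Lemma metric_moments (p' S : R) : n%:R < p' -> (forall i, M (fun x => tau i x `^ p') <= S) ->
  (exists T : R, forall i, M (fun x => trR (g i x)) <= T) /\
  (exists P : R, forall i, M (fun x => vol_density (g i) x `^ (p' / n%:R)) <= P).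
Proof.
move=> np hS; have [H H0 hH] := trace_compare.
have nR : 0 < n%:R :> R by rewrite ltr0n.
have p'0 : 0 < p' by exact: lt_trans np.
have p'1 : 1 <= p' by apply: le_trans (ltW np); rewrite ler1n.
have ct i : continuous (fun x => tau i x `^ p') by exact: tau_pow_cont.
have t0 i x : 0 <= trR (g i x) := posdef_trace_ge0 (kahler_posdef (gK i) x).
split.
  exists (H * (1 + S)) => i; apply: (@le_trans _ _ (M (fun x => H * (1 + tau i x `^ p')))).
    apply: (mean_le mM); [exact: trace_cont (gK i)|by apply: contZ; apply: contD => //; exact: cont_cst|].
    move=> x _; apply: le_trans (hH i x) _; rewrite ler_pM2l //.
    have := tau_ge0 i x; move: (tau i x) => t tp; case: (leP t 1) => h.
      by have := powR_ge0 t p'; lra.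
    have : t `^ 1 <= t `^ p' by rewrite ler_powR // ltW.
    by rewrite powRr1 //; lra.
  rewrite (meanZ mM); last by apply: contD => //; exact: cont_cst.
  rewrite ler_pM2l // (meanD mM) ?(mean_cst mM) //; last exact: cont_cst.
  by rewrite lerD2l.
exists (H `^ p' * S) => i; apply: (@le_trans _ _ (M (fun x => H `^ p' * tau i x `^ p'))).
  apply: (mean_le mM); [exact: upow_cont (gK i) _|exact: contZ|].
  move=> x _; have ux := u_gt0 (gK i) x.
  rewrite -powRM ?tau_ge0 ?(ltW H0) //.
  apply: (@le_trans _ _ (trR (g i x) `^ p')); last first.
    apply: ge0_ler_powR; rewrite ?nnegrE //; first exact: ltW.
    by rewrite mulr_ge0 ?tau_ge0 // ltW.
  have -> : trR (g i x) `^ p' = (trR (g i x) ^+ n) `^ (p' / n%:R).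
    by rewrite -powR_mulrn // -powRrM mulrCA divff ?gt_eqF // mulr1.
  rewrite ge0_ler_powR ?nnegrE ?exprn_ge0 ?(ltW ux) //; first by rewrite divr_ge0 // ltW.
  exact: posdef_det_le (kahler_posdef (gK i) x).
by rewrite (meanZ mM) // ler_pM2l ?powR_gt0.
Qed.

Lemma volume_lower : (forall i, Lambda^-1 <= volume B (kahler_form (g i))) ->
  forall i, Lambda^-1 / mass <= M (vol_density (g i)).
Proof.
move=> hV i; rewrite ler_pdivrMr ?mass_gt0 // mulrC; apply: le_trans (hV i) _.
rewrite /volume measure_integralE //; last exact: cont_cst.
rewrite le_eqVlt; apply/orP; left; apply/eqP; congr (_ * M _).
by apply/funext => x; rewrite mul1r.
Qed.

End Hypotheses.

(* [g i] is the metric of index i + 1. *)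
Theorem theorem1p1 (R : realType) (n : nat) (B : 'M[R]_(n + n))
    (gh : 'rV[R]_(n + n) -> 'M[R[i]]_n)
    (g : nat -> 'rV[R]_(n + n) -> 'M[R[i]]_n)
    (Lambda : R) (p : \bar R) :
  (0 < n)%N -> B \in unitmx ->
  kahler B gh -> (forall i, kahler B (g i)) ->
  1 < Lambda -> (n%:R%:E < p)%E ->
  (forall i, Lambda^-1 <= volume B (kahler_form (g i))) ->
  (forall i, (Lnorm_torus B (kahler_form gh) p
     (fun x => trace_form (kahler_form gh x) (kahler_form (g i) x))
     <= Lambda%:E)%E) ->
  (forall i x, - i.+1%:R^-1 <= scalar_curvature (g i) x) ->
  exists (ginf : 'rV[R]_(n + n) -> 'M[R[i]]_n) (phi : nat -> nat),
    [/\ kahler B ginf, flat (kahler_form ginf) &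
        {homo phi : k l / (k < l)%N}] /\
    [/\ cvg_currents B (fun k => kahler_form (g (phi k))) (kahler_form ginf),
        forall q : R, 0 < q -> (q%:E < p)%E ->
          Lnorm_torus B (kahler_form ginf) (q / n%:R)%:E
            (fun x => form_ratio (wedge_pow (kahler_form (g (phi k)) x) n)
                                 (wedge_pow (kahler_form ginf x) n) - 1)
            @[k --> \oo] --> 0%E,
        cvg_volume_weak B (fun k => kahler_form (g (phi k))) (kahler_form ginf) &
        (forall i, (Lnorm_torus B (kahler_form gh) +oo
           (fun x => trace_form (kahler_form gh x) (kahler_form (g i) x))
           <= Lambda%:E)%E) ->
        forall x y : 'rV[R]_(n + n),
          (limn_esup (fun k => riem_dist B (kahler_form (g (phi k))) x y)
           <= riem_dist B (kahler_form ginf) x y)%E].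
Proof.
move=> n0 Bu ghK gK Lambda1 np hvol hL hscal.
have L0 : 0 < Lambda by exact: lt_trans ltr01 Lambda1.
have nR : 0 < n%:R :> R by rewrite ltr0n.
have moments (q : R) : (q%:E < p)%E -> exists p' : R, [/\ q < p', n%:R < p' &
    exists S : R, forall i, torus_mean B (fun x => trace_form (kahler_form gh x) (kahler_form (g i) x) `^ p') <= S].
  move=> qp; have [p' [qp' np' pE]] : exists p' : R, [/\ q < p', n%:R < p' & p = p'%:E \/ p = +oo%E].
    move: qp np; case: (p) => [p'| |//]; first by rewrite !lte_fin => *; exists p'; split=> //; left.
    move=> _ _; exists (Num.max q n%:R + 1); split; last by right.
      by rewrite (@le_lt_trans _ _ (Num.max q n%:R)) ?le_max ?lexx // ltrDl.
    by rewrite (@le_lt_trans _ _ (Num.max q n%:R)) ?le_max ?lexx ?orbT // ltrDl.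
  exists p'; split=> //; exact: (trace_moment n0 Bu ghK gK L0 (lt_trans nR np') pE hL).
have [p0 [_ np0 [S0 hS0]]] := moments _ np.
have [[T hT] [P hP]] := metric_moments n0 Bu ghK gK np0 hS0.
have r1 : 1 < p0 / n%:R by rewrite ltr_pdivlMr // mul1r.
have v0 : 0 < Lambda^-1 / mass B by rewrite divr_gt0 ?invr_gt0 // mass_gt0.
have [A [phi [phih Ap mcvg vcvg]]] :=
  mean_mx_converges n0 Bu gK r1 v0 hscal hT hP (volume_lower Bu gK hvol).
pose g' k := g (phi k); have g'K k : kahler B (g' k) := gK (phi k).
exists (fun _ => A), phi; split; first split=> //; [exact: kahler_constant|exact: flat_constant|].
split.
- exact: (currents_cvg n0 Bu g'K Ap mcvg vcvg).
- move=> q q0 qp; have [p1 [qp1 np1 [S1 hS1]]] := moments _ qp.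
  have [_ [P1 hP1]] := metric_moments n0 Bu ghK gK np1 hS1.
  have s0 : 0 < q / n%:R by rewrite divr_gt0.
  have sr : q / n%:R < p1 / n%:R by rewrite ltr_pM2r // invr_gt0.
  have hP' k : torus_mean B (fun x => vol_density (g' k) x `^ (p1 / n%:R)) <= P1 := hP1 (phi k).
  have h := density_ratio_cvg g'K Ap vcvg hP' s0 sr.
  exact: h.
- exact: (volume_weak_cvg Bu g'K Ap vcvg).
- move=> hsup x y; have [H hH] := trace_sup n0 Bu ghK gK hsup.
  by apply: (distance_limsup n0 Bu g'K Ap mcvg vcvg (H := H)) => k z; exact: hH.
Qed.
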